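(* Let $\Omega\subset\mathbb{R}^2$ be a bounded connected domain with smooth boundary and let $C\neq 0$ be a real constant. Then there is no complete translating graph $\Sigma\subset\mathbb{R}^3$ with constant speed $C$ over $\Omega$. That is, there is no smooth function $u:\Omega\to\mathbb{R}$ satisfying $$\operatorname{div}\left(\frac{\nabla u}{\sqrt{1+|\nabla u|^2}}\right)=\frac{C}{\sqrt{1+|\nabla u|^2}}\quad\text{on }\Omega$$ whose graph $\Sigma=\{(x,u(x)):x\in\Omega\}\subset\mathbb{R}^3$ is complete.
   Context: A (vertically) translating graph with constant speed $C$ over a domain $\Omega\subset\mathbb{R}^2$ is the graph $\{(x,u(x)):x\in\Omega\}\subset\mathbb{R}^3$ of a smooth function $u:\Omega\to\mathbb{R}$ solving $\operatorname{div}\left(\frac{\nabla u}{\sqrt{1+|\nabla u|^2}}\right)=\frac{C}{\sqrt{1+|\nabla u|^2}}$. A surface in $\mathbb{R}^3$ is complete if it is complete as a Riemannian manifold (without boundary) with the metric induced from the Euclidean metric. *)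

(* Defs.v *)
From HB Require Import structures.
From mathcomp Require Import all_boot all_order all_algebra.
From mathcomp Require Import all_classical all_reals all_analysis.
Set Implicit Arguments.
Unset Strict Implicit.
Unset Printing Implicit Defensive.
Import Order.TTheory GRing.Theory Num.Theory.
Import numFieldNormedType.Exports.
Local Open Scope classical_set_scope.
Local Open Scope ring_scope.

(* The norm `|v| of MathComp-Analysis on 'rV[R]_n is the sup norm, which gives
   the usual topology and bounded sets but not the Euclidean metric. *)
Definition enorm (R : realType) (n : nat) (v : 'rV[R]_n) : R :=
  Num.sqrt (\sum_(i < n) v 0 i ^+ 2).

Definition partial (R : realType) (n : nat) (i : 'I_n.+1)
  (f : 'rV[R]_n.+1 -> R) : 'rV[R]_n.+1 -> R :=
  fun x => 'D_(delta_mx 0 i) f x.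

Definition grad (R : realType) (n : nat) (f : 'rV[R]_n.+1 -> R)
  (x : 'rV[R]_n.+1) : 'rV[R]_n.+1 :=
  \row_i partial i f x.

Definition divergence (R : realType) (n : nat)
  (X : 'rV[R]_n.+1 -> 'rV[R]_n.+1) (x : 'rV[R]_n.+1) : R :=
  \sum_i partial i (fun y => X y 0 i) x.

(* Functions on a subset D are total functions whose values outside D are
   irrelevant.  All the notions below are used on open sets D only, where the
   derivatives at a point of D depend on the values on D alone. *)
Fixpoint Ck_on (R : realType) (n : nat) (k : nat) (D : set 'rV[R]_n.+1)
  (f : 'rV[R]_n.+1 -> R) : Prop :=
  (forall x, D x -> {for x, continuous f}) /\
  (if k is k'.+1 then
     forall i : 'I_n.+1,
       (forall x, D x -> derivable f x (delta_mx 0 i)) /\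
       Ck_on k' D (partial i f)
   else True).

Definition smooth_on (R : realType) (n : nat) (D : set 'rV[R]_n.+1)
  (f : 'rV[R]_n.+1 -> R) : Prop :=
  forall k : nat, Ck_on k D f.

Definition boundary (T : topologicalType) (A : set T) : set T :=
  closure A `\` interior A.

(* Near each of its boundary points, D is the sublevel set {rho < 0} of a smooth
   function rho without critical points. *)
Definition smooth_boundary (R : realType) (n : nat) (D : set 'rV[R]_n.+1)
  : Prop :=
  forall p, boundary D p ->
  exists (U : set 'rV[R]_n.+1) (rho : 'rV[R]_n.+1 -> R),
    [/\ open U, U p, smooth_on U rho,
        forall x, U x -> grad rho x != 0 &
        D `&` U = [set x | U x /\ rho x < 0]].

Definition domain (R : realType) (n : nat) (D : set 'rV[R]_n.+1) : Prop :=
  [/\ open D, connected D & D !=set0].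

Definition translator_eq (R : realType) (n : nat) (D : set 'rV[R]_n.+1)
  (C : R) (u : 'rV[R]_n.+1 -> R) : Prop :=
  let W x := Num.sqrt (1 + enorm (grad u x) ^+ 2) in
  forall x, D x ->
    divergence (fun y => (W y)^-1 *: grad u y) x = C / W x.

Definition graph_over (R : realType) (D : set 'rV[R]_2) (u : 'rV[R]_2 -> R)
  : set 'rV[R]_3 :=
  [set (row_mx x (u x)%:M : 'rV[R]_(2 + 1)) | x in D].

Definition C1_curve (R : realType) (n : nat) (g : R -> 'rV[R]_n.+1) : Prop :=
  (forall t, derivable g t 1) /\ continuous (derive1 g).

(* Only the restriction of g to [0, 1] matters.  A C^1 map on a closed interval
   is the restriction of a C^1 map on the whole line. *)
Definition piecewise_C1 (R : realType) (n : nat) (g : R -> 'rV[R]_n.+1)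
  : Prop :=
  exists s : seq R,
    [/\ path <%R 0 s, last 0 s = 1 &
        forall i, (i < size s)%N ->
        exists h : R -> 'rV[R]_n.+1, C1_curve h /\
          {in `[nth 0 (0 :: s) i, nth 0 (0 :: s) i.+1], g =1 h}].

(* derive1 g may be meaningless at the break points and at 0 and 1, which form a
   Lebesgue-null set. *)
Definition curve_length (R : realType) (n : nat) (g : R -> 'rV[R]_n.+1)
  : \bar R :=
  (\int[@lebesgue_measure R]_(t in `[0%R, 1%R]) (enorm (derive1 g t))%:E)%E.

(* When S is an embedded submanifold, this is the Riemannian distance of the
   metric induced on S by the Euclidean one; it is +oo when no piecewise C^1 curve in S joins p to q. *)
Definition intrinsic_dist (R : realType) (n : nat) (S : set 'rV[R]_n.+1)
  (p q : 'rV[R]_n.+1) : \bar R :=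
  ereal_inf [set curve_length g | g in
    [set g : R -> 'rV[R]_n.+1 |
      [/\ piecewise_C1 g, {in `[0, 1], forall t, S (g t)},
          g 0 = p & g 1 = q]]].

Definition intrinsic_cauchy (R : realType) (n : nat) (S : set 'rV[R]_n.+1)
  (a : nat -> 'rV[R]_n.+1) : Prop :=
  forall e : R, 0 < e -> exists N : nat, forall i j : nat,
    (N <= i)%N -> (N <= j)%N -> (intrinsic_dist S (a i) (a j) < e%:E)%E.

Definition intrinsic_cvg (R : realType) (n : nat) (S : set 'rV[R]_n.+1)
  (a : nat -> 'rV[R]_n.+1) (p : 'rV[R]_n.+1) : Prop :=
  forall e : R, 0 < e -> exists N : nat, forall i : nat,
    (N <= i)%N -> (intrinsic_dist S (a i) p < e%:E)%E.

(* By Hopf-Rinow, for an embedded submanifold S this metric completeness is the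
   same as geodesic completeness. *)
Definition intrinsically_complete (R : realType) (n : nat)
  (S : set 'rV[R]_n.+1) : Prop :=
  forall a : nat -> 'rV[R]_n.+1, (forall i, S (a i)) ->
    intrinsic_cauchy S a -> exists2 p, S p & intrinsic_cvg S a p.

(* Main.v *)
Require Import Defs.
From mathcomp Require Import all_boot all_order all_algebra.
From mathcomp Require Import all_classical all_reals all_analysis.
From mathcomp Require Import measurable_realfun ring lra.
Import Order.TTheory GRing.Theory Num.Theory.
Import numFieldNormedType.Exports.
Local Open Scope classical_set_scope.
Local Open Scope ring_scope.

(** Write [W] for [sqrt (1 + |grad u| ^+ 2)] and [X] for [grad u / W], so that the equation
    reads [div X = C / W]. The proof finds, for a complete graph over a bounded domain, a
    compactly supported vector field on the plane whose divergence is positive somewhere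
    and almost nonnegative everywhere, although its mean is zero ([divergence_mean]).

    The place is a small cap of the domain. Let [p] be a point of the closure farthest from
    the origin, and let [x] be the position relative to [- p]. By the parallelogram law
    [|x| ^+ 2] is maximal at [p] only, so [|x| ^+ 2 > s0] cuts out a piece of the domain so
    close to [p] that it lies in a neighbourhood where the domain is [rho < 0] and
    [grad rho] is almost constant.

    The positive field is built from [g], the positive part of [|x| ^+ 2 - s0]. The
    tangential projection to the graph of the horizontal field [g ^+ 2 x], times the area
    density, is [Z = g ^+ 2 (W x - (x . grad u) X)] in the plane. Its divergence involves
    no second derivatives of [u] thanks to the equation, and is at least [g ^+ 2 W / 2] if
    the cap is small compared with [C] ([divZ_ge]). A weight [m = 1 / (1 + (eps u) ^+ 2)]
    has small logarithmic derivative along the graph, so [div (m Z) >= m g ^+ 2 W / 4].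

    Towards the curved part of the boundary [Z] has to be cut off. Completeness provides
    functions [chi] with compact support in the domain whose gradient along the graph is at
    most [delta] ([cutoff_exists]): by the argument of Hopf and Rinow the end of the domain
    is infinitely far away ([complete_no_escape]), and a truncated distance to it is
    Lipschitz and can be smoothed by averaging. The cut-off costs at most
    [delta m g ^+ 2 W], but the integral of [W] over the cap may be infinite, so that this
    error must be controlled pointwise.

    It is controlled by a second field. Let [eta] be a bounded function of [u] with
    derivative [m] in [u]. Then [- div (eta X) = - m |grad u| ^+ 2 / W - eta C / W] is [- m W] up to
    bounded terms, and adding a large constant field gives [E = c grad rho (p) - eta X] that
    points out of the domain near [p]. Hence a planar cut-off [ze] of [E], as close to the
    boundary as one likes, only contributes a negative term to the divergence of
    [g ^+ 2 ze E], and with [Q = chi m Z - 2 delta g ^+ 2 ze E] one gets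
    [div Q >= chi m g ^+ 2 / 4 - const * delta], where the constant does not depend on
    [delta] ([div_field_ge]). For small [delta] this contradicts the vanishing mean
    ([no_complete_cap]).

    Lengths on the graph are handled through polygonal paths in the domain ([gpath]), whose
    lifts are compared with the curves that define the intrinsic distance only at the end;
    functions of row vectors are read in coordinates on [R * R]. *)

Set Implicit Arguments.
Unset Strict Implicit.
Unset Printing Implicit Defensive.

(** * Functions of two variables: chain rule and symmetry of second derivatives *)

Lemma is_derive_continuous (R : realType) (f : R -> R) (x l : R) :
  is_derive x 1 f l -> {for x, continuous f}.
Proof. by case=> df _; apply/differentiable_continuous/derivable1_diffP. Qed.

Lemma MVT_between (R : realType) (f df : R -> R) (a b : R) :
  (forall x, Num.min a b <= x <= Num.max a b -> is_derive x 1 f (df x)) ->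
  exists2 c, Num.min a b <= c <= Num.max a b & f b - f a = df c * (b - a).
Proof.
wlog ab : a b / a <= b => [hw|].
  case/orP: (le_total a b) => [/hw//|/hw h]; rewrite minC maxC => /h[c cI e].
  by exists c => //; rewrite -[LHS]opprB e -mulrN opprB.
rewrite min_l// max_r// => hd.
have [c cI e] : exists2 c, c \in `[a, b] & f b - f a = df c * (b - a).
  apply: MVT_segment => // [x|].
    by rewrite in_itv/= => /andP[ax xb]; apply: hd; rewrite !ltW.
  apply: continuous_in_subspaceT => x; rewrite inE/= in_itv/= => xI.
  exact: is_derive_continuous (hd _ xI).
by exists c => //; move: cI; rewrite in_itv.
Qed.

Definition is_d1 (R : realType) (f : R * R -> R) (z : R * R) (l : R) :=
  is_derive z.1 (1 : R) (fun a => f (a, z.2)) l.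
Definition is_d2 (R : realType) (f : R * R -> R) (z : R * R) (l : R) :=
  is_derive z.2 (1 : R) (fun b => f (z.1, b)) l.

(** The partial derivatives are part of the data, as total functions: the fields below
    are built by the rules of calculus, which then also produce their derivatives. *)
Definition C1_on (R : realType) (D : set (R * R)) (f f1 f2 : R * R -> R) :=
  forall z, D z -> [/\ is_d1 f z (f1 z), is_d2 f z (f2 z),
    {for z, continuous f1} & {for z, continuous f2}].

Lemma near2P (R : realType) (P : set (R * R)) (w : R * R) :
  (\forall z \near w, P z) <-> exists2 r : R, 0 < r &
    forall x y, `|w.1 - x| < r -> `|w.2 - y| < r -> P (x, y).
Proof.
have [h1 h2] := nbhs_ballP w P; split=> [/h1[r /= r0 h]|[r r0 h]].
  by exists r => // x y hx hy; apply: h; split.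
by apply: h2; exists r => //= -[x y] [/= hx hy]; apply: h.
Qed.

Lemma continuous2P (R : realType) (f : R * R -> R) (w : R * R) :
  {for w, continuous f} <-> forall e, 0 < e -> exists2 r : R, 0 < r &
    forall x y, `|w.1 - x| < r -> `|w.2 - y| < r -> `|f w - f (x, y)| < e.
Proof.
split=> [c e e0|h].
  by move/cvgrPdist_lt: c => /(_ _ e0) /(near2P (fun z => `|f w - f z| < e)).
by apply/cvgrPdist_lt => e e0; apply/near2P; exact: h.
Qed.

Lemma between_dist (R : realType) (a b c x e: R) : Num.min a b <= c <= Num.max a b ->
  `|x - a| < e -> `|x - b| < e -> `|x - c| < e.
Proof.
move=> /andP[]; rewrite ge_min le_max => h1 h2; rewrite !ltr_norml.
by move=> /andP[? ?] /andP[? ?]; apply/andP; split;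
  case/orP: h1 => h1; case/orP: h2 => h2; lra.
Qed.

Lemma continuous_slice1 (R : realType) (f : R * R -> R) (x y : R) :
  {for (x, y), continuous f} -> {for x, continuous (fun s => f (s, y))}.
Proof.
move=> /continuous2P h; apply/cvgrPdist_lt => e /h[r /= r0 hr].
by apply/nbhs_ballP; exists r => // s /= hs; apply: hr; rewrite // subrr normr0.
Qed.

(** An increment of [f] splits along a horizontal and a vertical segment; on each of them
    the mean value theorem identifies the difference quotient with a nearby value of a
    partial derivative, so continuity of the latter at one point suffices. *)
Lemma chain2 (R : realType) (f f1 f2 : R * R -> R) (a b : R -> R) (t0 a' b' : R) :
  (\forall z \near (a t0, b t0), is_d1 f z (f1 z)) ->
  (\forall z \near (a t0, b t0), is_d2 f z (f2 z)) ->
  {for (a t0, b t0), continuous f1} -> {for (a t0, b t0), continuous f2} ->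
  is_derive t0 1 a a' -> is_derive t0 1 b b' ->
  is_derive t0 1 (fun t => f (a t, b t))
    (f1 (a t0, b t0) * a' + f2 (a t0, b t0) * b').
Proof.
move=> /near2P/=[r1 r10 d1] /near2P/=[r2 r20 d2] c1 c2 da db.
have /is_derive1_caratheodory[ha [eqa cha ha0]] := da.
have /is_derive1_caratheodory[hb [eqb chb hb0]] := db.
set a0 := a t0 in d1 d2 c1 c2 eqa eqb *.
set b0 := b t0 in d1 d2 c1 c2 eqa eqb *.
pose q1 (z : R * R) := if z.1 == a0 then f1 (a0, b0) else
   (f z - f (a0, z.2)) / (z.1 - a0).
pose q2 (y : R) := if y == b0 then f2 (a0, b0) else
   (f (a0, y) - f (a0, b0)) / (y - b0).
have cq1 : {for (a0, b0), continuous q1}.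
  apply/continuous2P => e e0.
  have /continuous2P/(_ _ e0)/=[r r0 hr] := c1.
  exists (Num.min r r1) => [|x y/=]; first by rewrite lt_min r0 r10.
  rewrite !lt_min => /andP[x1 x2] /andP[y1 y2].
  rewrite /q1 eqxx/=; case: eqP => [_|/eqP xa]; first by rewrite subrr normr0.
  have [|c cI ->] := @MVT_between _ (fun s => f (s, y)) (fun s => f1 (s, y)) a0 x.
    move=> s sI; apply: (d1 s y) => //=.
    by apply: between_dist sI _ x2; rewrite subrr normr0.
  rewrite mulfK ?subr_eq0//; apply: hr => //=.
  by apply: between_dist cI _ x1; rewrite subrr normr0.
have cq2 : {for b0, continuous q2}.
  apply/cvgrPdist_lt => /= e e0.
  have /continuous2P/(_ _ e0)/=[r r0 hr] := c2.
  have m0 : 0 < Num.min r r2 by rewrite lt_min r0 r20.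
  apply/nbhs_ballP; exists (Num.min r r2) => //= y.
  rewrite /ball/= !lt_min => /andP[y1 y2].
  rewrite /q2 eqxx/=; case: eqP => [_|/eqP xa]; first by rewrite subrr normr0.
  have [|c cI ->] := @MVT_between _ (fun s => f (a0, s)) (fun s => f2 (a0, s)) b0 y.
    move=> s sI; apply: (d2 a0 s) => //=; first by rewrite subrr normr0.
    by apply: between_dist sI _ y2; rewrite subrr normr0.
  rewrite mulfK ?subr_eq0//; apply: hr => //=; first by rewrite subrr normr0.
  by apply: between_dist cI _ y1; rewrite subrr normr0.
have ca : {for t0, continuous a} by exact: is_derive_continuous da.
have cb : {for t0, continuous b} by exact: is_derive_continuous db.
apply/is_derive1_caratheodory.
exists (fun t => q1 (a t, b t) * ha t + q2 (b t) * hb t); split.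
- move=> t; rewrite -/a0 -/b0 mulrDl -!mulrA -eqa -eqb /q1 /q2 /=.
  have [->|ax] := eqVneq (a t) a0.
    have [->|bx] := eqVneq (b t) b0; first by rewrite !subrr !mulr0 addr0.
    by rewrite subrr mulr0 add0r mulfVK// subr_eq0.
  rewrite mulfVK ?subr_eq0//.
  have [->|bx] := eqVneq (b t) b0; first by rewrite subrr mulr0 addr0.
  by rewrite mulfVK ?subr_eq0// subrKA.
- apply: cvgD.
    apply: cvgM => //.
    have cab : {for t0, continuous (fun t => (a t, b t))}.
      exact: (cvg_pair ca cb).
    exact: (@continuous_comp _ _ _ (fun t => (a t, b t)) q1 t0 cab cq1).
  apply: cvgM => //.
  exact: (@continuous_comp _ _ _ b q2 t0 cb cq2).
- by rewrite /q1 /q2 /= !eqxx ha0 hb0.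
Qed.

Lemma C1_on_continuous (R : realType) D (f f1 f2 : R * R -> R) z :
  open D -> C1_on D f f1 f2 -> D z -> {for z, continuous f}.
Proof.
case: z => a b oD fC Dz.
have [/= _ _ /continuous2P/(_ _ ltr01)/=[r1 r10 h1]
             /continuous2P/(_ _ ltr01)/=[r2 r20 h2]] := fC _ Dz.
have /near2P/=[rD rD0 hD] : nbhs (a, b) D by apply: open_nbhs_nbhs.
pose M := 1 + `|f1 (a, b)| + `|f2 (a, b)|.
have M0 : 0 < M by rewrite /M -addrA ltr_wpDr// addr_ge0.
apply/continuous2P => /= e e0.
pose r := Num.min (Num.min rD (e / (2 * M))) (Num.min r1 r2).
have r0 : 0 < r by rewrite !lt_min rD0 r10 r20 divr_gt0//= mulr_gt0.
exists r => //= x y.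
rewrite !lt_min => /andP[/andP[xD xe] /andP[x1 x2]] /andP[/andP[yD ye] /andP[y1 y2]].
have cc : forall t r : R, 0 < r -> `|t - t| < r by move=> *; rewrite subrr normr0.
have [|c cI e1] := @MVT_between _ (fun s => f (s, y)) (fun s => f1 (s, y)) a x.
  move=> s sI; have [] // := fC (s, y); apply: hD => //=.
  by apply: between_dist sI _ xD; exact: cc.
have [|d dI e2] := @MVT_between _ (fun s => f (a, s)) (fun s => f2 (a, s)) b y.
  move=> s sI; have [] // := fC (a, s); apply: hD => //=; first exact: cc.
  by apply: between_dist sI _ yD; exact: cc.
have k1 : `|f1 (c, y)| <= M.
  have /h1 : `|a - c| < r1 by apply: between_dist cI _ x1; exact: cc.
  move=> /(_ y y1); have := ler_distD (f1 (a, b)) (f1 (c, y)) 0.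
  rewrite !subr0 distrC /M; have := normr_ge0 (f2 (a, b)); lra.
have k2 : `|f2 (a, d)| <= M.
  have := h2 a d (cc _ _ r20) (between_dist dI (cc _ _ r20) y2).
  have := ler_distD (f2 (a, b)) (f2 (a, d)) 0.
  rewrite !subr0 distrC /M; have := normr_ge0 (f1 (a, b)); lra.
have -> : f (a, b) - f (x, y) = - (f1 (c, y) * (x - a)) - f2 (a, d) * (y - b).
  by rewrite -e1 -e2; ring.
have l1 : `|f1 (c, y) * (x - a)| <= M * `|a - x|.
  by rewrite normrM (distrC x) ler_wpM2r.
have l2 : `|f2 (a, d) * (y - b)| <= M * `|b - y|.
  by rewrite normrM (distrC y) ler_wpM2r.
have := ler_normB (- (f1 (c, y) * (x - a))) (f2 (a, d) * (y - b)).
rewrite normrN => l3.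
move: xe ye; rewrite !ltr_pdivlMr ?mulr_gt0// => xe ye; lra.
Qed.

(** The second difference of [f] over a small square equals, by the mean value theorem
    applied in either order, [h ^+ 2] times a value of either mixed derivative. *)
Lemma schwarz (R : realType) (f f1 f2 f12 f21 : R * R -> R) (z : R * R) :
  (\forall w \near z, [/\ is_d1 f w (f1 w), is_d2 f w (f2 w),
     is_d2 f1 w (f12 w) & is_d1 f2 w (f21 w)]) ->
  {for z, continuous f12} -> {for z, continuous f21} -> f12 z = f21 z.
Proof.
case: z => a b /near2P/=[r r0 hd] c12 c21.
apply/eqP; rewrite -subr_eq0 -normr_le0; apply/ler_addgt0Pl => e e0; rewrite addr0.
have e20 : 0 < e / 2 by rewrite divr_gt0.
have /continuous2P/(_ _ e20)/=[r1 r10 h1] := c12.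
have /continuous2P/(_ _ e20)/=[r2 r20 h2] := c21.
pose h := Num.min r (Num.min r1 r2) / 2.
have h0 : 0 < h by rewrite divr_gt0// !lt_min r0 r10.
have : h < Num.min r (Num.min r1 r2).
  by rewrite /h ltr_pdivrMr// ltr_pMr ?ltr1n// !lt_min r0 r10.
rewrite !lt_min => /and3P[hr hr1 hr2].
have near_ab x : Num.min a (a + h) <= x <= Num.max a (a + h) -> `|a - x| <= h.
  by rewrite min_l ?max_r ?lerDl ?(ltW h0)// => /andP[? ?]; rewrite ler_norml; lra.
have near_b x : Num.min b (b + h) <= x <= Num.max b (b + h) -> `|b - x| <= h.
  by rewrite min_l ?max_r ?lerDl ?(ltW h0)// => /andP[? ?]; rewrite ler_norml; lra.
have ah : `|a - (a + h)| <= h by rewrite ler_norml; lra.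
have bh : `|b - (b + h)| <= h by rewrite ler_norml; lra.
have aa : `|a - a| <= h by rewrite subrr normr0 ltW.
have bb : `|b - b| <= h by rewrite subrr normr0 ltW.
have inb x y (k1 : `|a - x| <= h) (k2 : `|b - y| <= h) :=
  hd x y (le_lt_trans k1 hr) (le_lt_trans k2 hr).
have [|x xI e1] := @MVT_between _ (fun s => f (s, b + h) - f (s, b))
  (fun s => f1 (s, b + h) - f1 (s, b)) a (a + h).
  move=> s /near_ab sI; apply: is_deriveB.
    by have [] := (inb _ _ sI bh).
  by have [] := (inb _ _ sI bb).
have [|y yI e2] := @MVT_between _ (fun s => f1 (x, s)) (fun s => f12 (x, s)) b (b + h).
  by move=> s /near_b sI; have [] := inb _ _ (near_ab _ xI) sI.
have [|y' yI' e3] := @MVT_between _ (fun s => f (a + h, s) - f (a, s))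
  (fun s => f2 (a + h, s) - f2 (a, s)) b (b + h).
  move=> s /near_b sI; apply: is_deriveB.
    by have [] := (inb _ _ ah sI).
  by have [] := (inb _ _ aa sI).
have [|x' xI' e4] := @MVT_between _ (fun s => f2 (s, y')) (fun s => f21 (s, y')) a (a + h).
  by move=> s /near_ab sI; have [] := (inb _ _ sI (near_b _ yI')).
have E : f12 (x, y) = f21 (x', y').
  move: e1 e3; rewrite e2 e4 !(addrC _ h) !addrK => e1 e3.
  apply: (@mulIf _ (h * h)); first by rewrite mulf_neq0// gt_eqF.
  by rewrite [LHS]mulrA [RHS]mulrA -e1 -e3; ring.
have k1 : `|f12 (a, b) - f12 (x, y)| < e / 2.
  apply: h1; first exact: le_lt_trans (near_ab _ xI) _.
  exact: le_lt_trans (near_b _ yI) _.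
have k2 : `|f21 (a, b) - f21 (x', y')| < e / 2.
  apply: h2; first exact: le_lt_trans (near_ab _ xI') _.
  exact: le_lt_trans (near_b _ yI') _.
rewrite E in k1.
have := ler_distD (f21 (x', y')) (f12 (a, b)) (f21 (a, b)).
rewrite (distrC (f21 (x', y'))); lra.
Qed.

(** * Integrals over segments and the divergence theorem *)

(** The comparison point [(x, y)] may lie outside [K]: this is what perturbing the
    vertices of a path, or averaging over a square, requires. *)
Lemma compact_unif_close (R : realType) (K : set (R * R)) (f : R * R -> R) (e : R) :
  compact K -> (forall z, K z -> {for z, continuous f}) -> 0 < e ->
  exists2 r : R, 0 < r & forall z, K z -> forall x y,
    `|z.1 - x| < r -> `|z.2 - y| < r -> `|f z - f (x, y)| < e.
Proof.
move=> cK cf e0.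
have e20 : 0 < e / 2 by rewrite divr_gt0.
pose P (r : R) (z : R * R) := forall x y,
    `|z.1 - x| < r -> `|z.2 - y| < r -> `|f z - f (x, y)| < e.
have unif (a b x y s r : R) : (forall x' y', `|a - x'| < r -> `|b - y'| < r ->
    `|f (a, b) - f (x', y')| < e / 2) -> `|a - x| < r / 2 -> `|b - y| < r / 2 ->
    s <= r / 2 -> P s (x, y).
  move=> hr ax yb sr x' y' /= h1 h2.
  have k1 : `|f (a, b) - f (x, y)| < e / 2.
    by apply: hr; [move: (normr_ge0 (a - x))|move: (normr_ge0 (b - y))]; lra.
  have k2 : `|f (a, b) - f (x', y')| < e / 2.
    apply: hr.
      have := ler_distD x a x'; lra.
    have := ler_distD y b y'; lra.
  have := ler_distD (f (a, b)) (f (x, y)) (f (x', y')).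
  rewrite (distrC (f (x, y)) (f (a, b))); lra.
have hnear : at_right (0:R) [set r | K `<=` P r].
  apply: ((compact_near_coveringP K).1 cK R (at_right (0:R)) P).
  move=> z Kz; move: (Kz) => /cf /continuous2P/(_ _ e20)[r r0 hr].
  have r20 : 0 < r / 2 by rewrite divr_gt0.
  exists ([set w : R * R | `|z.1 - w.1| < r / 2 /\ `|z.2 - w.2| < r / 2],
          [set s : R | s <= r / 2]) => /=.
    split; last exact: nbhs_right_le.
    by apply/near2P; exists (r / 2).
  case: z {Kz} hr => a b /= hr [[x y] s]/= [[ax yb] sr].
  apply: (unif a b x y s r) => //.
have [r [r0 hr]] := filter_ex (filterI (nbhs_right_gt 0) hnear).
by exists r.
Qed.

Definition unif_cont (R : realType) (f : R * R -> R) :=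
  forall e, 0 < e -> exists2 r : R, 0 < r & forall x y x' y',
    `|x - x'| < r -> `|y - y'| < r -> `|f (x, y) - f (x', y')| < e.

Lemma unif_cont_continuous (R : realType) (f : R * R -> R) : unif_cont f -> continuous f.
Proof.
move=> h [a b]; apply/continuous2P => e /h[r r0 hr].
by exists r => // x y h1 h2; apply: hr.
Qed.

Lemma compact_box (R : realType) (M : R) :
  compact [set z : R * R | `|z.1| <= M /\ `|z.2| <= M].
Proof.
suff -> : [set z : R * R | `|z.1| <= M /\ `|z.2| <= M] = `[-M, M] `*` `[-M, M].
  by apply: compact_setX; exact: segment_compact.
by apply/seteqP; split => -[x y]/=; rewrite !in_itv/= !ler_norml.
Qed.

Lemma compact_support_unif_cont (R : realType) (f : R * R -> R) (M : R) :
  continuous f ->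
  (forall x y, M < `|x| \/ M < `|y| -> f (x, y) = 0) -> unif_cont f.
Proof.
move=> cf f0 e e0.
have [|r r0 hr] := @compact_unif_close R _ f e (@compact_box R M) _ e0.
  by move=> z _; exact: cf.
exists r => // x y x' y' h1 h2.
have [hx|hx] := leP `|x| M; have [hy|hy] := leP `|y| M; first exact: (hr (x, y)).
all: have [hx'|hx'] := leP `|x'| M; have [hy'|hy'] := leP `|y'| M;
  try by rewrite distrC; apply: (hr (x', y')); rewrite //= distrC.
all: by rewrite (f0 x y) ?(f0 x' y') ?subrr ?normr0//; auto.
Qed.

Section segment_integral.
Variable R : realType.
Implicit Types (k l K : R -> R) (a b e : R).

Definition seg_int a b k := \int[@lebesgue_measure R]_(x in `[a, b]) k x.

Lemma continuous_integrable a b k : continuous k ->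
  (@lebesgue_measure R).-integrable `[a, b] (EFin \o k).
Proof.
move=> ck; apply: continuous_compact_integrable; first exact: segment_compact.
exact: continuous_subspaceT.
Qed.

Lemma seg_int_FTC a b k K : a < b -> continuous k ->
  (forall x, a <= x <= b -> is_derive x 1 K (k x)) ->
  seg_int a b k = K b - K a.
Proof.
move=> ab ck hK.
have cK x : a <= x <= b -> {for x, continuous K}.
  by move=> /hK; exact: is_derive_continuous.
have := @continuous_FTC2 R k K a b ab.
rewrite /seg_int /Rintegral => -> //.
- exact: continuous_subspaceT.
- split.
  + by move=> x; rewrite in_itv/= => /andP[ax xb]; case: (hK x); rewrite ?ltW//.
  + by apply: cvg_at_right_filter; apply: cK; rewrite lexx ltW.
  + by apply: cvg_at_left_filter; apply: cK; rewrite lexx ltW.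
- move=> x; rewrite in_itv/= => /andP[ax xb]; rewrite derive1E.
  by apply: derive_val; apply: hK; rewrite !ltW.
Qed.

Lemma seg_intB a b k l : continuous k -> continuous l ->
  seg_int a b (fun x => k x - l x) = seg_int a b k - seg_int a b l.
Proof. by move=> ck cl; apply: RintegralB => //; exact: continuous_integrable. Qed.

Lemma seg_intD a b k l : continuous k -> continuous l ->
  seg_int a b (fun x => k x + l x) = seg_int a b k + seg_int a b l.
Proof. by move=> ck cl; apply: RintegralD => //; exact: continuous_integrable. Qed.

Lemma seg_intZ a b c k : continuous k ->
  seg_int a b (fun x => c * k x) = c * seg_int a b k.
Proof. by move=> ck; apply: RintegralZl => //; exact: continuous_integrable. Qed.

Lemma seg_int_cst a b c : a <= b -> seg_int a b (cst c) = c * (b - a).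
Proof.
move=> ab; rewrite /seg_int Rintegral_cst//= lebesgue_measure_itv/=.
rewrite lte_fin; move: ab; rewrite le_eqVlt => /predU1P[->|ab].
  by rewrite ltxx subrr.
by rewrite ab -EFinB.
Qed.

Lemma seg_int_le a b k l : continuous k -> continuous l ->
  (forall x, a <= x <= b -> k x <= l x) -> seg_int a b k <= seg_int a b l.
Proof.
move=> ck cl h; apply: le_Rintegral => //; try exact: continuous_integrable.
Qed.

Lemma seg_int_norm a b k e : a <= b -> continuous k ->
  (forall x, a <= x <= b -> `|k x| <= e) -> `|seg_int a b k| <= e * (b - a).
Proof.
move=> ab ck h; rewrite ler_norml; apply/andP; split.
  rewrite -mulNr -seg_int_cst//; apply: seg_int_le => //; first exact: cst_continuous.
  by move=> x /h; rewrite ler_norml => /andP[].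
rewrite -seg_int_cst//; apply: seg_int_le => //; first exact: cst_continuous.
by move=> x /h; rewrite ler_norml => /andP[].
Qed.

Lemma primitive_exists k (c : R) : continuous k ->
  exists K, forall x : R, c < x -> is_derive x 1 K (k x).
Proof.
move=> ck; exists (fun x => seg_int c x k) => x cx.
have [] := @continuous_FTC1_closed R k c x (x + 1) _ _ cx (ck x).
- by rewrite ltrDl.
- exact: continuous_integrable.
by rewrite derive1E => d e; exact: DeriveDef d e.
Qed.

Lemma seg_int_derive a b (f f2 : R * R -> R) (y : R) : a <= b -> unif_cont f -> unif_cont f2 ->
  (forall z, is_d2 f z (f2 z)) ->
  is_derive y 1 (fun y => seg_int a b (fun x => f (x, y)))
    (seg_int a b (fun x => f2 (x, y))).
Proof.
move=> ab uf uf2 d2.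
have slice (g : R * R -> R) t : unif_cont g -> continuous (fun x => g (x, t)).
  by move=> /unif_cont_continuous cg x; exact: (@continuous_slice1 _ g x t (cg _)).
have cv : h^-1 *: (seg_int a b (fun x => f (x, h + y)) - seg_int a b (fun x => f (x, y)))
   @[h --> 0^'] --> seg_int a b (fun x => f2 (x, y)).
  apply/cvgrPdist_le => e e0.
  have ba : 0 < b - a + 1 by rewrite ltr_wpDl// subr_ge0.
  have [r r0 hr] := uf2 _ (divr_gt0 e0 ba).
  near=> h.
  have h0 : h != 0 by near: h; exact: nbhs_dnbhs_neq.
  have hr' : `|h| < r by near: h; apply: dnbhs0_lt.
  rewrite /GRing.scale/= -seg_intB; try exact: slice.
  rewrite -seg_intZ; last by move=> x; apply: cvgB; exact: slice.
  rewrite -seg_intB; first last.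
  - move=> x; apply: cvgMr; apply: cvgB; exact: slice.
  - exact: slice.
  apply: (@le_trans _ _ (e / (b - a + 1) * (b - a))).
    apply: seg_int_norm => //.
      by move=> x; apply: cvgB; [exact: slice|apply: cvgMr; apply: cvgB; exact: slice].
    move=> x xI.
    have [|c cI e1] := @MVT_between _ (fun s => f (x, s)) (fun s => f2 (x, s)) y (h + y).
      by move=> s _; exact: (d2 (x, s)).
    rewrite e1 addrK mulrC mulfK//; apply: ltW; apply: hr; first by rewrite subrr normr0.
    apply: between_dist cI _ _; first by rewrite subrr normr0.
    by rewrite addrC opprD addrNK normrN.
  rewrite -[leRHS](mulr1) -mulrA ler_wpM2l ?(ltW e0)//.
  by rewrite mulrC ler_pdivrMr// mul1r lerDl.
pose F y := seg_int a b (fun x => f (x, y)).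
have {}cv : h^-1 *: (F (h *: 1 + y) - F y) @[h --> 0^'] -->
    seg_int a b (fun x => f2 (x, y)).
  by under eq_fun do rewrite [X in F (X + _)]mulr1.
by split; [apply/cvg_ex; exists (seg_int a b (fun x => f2 (x, y)))|exact/cvg_lim].
Unshelve. all: by end_near. Qed.

Lemma growth_ge (M s c kappa x0 : R) (k K : R -> R) :
  0 < s -> `|x0| + s < M ->
  (forall x : R, - M <= x <= M -> is_derive x 1 K (k x)) ->
  (forall x : R, - M <= x <= M -> - kappa <= k x) ->
  (forall x, `|x - x0| <= s -> c <= k x) ->
  2 * c * s - kappa * (2 * M - 2 * s) <= K M - K (- M).
Proof.
move=> s0 xM hK hk hc.
have [x1 x2] : x0 <= `|x0| /\ - x0 <= `|x0| by rewrite ler_norm ler_normr lexx orbT.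
have step (c' a b : R) : - M <= a -> a <= b -> b <= M ->
    (forall x, a <= x <= b -> c' <= k x) -> c' * (b - a) <= K b - K a.
  move=> Ma ab bM hl.
  have [|t tI ->] := @MVT_between _ K k a b.
    by rewrite min_l// max_r// => x /andP[ax xb]; apply: hK; lra.
  rewrite ler_wpM2r ?subr_ge0//; apply: hl.
  by move: tI; rewrite min_l// max_r.
have k1 : - kappa * (x0 - s - - M) <= K (x0 - s) - K (- M).
  by apply: step; [lra..|move=> x /andP[h1 h2]; apply: hk; lra].
have k2 : c * (x0 + s - (x0 - s)) <= K (x0 + s) - K (x0 - s).
  by apply: step; [lra..|move=> x /andP[h1 h2]; apply: hc; rewrite ler_norml; lra].
have k3 : - kappa * (M - (x0 + s)) <= K M - K (x0 + s).
  by apply: step; [lra..|move=> x /andP[h1 h2]; apply: hk; lra].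
lra.
Qed.

(** Let [q y] be the integral of [Q2] over the horizontal line at height [y]. It vanishes
    for large [|y|], and its derivative is the integral of the whole divergence over that
    line, because [Q1] has compact support. So the divergence cannot be nearly nonnegative
    everywhere and large on a square; [growth_ge], applied along the lines and then to
    [q], makes this quantitative without any integral over the plane. *)
Lemma divergence_mean (M s c kappa x0 y0 : R) (Q1 Q2 d1 d2 : R * R -> R) :
  continuous Q2 -> continuous d1 -> continuous d2 ->
  (forall z, is_d1 Q1 z (d1 z)) -> (forall z, is_d2 Q2 z (d2 z)) ->
  0 < s -> `|x0| + s < M -> `|y0| + s < M -> 0 <= kappa ->
  (forall x y, M <= `|x| \/ M <= `|y| -> [/\ Q1 (x, y) = 0, Q2 (x, y) = 0,
     d1 (x, y) = 0 & d2 (x, y) = 0]) ->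
  (forall z, - kappa <= d1 z + d2 z) ->
  (forall x y, `|x - x0| <= s -> `|y - y0| <= s -> c <= d1 (x, y) + d2 (x, y)) ->
  c * s ^+ 2 <= kappa * M ^+ 2.
Proof.
move=> cQ2 cd1 cd2 D1 D2 s0 xM yM k0 supp lb lbc.
have M0 : 0 < M by have := normr_ge0 x0; lra.
have ucQ2 : unif_cont Q2.
  by apply: (@compact_support_unif_cont _ _ M) => // x y h; have [] // := supp x y; case: h => /ltW; auto.
have ucd2 : unif_cont d2.
  by apply: (@compact_support_unif_cont _ _ M) => // x y h; have [] // := supp x y; case: h => /ltW; auto.
have slice (g : R * R -> R) t : continuous g -> continuous (fun x => g (x, t)).
  by move=> cg x; exact: (@continuous_slice1 _ g x t (cg _)).
pose q y := seg_int (- M) M (fun x => Q2 (x, y)).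
pose dq y := seg_int (- M) M (fun x => d2 (x, y)).
have MM : - M < M by lra.
have Dq (y : R) : is_derive y 1 q (dq y) by apply: seg_int_derive => //; exact: ltW.
have dqE y : dq y = seg_int (- M) M (fun x => d1 (x, y) + d2 (x, y)).
  rewrite seg_intD; try exact: slice.
  have -> : seg_int (- M) M (fun x => d1 (x, y)) = Q1 (M, y) - Q1 (- M, y).
    apply: (@seg_int_FTC _ _ _ (fun x => Q1 (x, y)) MM (slice d1 y cd1)) => x _.
    exact: (D1 (x, y)).
  have [-> _ _ _] := supp M y (or_introl (ler_norm _)).
  have MN : M <= `|- M| by rewrite normrN ler_norm.
  have [-> _ _ _] := supp (- M) y (or_introl MN).
  by rewrite subrr add0r.
have low y e : (forall x, `|x - x0| <= s -> e <= d1 (x, y) + d2 (x, y)) ->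
    2 * e * s - kappa * (2 * M - 2 * s) <= dq y.
  move=> he; rewrite dqE.
  have ck : continuous (fun x => d1 (x, y) + d2 (x, y)).
    by move=> x; apply: cvgD; exact: slice.
  have [K hK] := primitive_exists (- M - 1) ck.
  have -> : seg_int (- M) M (fun x => d1 (x, y) + d2 (x, y)) = K M - K (- M).
    by apply: (seg_int_FTC MM ck) => x /andP[h1 h2]; apply: hK; lra.
  apply: (@growth_ge M s e kappa x0 (fun x => d1 (x, y) + d2 (x, y))) => //.
  by move=> x /andP[h1 h2]; apply: hK; lra.
have := @growth_ge M s (2 * c * s - kappa * (2 * M - 2 * s)) (kappa * (2 * M)) y0 dq q s0 yM.
have q0 t : M <= `|t| -> q t = 0.
  move=> Mt; rewrite /q (_ : (fun x => Q2 (x, t)) = cst 0) ?seg_int_cst ?mul0r ?ltW//.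
  by apply/funext => x; have [] := supp x t (or_intror Mt).
rewrite q0 ?ler_norm// q0 ?normrN ?ler_norm// => h.
have : 2 * (2 * c * s - kappa * (2 * M - 2 * s)) * s -
  kappa * (2 * M) * (2 * M - 2 * s) <= 0 - 0.
  apply: h => [x _|y /= hy].
    have := low x (- kappa) (fun _ _ => lb _); have := mulr_ge0 k0 (ltW s0); nra.
  by apply: low => x hx; exact: lbc.
have := mulr_ge0 k0 (sqr_ge0 s); nra.
Qed.
End segment_integral.

(** * Averaging over squares *)

Lemma is_derive_le_quotient (R : realType) (phi : R -> R) (l B tau0 : R) :
  is_derive (0 : R) 1 phi l -> 0 < tau0 ->
  (forall tau, 0 < tau < tau0 -> `|phi tau - phi 0| <= B * tau) -> `|l| <= B.
Proof.
move=> /is_derive1_caratheodory[g [eqg cg <-]] tau00 hB.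
apply/ler_addgt0Pr => e e0.
move/cvgrPdist_lt: cg => /(_ _ e0)/nbhs_ballP[r /= r0 hr].
pose tau := Num.min r tau0 / 2.
have m0 : 0 < Num.min r tau0 by rewrite lt_min r0.
have t0 : 0 < tau by rewrite divr_gt0.
have : tau < Num.min r tau0 by rewrite /tau ltr_pdivrMr// ltr_pMr// ltr1n.
rewrite lt_min => /andP[tr tt].
have k1 : `|g 0 - g tau| < e.
  by apply: hr; rewrite /ball/= sub0r normrN gtr0_norm.
have := hB tau; rewrite t0 tt => /(_ isT); rewrite eqg subr0 normrM (gtr0_norm t0).
rewrite ler_pM2r// => k2.
have := ler_distD (g tau) (g 0) 0; rewrite !subr0; lra.
Qed.

Section mollify.
Variable R : realType.
Implicit Types (f : R * R -> R) (h : R).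

Definition avg1 h f (z : R * R) := seg_int 0 h (fun s => f (z.1 + s, z.2)).
Definition avg2 h f (z : R * R) := seg_int 0 h (fun s => f (z.1, z.2 + s)).

Lemma unif_cont_slice1 f a b : unif_cont f -> continuous (fun s => f (a + s, b)).
Proof.
move=> uf s; apply/cvgrPdist_lt => e /uf[r r0 hr].
apply/nbhs_ballP; exists r => // s'; rewrite /ball/= => h.
by apply: hr; rewrite ?subrr ?normr0// opprD addrACA subrr add0r.
Qed.

Lemma unif_cont_slice2 f a b : unif_cont f -> continuous (fun s => f (a, b + s)).
Proof.
move=> uf s; apply/cvgrPdist_lt => e /uf[r r0 hr].
apply/nbhs_ballP; exists r => // s'; rewrite /ball/= => h.
by apply: hr; rewrite ?subrr ?normr0// opprD addrACA subrr add0r.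
Qed.

Lemma unif_cont_avg1 h f : 0 < h -> unif_cont f -> unif_cont (avg1 h f).
Proof.
move=> h0 uf e e0; have [r r0 hr] := uf (e / h / 2) (divr_gt0 (divr_gt0 e0 h0) (ltr0n _ 2)).
exists r => // x y x' y' hx hy; rewrite /avg1/= -seg_intB; try exact: unif_cont_slice1.
apply: (@le_lt_trans _ _ (e / h / 2 * (h - 0))).
  apply: seg_int_norm; first exact: ltW.
    by move=> s; apply: cvgB; exact: unif_cont_slice1.
  by move=> s _; apply/ltW/hr => //; rewrite opprD addrACA subrr addr0.
by rewrite subr0 mulrAC divfK ?gt_eqF// ltr_pdivrMr// ltr_pMr// ltr1n.
Qed.

Lemma unif_cont_avg2 h f : 0 < h -> unif_cont f -> unif_cont (avg2 h f).
Proof.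
move=> h0 uf e e0; have [r r0 hr] := uf (e / h / 2) (divr_gt0 (divr_gt0 e0 h0) (ltr0n _ 2)).
exists r => // x y x' y' hx hy; rewrite /avg2/= -seg_intB; try exact: unif_cont_slice2.
apply: (@le_lt_trans _ _ (e / h / 2 * (h - 0))).
  apply: seg_int_norm; first exact: ltW.
    by move=> s; apply: cvgB; exact: unif_cont_slice2.
  by move=> s _; apply/ltW/hr => //; rewrite opprD addrACA subrr addr0.
by rewrite subr0 mulrAC divfK ?gt_eqF// ltr_pdivrMr// ltr_pMr// ltr1n.
Qed.

Lemma shift_is_derive (K : R -> R) (a s l : R) : is_derive (a + s) 1 K l ->
  is_derive s 1 (fun s => K (a + s)) l.
Proof.
move=> dK; have -> : (fun s => K (a + s)) = K \o (fun s => s + a).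
  by apply/funext => t /=; rewrite addrC.
rewrite addrC in dK; rewrite -[l]mulr1.
apply: is_derive1_comp; rewrite -[X in is_derive _ _ _ X]addr0.
exact: is_deriveD.
Qed.

Lemma window_is_derive (k : R -> R) (a h : R) : 0 < h -> continuous k ->
  is_derive a 1 (fun a => seg_int 0 h (fun s => k (a + s))) (k (a + h) - k a).
Proof.
move=> h0 ck; have [K hK] := primitive_exists (a - 1) ck.
have dF : is_derive a 1 (fun a => K (a + h) - K a) (k (a + h) - k a).
  apply: is_deriveB; last by apply: hK; rewrite ltrBlDr ltrDl.
  under eq_fun do rewrite addrC.
  by apply: shift_is_derive; rewrite addrC; apply: hK; lra.
apply: near_eq_is_derive dF.
apply/nbhs_ballP; exists 1 => //= a'; rewrite /ball/= ltr_norml => /andP[h1 h2].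
have ck' : continuous (fun s => k (a' + s)).
  move=> s; apply: (@continuous_comp _ _ _ (fun s => a' + s) k); last exact: ck.
  by apply: cvgD; [exact: cvg_cst|exact: cvg_id].
suff -> : seg_int 0 h (fun s => k (a' + s)) = K (a' + h) - K (a' + 0) by rewrite addr0.
apply: (@seg_int_FTC _ 0 h _ (fun s => K (a' + s)) h0 ck') => s /andP[s0 _].
by apply: shift_is_derive; apply: hK; lra.
Qed.

Lemma avg1_bounds h f a b lo hi : 0 < h -> unif_cont f ->
  (forall s, 0 <= s <= h -> lo <= f (a + s, b) <= hi) ->
  lo * h <= avg1 h f (a, b) <= hi * h.
Proof.
move=> h0 uf hb; rewrite -[h in lo * h]subr0 -[h in hi * h]subr0.
rewrite -!seg_int_cst ?(ltW h0)//; apply/andP; split.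
  apply: seg_int_le => [||s /hb /andP[]//]; first exact: cst_continuous.
  exact: unif_cont_slice1.
apply: seg_int_le => [||s /hb /andP[]//]; last exact: cst_continuous.
exact: unif_cont_slice1.
Qed.

Lemma avg2_bounds h f a b lo hi : 0 < h -> unif_cont f ->
  (forall s, 0 <= s <= h -> lo <= f (a, b + s) <= hi) ->
  lo * h <= avg2 h f (a, b) <= hi * h.
Proof.
move=> h0 uf hb; rewrite -[h in lo * h]subr0 -[h in hi * h]subr0.
rewrite -!seg_int_cst ?(ltW h0)//; apply/andP; split.
  apply: seg_int_le => [||s /hb /andP[]//]; first exact: cst_continuous.
  exact: unif_cont_slice2.
apply: seg_int_le => [||s /hb /andP[]//]; last exact: cst_continuous.
exact: unif_cont_slice2.
Qed.

(** The mean over a square of side [h] with corner [z]. A kernel as rough as the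
    indicator of a square already turns continuous functions into C^1 ones, and its
    partial derivatives [mol1], [mol2] are explicit. *)
Definition mol h f (z : R * R) := (h * h)^-1 * avg2 h (avg1 h f) z.
Definition mol1 h f (z : R * R) :=
  (h * h)^-1 * avg2 h (fun w => f (w.1 + h, w.2) - f w) z.
Definition mol2 h f (z : R * R) :=
  (h * h)^-1 * (avg1 h f (z.1, z.2 + h) - avg1 h f z).

Lemma unif_cont_diff1 h f : unif_cont f -> unif_cont (fun w => f (w.1 + h, w.2) - f w).
Proof.
move=> uf e e0; have [r r0 hr] := uf (e / 2) (divr_gt0 e0 (ltr0n _ 2)).
exists r => // x y x' y' hx hy /=.
have k1 : `|f (x + h, y) - f (x' + h, y')| < e / 2.
  by apply: hr => //; rewrite opprD addrACA subrr addr0.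
have k2 := hr _ _ _ _ hx hy.
have := ler_normB (f (x + h, y) - f (x' + h, y')) (f (x, y) - f (x', y')).
rewrite (_ : f (x + h, y) - f (x' + h, y') - _ =
  f (x + h, y) - f (x, y) - (f (x' + h, y') - f (x', y'))); last by ring.
lra.
Qed.

Lemma is_d1_mol h f z : 0 < h -> unif_cont f -> is_d1 (mol h f) z (mol1 h f z).
Proof.
move=> h0 uf; apply: (@is_deriveZ _ _ _ (fun a => avg2 h (avg1 h f) (a, z.2))).
pose F (w : R * R) := avg1 h f (w.2, z.2 + w.1).
pose F2 (w : R * R) := f (w.2 + h, z.2 + w.1) - f (w.2, z.2 + w.1).
apply: (@seg_int_derive _ 0 h F F2); first exact: ltW.
- move=> e /(unif_cont_avg1 h0 uf)[r r0 hr]; exists r => // x y x' y' h1 h2.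
  by apply: hr => //; rewrite opprD addrACA subrr add0r.
- move=> e /(unif_cont_diff1 h uf)[r r0 hr]; exists r => // x y x' y' h1 h2.
  by apply: hr => //; rewrite opprD addrACA subrr add0r.
- move=> w; apply: (@window_is_derive (fun s => f (s, z.2 + w.1))) => //.
  have := @unif_cont_slice1 f 0 (z.2 + w.1) uf.
  by under eq_fun do rewrite add0r.
Qed.

Lemma is_d2_mol h f z : 0 < h -> unif_cont f -> is_d2 (mol h f) z (mol2 h f z).
Proof.
move=> h0 uf; apply: (@is_deriveZ _ _ _ (fun b => avg2 h (avg1 h f) (z.1, b))).
case: z => a b; apply: (@window_is_derive (fun s => avg1 h f (a, s))) => //.
have := @unif_cont_slice2 (avg1 h f) a 0 (unif_cont_avg1 h0 uf).
by under eq_fun do rewrite add0r.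
Qed.

Lemma continuous_mol1 h f : 0 < h -> unif_cont f -> continuous (mol1 h f).
Proof.
move=> h0 uf z; apply: cvgMr; apply: unif_cont_continuous; apply: unif_cont_avg2 => //.
exact: unif_cont_diff1.
Qed.

Lemma continuous_mol2 h f : 0 < h -> unif_cont f -> continuous (mol2 h f).
Proof.
move=> h0 uf; apply: unif_cont_continuous => e e0.
pose e' := e * (h * h) / 2.
have e'0 : 0 < e' by rewrite divr_gt0// mulr_gt0// mulr_gt0.
have [r r0 hr] := unif_cont_avg1 h0 uf e'0.
exists r => // x y x' y' hx hy; rewrite /mol2 /=.
have k2 := hr _ _ _ _ hx hy.
have k1 : `|avg1 h f (x, y + h) - avg1 h f (x', y' + h)| < e'.
  by apply: hr => //; rewrite opprD addrACA subrr addr0.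
rewrite -mulrBr normrM gtr0_norm ?invr_gt0 ?mulr_gt0// mulrC ltr_pdivrMr ?mulr_gt0//.
have := ler_normB (avg1 h f (x, y + h) - avg1 h f (x', y' + h))
  (avg1 h f (x, y) - avg1 h f (x', y')).
rewrite (_ : avg1 h f (x, y + h) - _ - _ = avg1 h f (x, y + h) - avg1 h f (x, y) -
   (avg1 h f (x', y' + h) - avg1 h f (x', y'))); last by ring.
move: k1 k2; rewrite /e'; lra.
Qed.

Lemma C1_mol h f : 0 < h -> unif_cont f -> C1_on setT (mol h f) (mol1 h f) (mol2 h f).
Proof.
move=> h0 uf z _; split; [exact: is_d1_mol|exact: is_d2_mol| |].
  exact: continuous_mol1.
exact: continuous_mol2.
Qed.

Lemma mol_bounds h f a b lo hi : 0 < h -> unif_cont f ->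
  (forall s t, 0 <= s <= h -> 0 <= t <= h -> lo <= f (a + s, b + t) <= hi) ->
  lo <= mol h f (a, b) <= hi.
Proof.
move=> h0 uf hb; rewrite /mol mulrC ler_pdivlMr ?ler_pdivrMr ?mulr_gt0// !mulrA.
apply: avg2_bounds => //; first exact: unif_cont_avg1.
by move=> t tI; apply: avg1_bounds => // s sI; exact: hb.
Qed.

Lemma molB h f g z : 0 < h -> unif_cont f -> unif_cont g ->
  mol h f z - mol h g z = mol h (fun w => f w - g w) z.
Proof.
move=> h0 uf ug; rewrite /mol -mulrBr; congr (_ * _).
rewrite /avg2 -seg_intB; try by apply: unif_cont_slice2; exact: unif_cont_avg1.
congr seg_int; apply/funext => t /=; rewrite /avg1 /= -seg_intB//; exact: unif_cont_slice1.
Qed.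

(** Averaging commutes with translations, so a Lipschitz bound in one direction that holds
    over the averaging square survives, for that direction, as a bound on the
    derivative. *)
Lemma mol_directional h f (a b v1 v2 B tau0 : R) : 0 < h -> unif_cont f -> 0 < tau0 ->
  (forall s t tau : R, 0 <= s <= h -> 0 <= t <= h -> 0 < tau < tau0 ->
    `|f (a + s + tau * v1, b + t + tau * v2) - f (a + s, b + t)| <= B * tau) ->
  `|mol1 h f (a, b) * v1 + mol2 h f (a, b) * v2| <= B.
Proof.
move=> h0 uf t0 hB.
apply: (@is_derive_le_quotient _ (fun tau => mol h f (a + tau * v1, b + tau * v2)) _ _ tau0) => //.
  have dlin c v : is_derive (0 : R) 1 (fun tau => c + tau * v) v.
    rewrite -[X in is_derive _ _ _ X]add0r; apply: is_deriveD.
    by apply: is_derive_eq; rewrite scale0r add0r [LHS]mulr1.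
  have := @chain2 R (mol h f) (mol1 h f) (mol2 h f)
    (fun tau => a + tau * v1) (fun tau => b + tau * v2) 0 v1 v2.
  rewrite !mul0r !addr0; apply => //.
  - by apply/near2P; exists 1 => // x y _ _; exact: is_d1_mol.
  - by apply/near2P; exists 1 => // x y _ _; exact: is_d2_mol.
  - exact: continuous_mol1.
  - exact: continuous_mol2.
move=> tau tI; rewrite !mul0r !addr0 ler_norml.
pose g (w : R * R) := f (w.1 + tau * v1, w.2 + tau * v2).
have ug : unif_cont g.
  move=> e /uf[r r0 hr]; exists r => // x y x' y' h1 h2.
  by apply: hr; rewrite opprD addrACA subrr addr0.
have -> : mol h f (a + tau * v1, b + tau * v2) = mol h g (a, b).
  rewrite /mol /avg2 /avg1 /g /=; congr (_ * _); congr seg_int; apply/funext => t /=.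
  congr seg_int; apply/funext => s /=; congr (f (_, _)); ring.
rewrite molB//; apply: mol_bounds => //.
  move=> e e0; have [r r0 hr] := uf (e / 2) (divr_gt0 e0 (ltr0n _ 2)).
  exists r => // x y x' y' hx hy /=.
  have k1 : `|g (x, y) - g (x', y')| < e / 2.
    by apply: hr; rewrite opprD addrACA subrr addr0.
  have k2 := hr _ _ _ _ hx hy.
  have := ler_normB (g (x, y) - g (x', y')) (f (x, y) - f (x', y')).
  rewrite (_ : g (x, y) - g (x', y') - _ =
    g (x, y) - f (x, y) - (g (x', y') - f (x', y'))); last by ring.
  lra.
by move=> s t sI tI'; rewrite -ler_norml; exact: hB.
Qed.
End mollify.

(** * Polygonal paths on a graph and their cost *)

(** The squared length of the tangent vector of a graph that lies over the vector
    [(v1, v2)], at a point where the gradient is [(p1, p2)]. *)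
Definition lift_sqr (R : realType) (p1 p2 v1 v2 : R) : R :=
  v1 ^+ 2 + v2 ^+ 2 + (p1 * v1 + p2 * v2) ^+ 2.

Section paths.
Variables (R : realType) (D : set (R * R)) (u u1 u2 : R * R -> R).
Hypothesis oD : open D.
Hypothesis uC : C1_on D u u1 u2.
Implicit Types (x y z w : R * R) (a c t : R).

Definition seg z w t : R * R :=
  (z.1 + t * (w.1 - z.1), z.2 + t * (w.2 - z.2)).

(** The speed of the lift of the segment, run in unit time, is bounded by [c] at every
    point, so the lift has length at most [c]. The pointwise bound is stronger than the one
    on the length, but paths can be cut, glued and perturbed without integrals. *)
Definition gstep z w c := 0 <= c /\ forall t, 0 <= t <= 1 ->
  D (seg z w t) /\
  lift_sqr (u1 (seg z w t)) (u2 (seg z w t)) (w.1 - z.1) (w.2 - z.2) <= c ^+ 2.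

Inductive gpath : R * R -> R * R -> R -> Prop :=
| gpath_refl x : D x -> gpath x x 0
| gpath_step x y z c c' : gpath x y c -> gstep y z c' -> gpath x z (c + c').

Lemma seg0 z w : seg z w 0 = z.
Proof. by case: z w => ? ? [? ?]; rewrite /seg/= !mul0r !addr0. Qed.

Lemma seg1 z w : seg z w 1 = w.
Proof. by case: z w => ? ? [? ?]; rewrite /seg/= !mul1r ![_ + (_ - _)]addrC !subrK. Qed.

Lemma gstep_in z w c : gstep z w c -> D z /\ D w.
Proof.
move=> [_ h]; have [] := h 0; rewrite ?lexx ?ler01// seg0 => ? _.
by have [] := h 1; rewrite ?lexx ?ler01// seg1.
Qed.

Lemma gstep_sym z w c : gstep z w c -> gstep w z c.
Proof.
move=> [c0 h]; split=> // t /andP[t0 t1].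
have [] := h (1 - t); first by rewrite subr_ge0 t1 gerBl.
have -> : seg z w (1 - t) = seg w z t by rewrite /seg; congr (_, _); ring.
by move=> Dt le; split=> //; apply: le_trans le; rewrite /lift_sqr le_eqVlt; apply/orP; left; apply/eqP; ring.
Qed.

Lemma gstep_split z w c t : 0 <= t <= 1 -> gstep z w c ->
  gstep z (seg z w t) (t * c) /\ gstep (seg z w t) w ((1 - t) * c).
Proof.
move=> /andP[t0 t1] [c0 h]; split; split; rewrite ?mulr_ge0 ?subr_ge0// => s /andP[s0 s1].
  have [] := h (s * t); first by rewrite mulr_ge0// mulr_ile1.
  have -> : seg z (seg z w t) s = seg z w (s * t).
    by rewrite /seg/=; congr (_, _); ring.
  move=> Dt le; split=> //; rewrite exprMn.
  apply: le_trans (ler_wpM2l (sqr_ge0 t) le).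
  by rewrite /lift_sqr/= le_eqVlt; apply/orP; left; apply/eqP; ring.
have [] := h (t + s * (1 - t)).
  by apply/andP; split; nra.
have -> : seg (seg z w t) w s = seg z w (t + s * (1 - t)).
  by rewrite /seg/=; congr (_, _); ring.
move=> Dt le; split=> //; rewrite exprMn.
apply: le_trans (ler_wpM2l (sqr_ge0 (1 - t)) le).
by rewrite /lift_sqr/= le_eqVlt; apply/orP; left; apply/eqP; ring.
Qed.

Lemma gstep_dist z w c : gstep z w c -> `|z.1 - w.1| <= c /\ `|z.2 - w.2| <= c.
Proof.
move=> [c0 /(_ 0)[]]; rewrite ?lexx ?ler01// => _.
rewrite /lift_sqr => h.
have h3 := sqr_ge0 (u1 (seg z w 0) * (w.1 - z.1) + u2 (seg z w 0) * (w.2 - z.2)).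
have h1 := sqr_ge0 (w.1 - z.1); have h2 := sqr_ge0 (w.2 - z.2).
by split; rewrite distrC -(ler_pXn2r (n := 2)) ?nnegrE// -normrX ger0_norm ?sqr_ge0//; lra.
Qed.

Lemma gpath_in x y c : gpath x y c -> [/\ D x, D y & 0 <= c].
Proof.
elim=> [z Dz|x' y' z c1 c2 _ [Dx Dy c10] st]; first by split.
by have [_ Dz] := gstep_in st; split=> //; case: st => ? _; rewrite addr_ge0.
Qed.

Lemma gstep_path z w c : gstep z w c -> gpath z w c.
Proof.
move=> st; have [Dz _] := gstep_in st.
by rewrite -[c]add0r; apply: gpath_step st; exact: gpath_refl.
Qed.

Lemma gpath_trans x y z c c' : gpath x y c -> gpath y z c' -> gpath x z (c + c').
Proof.
move=> pxy pyz; elim: pyz x c pxy => [w _ x' c pxy|y' w v c1 c2 _ IH st x' c pxy].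
  by rewrite addr0.
by rewrite addrA; apply: gpath_step st; exact: IH.
Qed.

Lemma gpath_sym x y c : gpath x y c -> gpath y x c.
Proof.
elim=> [z Dz|x' y' z c1 c2 _ IH st]; first exact: gpath_refl.
by rewrite addrC; apply: gpath_trans IH; apply/gstep_path/gstep_sym.
Qed.

Lemma gpath_dist x y c : gpath x y c -> `|x.1 - y.1| <= c /\ `|x.2 - y.2| <= c.
Proof.
elim=> [z Dz|x' y' z c1 c2 _ [h1 h2] /gstep_dist[h3 h4]].
  by rewrite !subrr normr0.
by split; [have := ler_distD y'.1 x'.1 z.1|have := ler_distD y'.2 x'.2 z.2]; lra.
Qed.

Lemma gpath_split x z c a : gpath x z c -> 0 <= a <= c ->
  exists2 y, gpath x y a & gpath y z (c - a).
Proof.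
move=> p; elim: p a => {x z c}[x Dx a|x y z c c' pxy IH st a /andP[a0 ac]].
  by rewrite -eq_le => /eqP <-; exists x; rewrite ?subr0; exact: gpath_refl.
have [ac1|ca] := leP a c.
  have [|w pw pw'] := IH a; first by rewrite a0.
  by exists w => //; rewrite addrAC; exact: gpath_step st.
have c'0 : 0 < c' by lra.
have [|s1 s2] := @gstep_split y z c' ((a - c) / c') _ st.
  by rewrite divr_ge0 ?ler_pdivrMr ?mul1r; lra.
exists (seg y z ((a - c) / c')).
  have e : c + (a - c) / c' * c' = a by rewrite divfK ?gt_eqF// addrC subrK.
  rewrite -[X in gpath _ _ X]e; exact: gpath_step pxy s1.
have e : (1 - (a - c) / c') * c' = c + c' - a.
  by rewrite mulrBl mul1r divfK ?gt_eqF//; ring.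
by apply: gstep_path; rewrite -e.
Qed.

Lemma local_gstep z e : D z -> 0 < e -> exists2 r, 0 < r &
  forall w, `|z.1 - w.1| < r -> `|z.2 - w.2| < r -> gstep z w e.
Proof.
case: z => p q Dz e0; have [/= _ _ /continuous2P/(_ _ ltr01)/=[r1 r10 h1]
             /continuous2P/(_ _ ltr01)/=[r2 r20 h2]] := uC Dz.
have /near2P/=[rD rD0 hD] : nbhs (p, q) D by apply: open_nbhs_nbhs.
pose M := 1 + `|u1 (p, q)| + `|u2 (p, q)|.
have M0 : 1 <= M by rewrite /M -addrA lerDl addr_ge0.
pose r := Num.min (Num.min rD (e / (4 * M))) (Num.min r1 r2).
have r0 : 0 < r by rewrite !lt_min rD0 r10 r20 divr_gt0// mulr_gt0//; lra.
exists r => //= -[x y]/=; rewrite !lt_min => /andP[/andP[xD xe] /andP[x1 x2]]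
  /andP[/andP[yD ye] /andP[y1 y2]].
split=> [|t /andP[t0 t1]/=]; first exact: ltW.
have cl (s s' d : R) : `|s - s'| < d -> `|s - (s + t * (s' - s))| < d.
  rewrite opprD addNKr normrN normrM (ger0_norm t0) distrC => h.
  by apply: le_lt_trans h; rewrite ler_piMl.
have k1 : `|u1 (seg (p, q) (x, y) t)| <= M.
  have := h1 _ _ (cl _ _ _ x1) (cl _ _ _ y1).
  have := ler_distD (u1 (p, q)) (u1 (seg (p, q) (x, y) t)) 0.
  rewrite !subr0 distrC /M /seg/=; have := normr_ge0 (u2 (p, q)); lra.
have k2 : `|u2 (seg (p, q) (x, y) t)| <= M.
  have := h2 _ _ (cl _ _ _ x2) (cl _ _ _ y2).
  have := ler_distD (u2 (p, q)) (u2 (seg (p, q) (x, y) t)) 0.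
  rewrite !subr0 distrC /M /seg/=; have := normr_ge0 (u1 (p, q)); lra.
split; first by apply: hD; exact: cl.
move: k1 k2; set P := u1 _; set Q := u2 _ => k1 k2.
have bnd (s : R) : `|s| < e / (4 * M) -> `|s| * M <= e / 4.
  by rewrite ltr_pdivlMr ?mulr_gt0//; [move=> h; lra|lra].
have bx := bnd _ xe; have by_ := bnd _ ye.
rewrite (distrC p) in bx; rewrite (distrC q) in by_.
have b1 : `|x - p| <= e / 4 by apply: le_trans bx; rewrite ler_peMr.
have b2 : `|y - q| <= e / 4 by apply: le_trans by_; rewrite ler_peMr.
have b3 : `|P * (x - p) + Q * (y - q)| <= e / 2.
  apply: le_trans (ler_normD _ _) _; rewrite !normrM.
  have := ler_wpM2r (normr_ge0 (x - p)) k1; have := ler_wpM2r (normr_ge0 (y - q)) k2.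
  rewrite ![M * _]mulrC; lra.
have sq (s d : R) : `|s| <= d -> s ^+ 2 <= d ^+ 2.
  move=> h; rewrite -real_normK ?num_real// ler_pXn2r ?nnegrE//.
  exact: le_trans (normr_ge0 _) h.
move/sq: b1; move/sq: b2; move/sq: b3; rewrite /lift_sqr; nra.
Qed.
End paths.

(** * Reaching the end of the domain: a Hopf--Rinow argument *)

Section escape.
Variables (R : realType) (D : set (R * R)) (u u1 u2 : R * R -> R).
Hypothesis oD : open D.
Hypothesis uC : C1_on D u u1 u2.
Implicit Types (x y z w : R * R) (a c t S : R) (n : nat).
Notation gpath := (gpath D u1 u2).
Notation gstep := (gstep D u1 u2).

(** The sets of points at sup distance at least [1 / (n + 1)] from the complement of [D];
    for bounded [D] they are an exhaustion by compact sets. *)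
Definition core n : set (R * R) :=
  [set z | forall x y : R, `|z.1 - x| < n.+1%:R^-1 -> `|z.2 - y| < n.+1%:R^-1 ->
     D (x, y)].

Lemma core_sub n z : core n z -> D z.
Proof.
case: z => a b h; apply: h => /=; by rewrite subrr normr0 invr_gt0.
Qed.

Lemma core_mono m n : (m <= n)%N -> core m `<=` core n.
Proof.
move=> mn z h x y hx hy; apply: h; [move: hx|move: hy] => /lt_le_trans; apply;
  by rewrite lef_pV2 ?posrE// ler_nat.
Qed.

Lemma core_exhaust z : D z -> exists n, exists2 r : R, 0 < r &
  forall w, `|z.1 - w.1| < r -> `|z.2 - w.2| < r -> core n w.
Proof.
case: z => p q Dz; have /near2P/=[r r0 hD] : nbhs (p, q) D by apply: open_nbhs_nbhs.
have r20 : 0 < r / 2 by rewrite divr_gt0.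
have [n hn] : exists n, n.+1%:R^-1 < r / 2.
  exists (Num.truncn (r / 2)^-1); rewrite invf_plt ?posrE//; exact: Num.Theory.truncnS_gt.
exists n, (r / 2) => // -[a b]/= ha hb x y/= hx hy.
move: (lt_trans hx hn) (lt_trans hy hn) => {}hx {}hy.
by apply: hD; [have := ler_distD a p x|have := ler_distD b q y]; lra.
Qed.

Lemma core_closed n : closed (core n).
Proof.
rewrite -openC openE => -[a b] /= nz.
have [x [y [hx hy nD]]] : exists x y : R, [/\ `|a - x| < n.+1%:R^-1,
    `|b - y| < n.+1%:R^-1 & ~ D (x, y)].
  apply: contrapT => h; apply: nz => x y /= hx hy.
  by apply: contrapT => nD; apply: h; exists x, y.
apply/near2P.
exists (Num.min (n.+1%:R^-1 - `|a - x|) (n.+1%:R^-1 - `|b - y|)).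
  by rewrite lt_min !subr_gt0 hx.
move=> a' b' /=; rewrite !lt_min => /andP[h1 _] /andP[_ h2] hc; apply: nD; apply: hc => /=.
  have := ler_distD a a' x; rewrite (distrC a' a); set i := _^-1 in h1 *; lra.
have := ler_distD b b' y; rewrite (distrC b' b); set i := _^-1 in h2 *; lra.
Qed.

Lemma core_compact (M : R) n : (forall z, D z -> `|z.1| <= M /\ `|z.2| <= M) ->
  compact (core n).
Proof.
move=> DM; apply: subclosed_compact (@core_closed n) (@compact_box R M) _.
by move=> z /core_sub /DM.
Qed.

(** The end of [D], approached through the complements of the cores, is within cost [S]
    of [x]. *)
Definition escapes x S := forall n, exists y c,
  [/\ D y, ~ core n y, gpath x y c & c <= S].

Lemma escapes_le x S S' : S <= S' -> escapes x S -> escapes x S'.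
Proof.
move=> SS h n; have [y [c [Dy ny p cS]]] := h n.
by exists y, c; split=> //; exact: le_trans SS.
Qed.

Lemma escapes_path x y S c : gpath x y c -> escapes y S -> escapes x (c + S).
Proof.
move=> p h n; have [z [c' [Dz nz p' cS]]] := h n.
by exists z, (c + c'); split=> //; [exact: gpath_trans p p'|rewrite lerD2l].
Qed.

Lemma escapes_lower x : D x -> exists2 r : R, 0 < r & forall S, escapes x S -> r <= S.
Proof.
move=> /core_exhaust[n [r r0 hr]]; exists r => // S /(_ n)[y [c [Dy ny /gpath_dist[h1 h2] cS]]].
rewrite leNgt; apply/negP => Sr; apply: ny; apply: hr.
  exact: le_lt_trans h1 (le_lt_trans cS Sr).
exact: le_lt_trans h2 (le_lt_trans cS Sr).
Qed.

(** Let [s] be the infimum of the costs of escape from [x]. The points at cost less than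
    [s] lie in a compact part of [D], so points at cost close to [s] on cheaper and cheaper
    ways to the end of [D] accumulate, and a point of accumulation does not depend on
    how close to the end one wants to come. *)
Lemma escapes_half (M : R) x S : (forall z, D z -> `|z.1| <= M /\ `|z.2| <= M) ->
  escapes x S -> exists y c, [/\ gpath x y c, c <= S & escapes y (S / 2)].
Proof.
move=> DM hS.
have Dx : D x by have [y [c [_ _ /gpath_in[]]]] := hS 0.
have [r r0 hr] := escapes_lower Dx.
pose E : set R := [set S | escapes x S].
have Elb : has_lbound E by exists r => S' /hr.
have iE : has_inf E by split=> //; exists S.
pose s := inf E.
have s0 : 0 < s.
  by apply: lt_le_trans r0 _; apply: lb_le_inf => [|S' /hr//]; exists S.
have sS : s <= S by apply: ge_inf.
have esc1 : escapes x (s + s / 10).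
  have [|S' hS' /ltW lS'] := @inf_adherent R E (s / 10) _ iE; first by rewrite divr_gt0.
  exact: escapes_le lS' hS'.
(* leaving core m costs more than 9/10 s, so the points chosen below at cost 8/10 s lie
   in it; the ways they are on cost at most 11/10 s, which leaves at most 3/10 s *)
have [m hm] : exists m, forall y c, D y -> ~ core m y -> gpath x y c -> s * (9 / 10) < c.
  apply: contrapT => h; have : s <= s * (9 / 10); last by lra.
  apply: ge_inf => // n; apply: contrapT => h'; apply: h; exists n => y c Dy ny p.
  by rewrite ltNge; apply/negP => cs; apply: h'; exists y, c.
have /choice[f hf] : forall n, exists y : R * R, core m y /\ gpath x y (s * (8 / 10)) /\
    exists z c, [/\ D z, ~ core n z, gpath y z c & c <= s * (3 / 10)].
  move=> n; have [z [c [Dz nz p cS]]] := esc1 (n + m)%N.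
  have nm : ~ core m z by apply: contra_not nz; apply: core_mono; rewrite leq_addl.
  have nn : ~ core n z by apply: contra_not nz; apply: core_mono; rewrite leq_addr.
  have cl := hm _ _ Dz nm p.
  have [|y pxy pyz] := gpath_split (a := s * (8 / 10)) p; first by apply/andP; split; lra.
  have [_ Dy _] := gpath_in pxy.
  exists y; split.
    by apply: contrapT => ny; have := hm _ _ Dy ny pxy; lra.
  by split=> //; exists z, (c - s * (8 / 10)); split=> //; lra.
have [y [Ky cly]] : core m `&` cluster (f @ \oo) !=set0.
  by apply: (core_compact DM); exists 0 => // n _; have [] := hf n.
have [|rho rho0 hrho] := local_gstep oD uC (core_sub Ky) (e := s / 20).
  by rewrite divr_gt0.
have near_y N : exists2 n, (N <= n)%N & gstep y (f n) (s / 20).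
  have := cly (f @` [set n | (N <= n)%N])
    [set w | `|y.1 - w.1| < rho /\ `|y.2 - w.2| < rho].
  case.
  - by exists N => // n hn; exists n.
  - by apply/near2P; exists rho.
  by move=> w [[n Nn <-] [h1 h2]]; exists n => //; exact: hrho.
exists y, (s * (8 / 10) + s / 20); split.
- have [n _ st] := near_y 0.
  have [_ [p _]] := hf n.
  exact: gpath_trans p (gstep_path (gstep_sym st)).
- lra.
- move=> N; have [n Nn st] := near_y N.
  have [_ [_ [z [c [Dz nz p cs]]]]] := hf n.
  exists z, (s / 20 + c); split=> //.
  + by apply: contra_not nz; exact: core_mono.
  + exact: gpath_trans (gstep_path st) p.
  + lra.
Qed.

(** Cauchy for the cost of paths, convergent in the plane: intrinsic completeness yields
    this directly, as costs dominate intrinsic distances and these dominate planar ones. *)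
Definition path_complete := forall f : nat -> R * R,
  (forall i, D (f i)) ->
  (forall e, 0 < e -> exists N : nat, forall i j, (N <= i)%N -> (N <= j)%N ->
     exists2 c, gpath (f i) (f j) c & c < e) ->
  exists2 p, D p & forall e : R, 0 < e -> exists N : nat, forall i, (N <= i)%N ->
     `|p.1 - (f i).1| < e /\ `|p.2 - (f i).2| < e.

(** Halving the cost of escape again and again yields a Cauchy sequence; its limit would be
    a point of [D] from which escape costs nothing, against [escapes_lower]. *)
Lemma complete_no_escape (M : R) x S : (forall z, D z -> `|z.1| <= M /\ `|z.2| <= M) ->
  path_complete -> ~ escapes x S.
Proof.
move=> DM cpl hS.
have /choice[g hg] : forall w : (R * R) * R, exists y : R * R,
    escapes w.1 w.2 -> exists c, [/\ gpath w.1 y c, c <= w.2 & escapes y (w.2 / 2)].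
  move=> w; have [h|h] := pselect (escapes w.1 w.2); last by exists w.1.
  by have [y [c hc]] := escapes_half DM h; exists y => _; exists c.
pose st n := iter n (fun w : (R * R) * R => (g w, w.2 / 2)) (x, S).
have st2 n : (st n).2 = S / 2 ^+ n.
  elim: n => [|n IH]; first by rewrite expr0 divr1.
  by rewrite /= -/(st n) IH exprS invfM mulrA mulrAC.
pose f n := (st n).1.
have escf n : escapes (f n) (S / 2 ^+ n).
  rewrite -st2; elim: n => [//|n IH].
  by have [c [_ _]] := hg _ IH; rewrite /f /= -/(st n).
have stepf n : exists2 c, gpath (f n) (f n.+1) c & c <= S / 2 ^+ n.
  have := escf n; rewrite -st2 => /hg[c [p cl _]]; exists c => //.
have S0 : 0 <= S.
  by have [y [c [_ _ /gpath_in[_ _ c0] cS]]] := hS 0; exact: le_trans cS.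
have pathf n k : exists2 c, gpath (f n) (f (n + k)%N) c &
    c <= 2 * (S / 2 ^+ n) - 2 * (S / 2 ^+ (n + k)).
  elim: k => [|k [c p cl]].
    exists 0; last by rewrite addn0 subrr.
    rewrite addn0; apply: gpath_refl.
    by have [c /gpath_in[]] := stepf n.
  have [c' p' cl'] := stepf (n + k)%N.
  exists (c + c'); first by rewrite addnS; exact: gpath_trans p p'.
  have : S / 2 ^+ (n + k.+1) = S / 2 ^+ (n + k) / 2.
    by rewrite addnS exprS invfM mulrA mulrAC.
  lra.
have small e : 0 < e -> exists N, S / 2 ^+ N < e.
  move=> e0; exists (Num.truncn (S / e)).+1.
  rewrite ltr_pdivrMr ?exprn_gt0// mulrC -ltr_pdivrMr//.
  apply: lt_trans (Num.Theory.truncnS_gt _) _.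
  by rewrite -natrX ltr_nat ltn_expl.
have decr n k : S / 2 ^+ (n + k) <= S / 2 ^+ n.
  by rewrite ler_wpM2l// lef_pV2 ?posrE ?exprn_gt0// ler_eXn2l ?leq_addr// ltr1n.
have Df n : D (f n) by have [c /gpath_in[]] := stepf n.
have tail N i j : (N <= i)%N -> (N <= j)%N ->
    exists2 c, gpath (f i) (f j) c & c <= 4 * (S / 2 ^+ N).
  have tail_ge0 k : 0 <= S / 2 ^+ k by rewrite divr_ge0// exprn_ge0.
  move=> /subnKC ei /subnKC ej.
  have [c1 p1 l1] := pathf N (i - N)%N; have [c2 p2 l2] := pathf N (j - N)%N.
  rewrite ei in p1 l1; rewrite ej in p2 l2.
  exists (c1 + c2); first exact: gpath_trans (gpath_sym p1) p2.
  have := tail_ge0 i; have := tail_ge0 j; lra.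
have [|p Dp cvp] := cpl f Df.
  move=> e e0; have [N hN] := small (e / 4) (divr_gt0 e0 (ltr0n _ 4)).
  by exists N => i j Ni Nj; have [c pc cl] := tail N i j Ni Nj; exists c => //; lra.
have [r r0 hr] := escapes_lower Dp.
have r30 : 0 < r / 3 by rewrite divr_gt0.
have [rho rho0 hrho] := local_gstep oD uC Dp r30.
have [N1 hN1] := cvp _ rho0; have [N2 hN2] := small _ r30.
pose n := (N2 + N1)%N.
have [h1 h2] := hN1 n (leq_addl _ _).
have := hr _ (escapes_path (gstep_path (hrho _ h1 h2)) (escf n)).
have := decr N2 N1; rewrite -/n; lra.
Qed.
End escape.

(** * Cut-off functions on complete graphs *)

Section cutoff.
Variables (R : realType) (D : set (R * R)) (u u1 u2 : R * R -> R).
Hypothesis oD : open D.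
Hypothesis uC : C1_on D u u1 u2.
Variable M : R.
Hypothesis DM : forall z, D z -> `|z.1| <= M /\ `|z.2| <= M.
Implicit Types (x y z w : R * R) (a b c t S L delta rho : R) (n : nat).
Notation gpath := (gpath D u1 u2).
Notation gstep := (gstep D u1 u2).

Definition exit_costs rho n z : set R :=
  [set c | c = rho \/ exists2 y, D y /\ ~ core D n y & gpath z y c].

(** The truncation at [rho] keeps the infimum meaningful when no path leaves the core,
    and bounds the function. *)
Definition exit_cost rho n z : R :=
  if `[< D z >] then inf (exit_costs rho n z) else 0.

Section fixed.
Variables (rho : R) (n : nat).
Hypothesis rho0 : 0 < rho.
Notation cost := (exit_cost rho n).

Lemma exit_costs_inf z : has_inf (exit_costs rho n z).
Proof.
split; first by exists rho; left.
by exists 0 => c [->|[y _ /gpath_in[]//]]; exact: ltW.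
Qed.

Lemma exit_cost_bounds z : 0 <= cost z <= rho.
Proof.
rewrite /exit_cost; case: asboolP => _; last by rewrite lexx ltW.
apply/andP; split.
  apply: lb_le_inf; first by exists rho; left.
  by move=> c [->|[y _ /gpath_in[]//]]; exact: ltW.
by apply: ge_inf; [case: (exit_costs_inf z)|left].
Qed.

Lemma exit_cost_out z : ~ core D n z -> cost z = 0.
Proof.
move=> nz; have /andP[h _] := exit_cost_bounds z.
apply/eqP; rewrite eq_le h andbT /exit_cost; case: asboolP => // Dz.
apply: ge_inf; first by case: (exit_costs_inf z).
by right; exists z => //; exact: gpath_refl.
Qed.

Lemma exit_cost_step_le z w c : gstep z w c -> cost z <= c + cost w.
Proof.
move=> st; have [Dz Dw] := gstep_in st.
have c0 : 0 <= c by case: st.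
rewrite /exit_cost; case: asboolP => // _; case: asboolP => // _.
rewrite -lerBlDl; apply: lb_le_inf; first by exists rho; left.
move=> d hd; rewrite lerBlDl; apply: le_trans (_ : Num.min rho (c + d) <= _); last first.
  by rewrite ge_min lexx orbT.
have lb := (exit_costs_inf z).2.
rewrite le_min; apply/andP; split; first by apply: ge_inf => //; left.
case: hd => [->|[y hy p]].
  by apply: (@le_trans _ _ rho); [apply: ge_inf => //; left|rewrite lerDr].
by apply: ge_inf => //; right; exists y => //; exact: gpath_trans (gstep_path st) p.
Qed.

Lemma exit_cost_step z w c : gstep z w c -> `|cost z - cost w| <= c.
Proof.
move=> st; have := exit_cost_step_le st.
have := exit_cost_step_le (gstep_sym st).
by rewrite ler_norml; lra.
Qed.

Lemma exit_cost_continuous : continuous cost.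
Proof.
move=> z; apply/continuous2P => e e0.
have [Dz|nDz] := pselect (D z).
  have e20 : 0 < e / 2 by rewrite divr_gt0.
  have [r r0 hr] := local_gstep oD uC Dz e20.
  exists r => // x y h1 h2; have := exit_cost_step (hr (x, y) h1 h2); lra.
have nz : ~ core D n z by apply: contra_not nDz; exact: core_sub.
have : nbhs z (~` core D n).
  by apply: open_nbhs_nbhs; split=> //; apply: closed_openC; exact: core_closed.
move=> /near2P[r r0 hr]; exists r => // x y h1 h2.
by rewrite !exit_cost_out ?subrr ?normr0//; exact: hr.
Qed.

Lemma exit_cost_unif_cont : unif_cont cost.
Proof.
apply: (@compact_support_unif_cont _ _ M) => [|x y h]; first exact: exit_cost_continuous.
apply: exit_cost_out => /core_sub /DM/= [h1 h2].
by case: h => h; [move: h1|move: h2]; rewrite leNgt h.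
Qed.

Lemma exit_cost_far z : D z ->
  (forall y c, D y -> ~ core D n y -> gpath z y c -> rho < c) -> cost z = rho.
Proof.
move=> Dz hf; apply/eqP; rewrite eq_le; have /andP[_ ->] := exit_cost_bounds z.
rewrite /exit_cost; case: asboolP => // _.
apply: lb_le_inf; first by exists rho; left.
by move=> c [->//|[y [Dy ny] p]]; apply: ltW; exact: hf p.
Qed.
End fixed.

Lemma lift_sqr_perturb (p1 p2 q1 q2 v1 v2 L : R) : 0 <= L ->
  lift_sqr p1 p2 v1 v2 <= L ^+ 2 ->
  `|q1 - p1| <= (2 * (L + 1))^-1 -> `|q2 - p2| <= (2 * (L + 1))^-1 ->
  lift_sqr q1 q2 v1 v2 <= (L + 1) ^+ 2.
Proof.
move=> L0 hL h1 h2.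
have L1 : 0 < 2 * (L + 1) by lra.
have sq0 (s : R) := sqr_ge0 s.
have abs (s : R) : s ^+ 2 <= L ^+ 2 -> `|s| <= L.
  by move=> h; rewrite -(ler_pXn2r (n := 2)) ?nnegrE// -normrX ger0_norm.
have b1 : `|v1| <= L.
  by apply: abs; move: hL (sq0 v2) (sq0 (p1 * v1 + p2 * v2)); rewrite /lift_sqr; lra.
have b2 : `|v2| <= L.
  by apply: abs; move: hL (sq0 v1) (sq0 (p1 * v1 + p2 * v2)); rewrite /lift_sqr; lra.
have b3 : `|p1 * v1 + p2 * v2| <= L.
  by apply: abs; move: hL (sq0 v1) (sq0 v2); rewrite /lift_sqr; lra.
pose d := (q1 - p1) * v1 + (q2 - p2) * v2.
have hd : `|d| <= 1.
  apply: le_trans (ler_normD _ _) _; rewrite !normrM.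
  have k1 := ler_pM (normr_ge0 _) (normr_ge0 _) h1 b1.
  have k2 := ler_pM (normr_ge0 _) (normr_ge0 _) h2 b2.
  apply: le_trans (lerD k1 k2) _.
  by rewrite -mulrDr mulrC ler_pdivrMr//; lra.
have e : q1 * v1 + q2 * v2 = p1 * v1 + p2 * v2 + d by rewrite /d; ring.
move: hL; rewrite /lift_sqr e; move: (p1 * v1 + p2 * v2) b3 d hd {e} => s hs d hd hL.
have hsd : s * d <= L.
  apply: le_trans (ler_norm _) _; rewrite normrM -[L]mulr1.
  exact: ler_pM.
have hdd : d ^+ 2 <= 1.
  by rewrite -[1](expr1n _ 2) -real_normK ?num_real// ler_pXn2r ?nnegrE.
have := sq0 d; nra.
Qed.

(** On a complete graph the cost of leaving a large core exceeds any given [rho] at [z0].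
    This cost, truncated at [rho] and divided by [rho], has Lipschitz constant [1 / rho]
    for the length on the graph and vanishes off the core; averaging makes it C^1. Over a
    small averaging square the gradient of [u] hardly changes, which replaces the bound
    [L] on the length of directions by [L + 1]. *)
Lemma cutoff_exists z0 L : D z0 -> path_complete D u1 u2 -> 0 <= L ->
  exists2 s : R, 0 < s & forall delta : R, 0 < delta ->
  exists chi chi1 chi2 : R * R -> R, [/\ C1_on setT chi chi1 chi2,
    (forall z, 0 <= chi z <= 1),
    (exists2 K, compact K /\ K `<=` D & forall z, ~ K z ->
       [/\ chi z = 0, chi1 z = 0 & chi2 z = 0]),
    (forall a b : R, `|a - z0.1| <= s -> `|b - z0.2| <= s -> 2^-1 <= chi (a, b)) &
    (forall z (v1 v2 : R), D z -> lift_sqr (u1 z) (u2 z) v1 v2 <= L ^+ 2 ->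
       `|chi1 z * v1 + chi2 z * v2| <= delta)].
Proof.
move=> Dz0 cpl L0.
have [r r0 hr] := local_gstep oD uC Dz0 ltr01.
exists (r / 4); first by rewrite divr_gt0.
move=> delta delta0.
pose rho := Num.max 2 ((L + 1) / delta).
have rho2 : 2 <= rho by rewrite le_max lexx.
have rho0 : 0 < rho by lra.
have rhoL : (L + 1) / rho <= delta.
  by rewrite ler_pdivrMr// -ler_pdivrMl// mulrC le_max lexx orbT.
have [n hn] : exists n, forall y c, D y -> ~ core D n y -> gpath z0 y c -> rho < c.
  apply: contrapT => h; apply: (@complete_no_escape _ D u u1 u2 oD uC M z0 rho DM cpl).
  move=> n; apply: contrapT => h'; apply: h; exists n => y c Dy ny p.
  by rewrite ltNge; apply/negP => cs; apply: h'; exists y, c.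
pose f z := rho^-1 * exit_cost rho n z.
have uf : unif_cont f.
  move=> e e0; have [d d0 hd] := exit_cost_unif_cont n rho0 (mulr_gt0 rho0 e0).
  exists d => // x y x' y' h1 h2.
  rewrite /f -mulrBr normrM gtr0_norm ?invr_gt0// ltr_pdivrMl//; exact: hd.
have f01 z : 0 <= f z <= 1.
  have /andP[h1 h2] := exit_cost_bounds n rho0 z.
  by rewrite /f mulr_ge0 ?invr_ge0 ?(ltW rho0)//= mulrC ler_pdivrMr// mul1r.
have fstep z w c : gstep z w c -> `|f z - f w| <= c / rho.
  move=> st; rewrite /f -mulrBr normrM gtr0_norm ?invr_gt0// mulrC.
  by rewrite ler_wpM2r ?invr_ge0 ?(ltW rho0)//; exact: exit_cost_step.
(* averaging spreads the support from core n to core N, where 1 / (N + 1) is half of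
   1 / (n + 1) *)
pose N := (n.*2.+1)%N.
pose rn : R := n.+1%:R^-1.
have rn0 : 0 < rn by rewrite invr_gt0.
have rNE : N.+1%:R^-1 = rn / 2.
  by rewrite /rn /N -invfM -natrM; congr (_%:R^-1); rewrite muln2 doubleS.
have cK : compact (core D N) by exact: core_compact DM.
have eta0 : 0 < (2 * (L + 1))^-1 by rewrite invr_gt0; lra.
have [d1 d10 hd1] := @compact_unif_close _ _ u1 _ cK
  (fun z Kz => let: And4 _ _ c _ := uC (core_sub Kz) in c) eta0.
have [d2 d20 hd2] := @compact_unif_close _ _ u2 _ cK
  (fun z Kz => let: And4 _ _ _ c := uC (core_sub Kz) in c) eta0.
pose mm := Num.min (Num.min r rn) (Num.min d1 d2).
have mm0 : 0 < mm by rewrite !lt_min r0 rn0 d10 d20.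
pose h := mm / 8.
have h0 : 0 < h by rewrite divr_gt0.
have hlt d : h * 8 <= d -> 2 * h < d by lra.
have hlt' d : h * 8 <= d -> 2 * h < d / 2 by lra.
have [hr8 hrn hd18 hd28] : [/\ h * 8 <= r, h * 8 <= rn, h * 8 <= d1 & h * 8 <= d2].
  by rewrite /h divfK ?pnatr_eq0// /mm !ge_min !lexx !orbT.
have fout a b : ~ core D N (a, b) -> forall s t, 0 <= s <= h -> 0 <= t <= h ->
    f (a + s, b + t) = 0.
  move=> nz s t /andP[s0 sh] /andP[t0 th].
  rewrite /f exit_cost_out ?mulr0// => hc; apply: nz => x y /=; rewrite rNE => h1 h2.
  apply: hc; rewrite /= -/rn.
    by have := ler_distD a (a + s) x; rewrite (_ : a + s - a = s) ?(ger0_norm s0); [lra|ring].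
  by have := ler_distD b (b + t) y; rewrite (_ : b + t - b = t) ?(ger0_norm t0); [lra|ring].
have hI : 0 <= h <= h by rewrite lexx ltW.
have zI : 0 <= (0 : R) <= h by rewrite lexx ltW.
have eq0 (s : R) : 0 * h <= s <= 0 * h -> s = 0.
  by rewrite !mul0r -eq_le => /eqP.
have out a b : ~ core D N (a, b) ->
    [/\ mol h f (a, b) = 0, mol1 h f (a, b) = 0 & mol2 h f (a, b) = 0].
  move=> nz; have f0 := fout _ _ nz; split.
  - apply/esym/eqP; rewrite eq_le; apply: mol_bounds => // s t sI tI.
    by rewrite f0// lexx.
  - rewrite /mol1 (eq0 _ (avg2_bounds h0 (unif_cont_diff1 h uf) _)) ?mulr0// => t tI /=.
    by rewrite f0// -[a in f (a, _)]addr0 f0// subrr lexx.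
  - rewrite /mol2 /= (eq0 _ (avg1_bounds h0 uf _)) => [|s sI]; last by rewrite f0// lexx.
    rewrite (eq0 _ (avg1_bounds h0 uf _)) ?subrr ?mulr0// => s sI.
    by rewrite -[b in f (_, b)]addr0 f0// lexx.
exists (mol h f), (mol1 h f), (mol2 h f); split.
- exact: C1_mol.
- by move=> [a b]; exact: mol_bounds.
- exists (core D N); first by split=> // z; exact: core_sub.
  by case=> a b; exact: out.
- move=> a b ha hb; have [] := andP (_ : 2^-1 <= mol h f (a, b) <= 1); last by [].
  apply: mol_bounds => // s t /andP[s0 sh] /andP[t0 th].
  have /andP[_ ->] := f01 (a + s, b + t); rewrite andbT.
  have st : gstep z0 (a + s, b + t) 1.
    apply: hr => /=.
      have := ler_distD a z0.1 (a + s); rewrite (distrC z0.1 a) opprD addNKr normrN (ger0_norm s0); lra.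
    have := ler_distD b z0.2 (b + t); rewrite (distrC z0.2 b) opprD addNKr normrN (ger0_norm t0); lra.
  have := fstep _ _ _ st.
  have -> : f z0 = 1 by rewrite /f (exit_cost_far rho0 Dz0 hn) mulVf// gt_eqF.
  have : 1 / rho <= 2^-1 by rewrite div1r lef_pV2 ?posrE.
  by rewrite ler_norml; lra.
- move=> [a b] v1 v2 Dz hv; have [Kz|nKz] := pselect (core D N (a, b)); last first.
    by have [_ -> ->] := out _ _ nKz; rewrite !mul0r addr0 normr0 ltW.
  apply: le_trans rhoL.
  have L1 : 0 < L + 1 by lra.
  have abs (s : R) : s ^+ 2 <= L ^+ 2 -> `|s| <= L.
    by move=> ?; rewrite -(ler_pXn2r (n := 2)) ?nnegrE// -normrX ger0_norm// sqr_ge0.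
  have b1 : `|v1| <= L.
    apply: abs; move: hv (sqr_ge0 v2) (sqr_ge0 (u1 (a, b) * v1 + u2 (a, b) * v2)).
    by rewrite /lift_sqr; lra.
  have b2 : `|v2| <= L.
    apply: abs; move: hv (sqr_ge0 v1) (sqr_ge0 (u1 (a, b) * v1 + u2 (a, b) * v2)).
    by rewrite /lift_sqr; lra.
  have small (s v tau th : R) : 0 <= s <= h -> `|v| <= L -> 0 < tau < h / (L + 1) ->
      0 <= th <= 1 -> `|s + th * (tau * v)| <= 2 * h.
    move=> /andP[s0 sh] vL /andP[tau0]; rewrite ltr_pdivlMr// => tauh /andP[th0 th1].
    have k1 : `|th * (tau * v)| <= h.
      rewrite !normrM (ger0_norm th0) (gtr0_norm tau0).
      have : tau * `|v| <= tau * L by rewrite ler_pM2l.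
      have := mulr_ge0 (ltW tau0) (normr_ge0 v); nra.
    by have := ler_normD s (th * (tau * v)); rewrite (ger0_norm s0); lra.
  apply: (@mol_directional _ h f a b v1 v2 _ (h / (L + 1))) => //; first exact: divr_gt0.
  move=> s t tau sI tI tauI.
  have tau0 : 0 < tau by case/andP: tauI.
  rewrite distrC mulrAC; apply: fstep; split=> [|th thI].
    by rewrite mulr_ge0 ?ltW.
  have k1 : `|a - (a + (s + th * (tau * v1)))| <= 2 * h.
    by rewrite opprD addNKr normrN; exact: small.
  have k2 : `|b - (b + (t + th * (tau * v2)))| <= 2 * h.
    by rewrite opprD addNKr normrN; exact: small.
  have -> : seg (a + s, b + t) (a + s + tau * v1, b + t + tau * v2) th =
     (a + (s + th * (tau * v1)), b + (t + th * (tau * v2))).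
    by rewrite /seg /=; congr (_, _); ring.
  split.
    by apply: Kz; rewrite /= rNE;
      [exact: le_lt_trans k1 (hlt' _ hrn)|exact: le_lt_trans k2 (hlt' _ hrn)].
  rewrite /= (_ : a + s + tau * v1 - (a + s) = tau * v1); last by ring.
  rewrite (_ : b + t + tau * v2 - (b + t) = tau * v2); last by ring.
  have hu1 : `|u1 (a + (s + th * (tau * v1)), b + (t + th * (tau * v2))) - u1 (a, b)| <=
      (2 * (L + 1))^-1.
    rewrite distrC; apply/ltW/(hd1 _ Kz).
      exact: le_lt_trans k1 (hlt _ hd18).
    exact: le_lt_trans k2 (hlt _ hd18).
  have hu2 : `|u2 (a + (s + th * (tau * v1)), b + (t + th * (tau * v2))) - u2 (a, b)| <=
      (2 * (L + 1))^-1.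
    rewrite distrC; apply/ltW/(hd2 _ Kz).
      exact: le_lt_trans k1 (hlt _ hd28).
    exact: le_lt_trans k2 (hlt _ hd28).
  have hq := lift_sqr_perturb L0 hv hu1 hu2; rewrite exprMn.
  apply: le_trans (_ : tau ^+ 2 * (L + 1) ^+ 2 <= _); last by rewrite mulrC.
  apply: le_trans (ler_wpM2l (sqr_ge0 tau) hq).
  by rewrite /lift_sqr le_eqVlt; apply/orP; left; apply/eqP; ring.
Qed.
End cutoff.

(** * Products, compositions and special functions *)

Section C1_algebra.
Variable R : realType.
Implicit Types (D : set (R * R)) (f g : R * R -> R).

Lemma C1_on_sub D D' f f1 f2 : D `<=` D' -> C1_on D' f f1 f2 -> C1_on D f f1 f2.
Proof. by move=> DD h z /DD /h. Qed.

Lemma C1_cst D c : C1_on D (cst c) (cst 0) (cst 0).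
Proof.
move=> z _; split; try exact: is_derive_cst; exact: cst_continuous.
Qed.

Lemma C1_fst D (c : R) : C1_on D (fun z => z.1 - c) (cst 1) (cst 0).
Proof.
move=> z _; split; try exact: cst_continuous; rewrite /is_d1 /is_d2 /=.
  by rewrite -[X in is_derive _ _ _ X]subr0; exact: is_deriveB.
exact: is_derive_cst.
Qed.

Lemma C1_snd D (c : R) : C1_on D (fun z => z.2 - c) (cst 0) (cst 1).
Proof.
move=> z _; split; try exact: cst_continuous; rewrite /is_d1 /is_d2 /=.
  exact: is_derive_cst.
by rewrite -[X in is_derive _ _ _ X]subr0; exact: is_deriveB.
Qed.

Lemma C1_D D f f1 f2 g g1 g2 : C1_on D f f1 f2 -> C1_on D g g1 g2 ->
  C1_on D (fun z => f z + g z) (fun z => f1 z + g1 z) (fun z => f2 z + g2 z).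
Proof.
move=> hf hg z Dz; have [a1 a2 a3 a4] := hf z Dz; have [b1 b2 b3 b4] := hg z Dz.
by split; [exact: is_deriveD|exact: is_deriveD|exact: cvgD|exact: cvgD].
Qed.

Lemma C1_N D f f1 f2 : C1_on D f f1 f2 ->
  C1_on D (fun z => - f z) (fun z => - f1 z) (fun z => - f2 z).
Proof.
move=> hf z Dz; have [a1 a2 a3 a4] := hf z Dz.
by split; [exact: is_deriveN|exact: is_deriveN|exact: cvgN|exact: cvgN].
Qed.

Lemma C1_M D f f1 f2 g g1 g2 : open D -> C1_on D f f1 f2 -> C1_on D g g1 g2 ->
  C1_on D (fun z => f z * g z) (fun z => f1 z * g z + f z * g1 z)
    (fun z => f2 z * g z + f z * g2 z).
Proof.
move=> oD hf hg z Dz; have [a1 a2 a3 a4] := hf z Dz; have [b1 b2 b3 b4] := hg z Dz.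
have cf := C1_on_continuous oD hf Dz; have cg := C1_on_continuous oD hg Dz.
split.
- apply: (is_derive_eq (@is_deriveM _ _ (fun a => f (a, z.2)) (fun a => g (a, z.2)) _ _ _ _ a1 b1)).
  by rewrite /= -surjective_pairing /GRing.scale/=; ring.
- apply: (is_derive_eq (@is_deriveM _ _ (fun b => f (z.1, b)) (fun b => g (z.1, b)) _ _ _ _ a2 b2)).
  by rewrite /= -surjective_pairing /GRing.scale/=; ring.
- by apply: cvgD; exact: cvgM.
- by apply: cvgD; exact: cvgM.
Qed.

Lemma C1_comp D f f1 f2 (h h' : R -> R) : open D -> C1_on D f f1 f2 ->
  (forall z, D z -> is_derive (f z) 1 h (h' (f z)) /\ {for f z, continuous h'}) ->
  C1_on D (fun z => h (f z)) (fun z => h' (f z) * f1 z) (fun z => h' (f z) * f2 z).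
Proof.
move=> oD hf hh z Dz; have [a1 a2 a3 a4] := hf z Dz; have [b1 b2] := hh z Dz.
have cf := C1_on_continuous oD hf Dz.
have chf : {for z, continuous (fun z => h' (f z))}.
  exact: (@continuous_comp _ _ _ f h' z cf b2).
split; try exact: cvgM.
- rewrite {1}(surjective_pairing z) in b1.
  exact: (@is_derive1_comp _ h (fun a => f (a, z.2)) z.1 _ _ b1 a1).
- rewrite {1}(surjective_pairing z) in b1.
  exact: (@is_derive1_comp _ h (fun b => f (z.1, b)) z.2 _ _ b1 a2).
Qed.

Definition ext0 D f z := if `[< D z >] then f z else 0.

(** Outside of the closed set [K] all three extensions vanish on a neighbourhood; inside
    [D] they agree locally with the given functions. *)
Lemma C1_ext0 D K f f1 f2 : open D -> closed K -> K `<=` D ->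
  C1_on D f f1 f2 -> (forall z, D z -> ~ K z -> f z = 0) ->
  [/\ C1_on setT (ext0 D f) (ext0 D f1) (ext0 D f2) &
   forall z, ~ K z -> [/\ ext0 D f z = 0, ext0 D f1 z = 0 & ext0 D f2 z = 0]].
Proof.
move=> oD cK KD hf f0.
have E0 g z : D z -> ext0 D g z = g z by rewrite /ext0 => Dz; case: asboolP.
have near0 z : ~ K z -> exists2 r : R, 0 < r & forall x y, `|z.1 - x| < r ->
    `|z.2 - y| < r -> ~ K (x, y) /\ ext0 D f (x, y) = 0.
  move=> nK; have : nbhs z (~` K).
    by apply: open_nbhs_nbhs; split=> //; exact: closed_openC.
  move=> /near2P[r r0 hr]; exists r => // x y hx hy; split; first exact: hr.
  by rewrite /ext0; case: asboolP => // Dxy; apply: f0 => //; exact: hr.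
have d0 z : ~ K z -> is_d1 (ext0 D f) z 0 /\ is_d2 (ext0 D f) z 0.
  move=> nK; have [r r0 hr] := near0 z nK; split.
    apply: (@near_eq_is_derive _ _ _ (cst 0)).
    apply/nbhs_ballP; exists r => // a' ha; apply/esym; apply: (hr _ _ ha _).2.
    by rewrite subrr normr0.
  apply: (@near_eq_is_derive _ _ _ (cst 0)).
  apply/nbhs_ballP; exists r => // a' ha; apply/esym; apply: (hr _ _ _ ha).2.
  by rewrite subrr normr0.
have dD z : D z -> is_d1 (ext0 D f) z (f1 z) /\ is_d2 (ext0 D f) z (f2 z).
  move=> Dz; have [a1 a2 _ _] := hf z Dz.
  have /near2P[r r0 hr] : nbhs z D by exact: open_nbhs_nbhs.
  split.
    apply: near_eq_is_derive a1.
    apply/nbhs_ballP; exists r => // a' ha; rewrite E0//; apply: hr => //.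
    by rewrite subrr normr0.
  apply: near_eq_is_derive a2.
  apply/nbhs_ballP; exists r => // a' ha; rewrite E0//; apply: hr => //.
  by rewrite subrr normr0.
have z0 z : ~ K z -> [/\ ext0 D f z = 0, ext0 D f1 z = 0 & ext0 D f2 z = 0].
  move=> nK; have [r r0 hr] := near0 z nK.
  have [e1 e2] := d0 z nK; split.
  - by rewrite (surjective_pairing z); apply: (hr _ _ _ _).2; rewrite subrr normr0.
  - rewrite /ext0; case: asboolP => // Dz; have [a1 _] := dD z Dz.
    by rewrite -(@derive_val _ _ _ _ _ _ _ a1) (@derive_val _ _ _ _ _ _ _ e1).
  - rewrite /ext0; case: asboolP => // Dz; have [_ a2] := dD z Dz.
    by rewrite -(@derive_val _ _ _ _ _ _ _ a2) (@derive_val _ _ _ _ _ _ _ e2).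
split=> // z _; have [Kz|nK] := pselect (K z).
  have Dz := KD _ Kz; have [a1 a2] := dD z Dz; have [_ _ c1 c2] := hf z Dz.
  have cE g : {for z, continuous g} -> {for z, continuous (ext0 D g)}.
    have /near2P[r r0 hr] : nbhs z D by exact: open_nbhs_nbhs.
    move=> /continuous2P cg; apply/continuous2P => e /cg[r' r'0 hr'].
    exists (Num.min r r') => [|x y]; first by rewrite lt_min r0.
    rewrite !lt_min => /andP[x1 x2] /andP[y1 y2].
    by rewrite !E0//; [exact: hr'|exact: hr].
  by split; [rewrite E0|rewrite E0|exact: cE|exact: cE].
have [r r0 hr] := near0 z nK; have [e1 e2] := d0 z nK; have [_ z1 z2] := z0 z nK.
have cE g : (forall w, ~ K w -> ext0 D g w = 0) -> {for z, continuous (ext0 D g)}.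
  move=> g0; apply/continuous2P => e e0; exists r => // x y hx hy.
  by rewrite !g0 ?subrr ?normr0//; exact: (hr _ _ hx hy).1.
split; [by rewrite z1|by rewrite z2|apply: cE|apply: cE] => w /z0[]//.
Qed.
End C1_algebra.

Section special_functions.
Variable R : realType.
Implicit Types (s t : R).

Definition pospart t : R := Num.max t 0.

Lemma continuous_pospart : continuous pospart.
Proof.
move=> t; apply/cvgrPdist_lt => e e0; apply/nbhs_ballP; exists e => // s /=.
rewrite /ball/= /pospart !ltr_norml => /andP[h1 h2].
by case: (leP t 0) => ?; case: (leP s 0) => ?; lra.
Qed.

Lemma is_derive_sqr_pospart t : is_derive t 1 (fun t => pospart t ^+ 2) (2 * pospart t).
Proof.
have [t0|t0|->] := ltgtP t 0.
- rewrite {2}/pospart max_r ?ltW// mulr0.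
  apply: (@near_eq_is_derive _ _ _ (cst 0)).
  apply/nbhs_ballP; exists (- t) => [/=|s]; first lra.
  rewrite /ball/= ltr_norml /pospart => /andP[h1 h2].
  by rewrite max_r ?expr0n//; lra.
- rewrite {2}/pospart max_l ?ltW//.
  apply: (@near_eq_is_derive _ _ _ (fun s => s ^+ 2)); last first.
    by apply: is_derive_eq; rewrite /GRing.scale/=; ring.
  apply/nbhs_ballP; exists t => [//|s].
  rewrite /ball/= ltr_norml /pospart => /andP[h1 h2].
  by rewrite max_l//; lra.
- rewrite {2}/pospart maxxx mulr0; apply/is_derive1_caratheodory; exists pospart; split.
  + move=> s; rewrite /pospart maxxx expr0n subr0/= subr0.
    by case: (leP s 0) => ?; rewrite ?expr2//; ring.
  + exact: continuous_pospart.
  + by rewrite /pospart maxxx.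
Qed.

(** A C^1 step from 0 on [t <= 0] to 1 on [1 <= t], the primitive of a tent function. *)
Definition ramp t : R := 2 * pospart t ^+ 2 - 4 * pospart (t - 2^-1) ^+ 2 + 2 * pospart (t - 1) ^+ 2.
Definition ramp' t : R := 4 * pospart t - 8 * pospart (t - 2^-1) + 4 * pospart (t - 1).

Lemma is_derive_ramp t : is_derive t 1 ramp (ramp' t).
Proof.
have sh c : is_derive t 1 (fun t => pospart (t - c) ^+ 2) (2 * pospart (t - c)).
  rewrite -[X in is_derive _ _ _ X]mulr1.
  apply: (@is_derive1_comp _ (fun t => pospart t ^+ 2) (fun t => t - c)).
    exact: is_derive_sqr_pospart.
  by rewrite -[X in is_derive _ _ _ X]subr0; exact: is_deriveB.
have s0 := is_derive_sqr_pospart t; have s1 := sh 2^-1; have s2 := sh 1.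
have h := is_deriveD (is_deriveB (is_deriveZ 2 s0) (is_deriveZ 4 s1)) (is_deriveZ 2 s2).
have -> : ramp' t = 2 *: (2 * pospart t) - 4 *: (2 * pospart (t - 2^-1)) + 2 *: (2 * pospart (t - 1)).
  by rewrite /ramp' /GRing.scale/=; ring.
exact: h.
Qed.

Lemma continuous_ramp' : continuous ramp'.
Proof.
have sh c : continuous (fun t => pospart (t - c)).
  move=> t; apply: (@continuous_comp _ _ _ (fun t => t - c) pospart); last exact: continuous_pospart.
  by apply: cvgB; [exact: cvg_id|exact: cvg_cst].
move=> t; apply: cvgD; last by apply: cvgMr; exact: sh.
by apply: cvgB; apply: cvgMr; [exact: continuous_pospart|exact: sh].
Qed.

Lemma ramp0 t : t <= 0 -> ramp t = 0.
Proof. by move=> t0; rewrite /ramp /pospart !max_r//; [ring|lra|lra]. Qed.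

Lemma ramp1 t : 1 <= t -> ramp t = 1.
Proof. by move=> t0; rewrite /ramp /pospart !max_l//; [field|lra|lra|lra]. Qed.

Lemma ramp_bounds t : 0 <= ramp t <= 1.
Proof.
rewrite /ramp /pospart; case: (leP t 0); case: (leP (t - 2^-1) 0); case: (leP (t - 1) 0);
  move=> h1 h2 h3; apply/andP; split; nra.
Qed.

Lemma ramp'_ge0 t : 0 <= ramp' t.
Proof.
by rewrite /ramp' /pospart; case: (leP t 0); case: (leP (t - 2^-1) 0); case: (leP (t - 1) 0);
  move=> h1 h2 h3; lra.
Qed.

(** A bounded function whose derivative is positive and has logarithmic derivative at most
    [e]: composed with [u], [decay] weights the field [Z] without spoiling the positivity of
    its divergence, and its primitive [sigm] is a scaled arctangent. *)
Definition sigm (e t : R) : R := atan (e * t) / e.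
Definition decay (e t : R) : R := (1 + (e * t) ^+ 2)^-1.
Definition decay' (e t : R) : R := - (1 + (e * t) ^+ 2) ^- 2 * (2 * e ^+ 2 * t).

Lemma decay_den_gt0 e t : 0 < 1 + (e * t) ^+ 2.
Proof. by rewrite ltr_pwDl// sqr_ge0. Qed.

Lemma is_derive_sigm e t : e != 0 -> is_derive t 1 (sigm e) (decay e t).
Proof.
move=> e0; have h1 : is_derive t 1 (fun t => e * t) e.
  by rewrite -[X in is_derive _ _ _ X]mulr1; exact: is_deriveZ.
have h2 := is_derive1_comp (is_derive1_atan (e * t)) h1.
have -> : sigm e = (e^-1 \*: (atan \o (fun t => e * t)) : R -> R).
  by apply/funext => s; rewrite /sigm mulrC.
by apply: (is_derive_eq (is_deriveZ e^-1 h2)); rewrite /decay /GRing.scale/= mulrCA mulVf// mulr1.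
Qed.

Lemma is_derive_decay e t : is_derive t 1 (decay e) (decay' e t).
Proof.
have h1 : is_derive t 1 (fun t => 1 + (e * t) ^+ 2) (2 * e ^+ 2 * t).
  have h : is_derive t 1 (fun t => e * t) e.
    by rewrite -[X in is_derive _ _ _ X]mulr1; exact: is_deriveZ.
  have h2 := is_deriveD (is_derive_cst (1 : R) t 1) (is_deriveM h h).
  have -> : 2 * e ^+ 2 * t = 0 + (e * t *: e + e * t *: e).
    by rewrite /GRing.scale/=; ring.
  exact: h2.
by apply: (@is_deriveV _ _ _ _ _ _ h1); rewrite gt_eqF ?decay_den_gt0.
Qed.

Lemma continuous_den e : continuous (fun t => 1 + (e * t) ^+ 2).
Proof.
move=> t; apply: cvgD; first exact: cvg_cst.
by apply: cvgM; apply: cvgMr; exact: cvg_id.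
Qed.

Lemma continuous_decay e : continuous (decay e).
Proof. by move=> t; exact: is_derive_continuous (is_derive_decay e t). Qed.

Lemma continuous_decay' e : continuous (decay' e).
Proof.
move=> t; apply: cvgM; last by apply: cvgMr; exact: cvg_id.
apply: cvgN; apply: cvgV; first by rewrite expf_neq0// gt_eqF// decay_den_gt0.
by apply: cvgM; exact: continuous_den.
Qed.

Lemma decay_bounds e t : 0 < decay e t <= 1.
Proof.
rewrite /decay invr_gt0 decay_den_gt0 /= invf_le1 ?decay_den_gt0//.
by rewrite lerDl sqr_ge0.
Qed.

Lemma decay'_bound e t : 0 < e -> `|decay' e t| <= e * decay e t.
Proof.
move=> e0; have d0 := decay_den_gt0 e t.
have k : `|2 * e ^+ 2 * t| <= e * (1 + (e * t) ^+ 2).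
  rewrite ler_norml; have := sqr_ge0 (1 - e * t); have := sqr_ge0 (1 + e * t).
  by move=> h1 h2; apply/andP; split; nra.
rewrite /decay' /decay mulNr normrN normrM.
move: (1 + (e * t) ^+ 2) d0 k => d d0 k.
rewrite ger0_norm ?invr_ge0 ?exprn_ge0 ?(ltW d0)//.
have -> : e * d^-1 = d ^- 2 * (e * d) by field; rewrite gt_eqF.
by rewrite ler_wpM2l// invr_ge0 exprn_ge0// ltW.
Qed.

Lemma sigm_bound e t : 0 < e -> `|sigm e t| <= 2 / e.
Proof.
move=> e0; rewrite /sigm normrM [`|e^-1|]gtr0_norm ?invr_gt0//.
rewrite ler_wpM2r ?invr_ge0 ?(ltW e0)// ler_norml.
have := atan_gtNpi2 (e * t); have := atan_ltpi2 (e * t).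
have := @pihalf_lt2 R; lra.
Qed.
End special_functions.

(** * Pointwise inequalities on a translating graph *)

Section pointwise.
Variable R : realType.
Variables (a b p1 p2 W g : R).
Hypothesis W1 : 1 <= W.
Hypothesis WE : W ^+ 2 = 1 + p1 ^+ 2 + p2 ^+ 2.
Hypothesis g0 : 0 <= g.
Let S := a * p1 + b * p2.
Let phi := a ^+ 2 + b ^+ 2.

Lemma cauchy_S : S ^+ 2 <= phi * (W ^+ 2 - 1).
Proof.
rewrite WE /S /phi -subr_ge0.
have -> : (a ^+ 2 + b ^+ 2) * (1 + p1 ^+ 2 + p2 ^+ 2 - 1) - (a * p1 + b * p2) ^+ 2 =
  (a * p2 - b * p1) ^+ 2 by ring.
exact: sqr_ge0.
Qed.

Lemma S_le_W L : 0 <= L -> phi <= L ^+ 2 -> `|S| <= L * W.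
Proof.
move=> L0 pL; have W0 : 0 <= W by exact: le_trans ler01 W1.
rewrite -(ler_pXn2r (n := 2)) ?nnegrE ?mulr_ge0// -normrX ger0_norm ?sqr_ge0//.
apply: le_trans cauchy_S _; rewrite exprMn.
have := ler_wpM2r (sqr_ge0 W) pL; have : 0 <= phi by rewrite addr_ge0 ?sqr_ge0.
nra.
Qed.

(** An orthogonal projection does not increase lengths: the vector in question is the
    horizontal part of the projection of [(a, b, 0)] to the tangent plane, so the vector
    that lies over it is this projection itself. *)
Lemma lift_sqr_tangential L : phi <= L ^+ 2 ->
  lift_sqr p1 p2 (a - S * p1 / W ^+ 2) (b - S * p2 / W ^+ 2) <= L ^+ 2.
Proof.
move=> pL; have W0 : W != 0 by rewrite gt_eqF// (lt_le_trans ltr01 W1).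
apply: le_trans pL; rewrite /lift_sqr.
have W20 : W ^+ 2 != 0 by rewrite expf_neq0.
pose k := (W ^+ 2)^-1.
have kE : k * (1 + p1 ^+ 2 + p2 ^+ 2) = 1 by rewrite -WE mulVf.
have k0 : 0 <= k by rewrite invr_ge0 sqr_ge0.
have -> : (a - S * p1 / W ^+ 2) ^+ 2 + (b - S * p2 / W ^+ 2) ^+ 2 +
   (p1 * (a - S * p1 / W ^+ 2) + p2 * (b - S * p2 / W ^+ 2)) ^+ 2 =
   phi - S ^+ 2 * k.
  rewrite -/k /phi /S.
  have kE' : k * (p1 ^+ 2 + p2 ^+ 2) = 1 - k by rewrite -kE; ring.
  have -> : p1 * (a - (a * p1 + b * p2) * p1 * k) + p2 * (b - (a * p1 + b * p2) * p2 * k)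
    = (a * p1 + b * p2) * k.
    transitivity ((a * p1 + b * p2) * (1 - k * (p1 ^+ 2 + p2 ^+ 2))); first by ring.
    by rewrite kE'; ring.
  transitivity (a ^+ 2 + b ^+ 2 - 2 * (a * p1 + b * p2) ^+ 2 * k +
    (a * p1 + b * p2) ^+ 2 * k * (k * (1 + p1 ^+ 2 + p2 ^+ 2))); first by ring.
  by rewrite kE; ring.
by rewrite lerBlDr lerDl mulr_ge0 ?sqr_ge0.
Qed.

(** The right-hand side is the divergence of [Z = g ^+ 2 (W x - S X)], where [x = (a, b)] is
    the position, [X = grad u / W] and [g] is the positive part of [|x| ^+ 2 - s0]. By the
    equation [div X = C / W] the second derivatives of [u] cancel, and [W div Z] is
    [4 g (|x| ^+ 2 W ^+ 2 - S ^+ 2) + g ^+ 2 (W ^+ 2 + 1) - C g ^+ 2 S]. The first term is at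
    least [4 g |x| ^+ 2] by Cauchy--Schwarz; with half of the second it absorbs the last one
    when [C ^+ 2 g <= 8]. *)
Lemma divZ_ge (C p11 p12 p22 W_1 W_2 X11 X22 : R) :
  W_1 = (p1 * p11 + p2 * p12) / W -> W_2 = (p1 * p12 + p2 * p22) / W ->
  X11 + X22 = C / W -> C ^+ 2 * g <= 8 ->
  let S1 := p1 + a * p11 + b * p12 in let S2 := p2 + a * p12 + b * p22 in
  g ^+ 2 * W / 2 <=
   (4 * g * a * (W * a - S * (p1 / W)) +
     g ^+ 2 * (W_1 * a + W - (S1 * (p1 / W) + S * X11))) +
   (4 * g * b * (W * b - S * (p2 / W)) +
     g ^+ 2 * (W_2 * b + W - (S2 * (p2 / W) + S * X22))).
Proof.
move=> e1 e2 eX hC /=; have W0 : 0 < W by exact: lt_le_trans ltr01 W1.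
have W00 : W != 0 by rewrite gt_eqF.
set rhs := (X in _ <= X).
have -> : rhs = (4 * g * (phi * W ^+ 2 - S ^+ 2) + g ^+ 2 * (W ^+ 2 + 1) - C * g ^+ 2 * S) / W.
  have -> : rhs = 4 * g * (phi * W - S ^+ 2 / W) + g ^+ 2 * (2 * W - (p1 ^+ 2 + p2 ^+ 2) / W)
      - g ^+ 2 * S * (X11 + X22).
    by rewrite /rhs e1 e2 /phi /S; field.
  rewrite eX (_ : p1 ^+ 2 + p2 ^+ 2 = W ^+ 2 - 1); last by rewrite WE; ring.
  by field.
rewrite ler_pdivlMr//.
have cS := cauchy_S.
have phi0 : 0 <= phi by rewrite addr_ge0 ?sqr_ge0.
have k1 : C * g * S <= g * W ^+ 2 / 2 + 4 * phi.
  have x0 : 0 <= g * W ^+ 2 / 2 by rewrite divr_ge0// mulr_ge0// sqr_ge0.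
  apply: le_trans (ler_norm _) _.
  rewrite -(ler_pXn2r (n := 2)) ?nnegrE//; last by rewrite addr_ge0// mulr_ge0.
  rewrite -normrX ger0_norm ?sqr_ge0//.
  have h1 : (C * g * S) ^+ 2 <= 8 * g * (phi * W ^+ 2).
    have -> : (C * g * S) ^+ 2 = (C ^+ 2 * g) * (g * S ^+ 2) by ring.
    rewrite -[leRHS]mulrA; apply: ler_pM => //.
    - by apply: mulr_ge0 => //; exact: sqr_ge0.
    - by apply: mulr_ge0 => //; exact: sqr_ge0.
    - by rewrite ler_wpM2l// (le_trans cS)// ler_wpM2l// gerBl.
  apply: le_trans h1 _; have := sqr_ge0 (g * W ^+ 2 / 2 - 4 * phi); nra.
have k2 : g * (C * g * S) <= g * (g * W ^+ 2 / 2 + 4 * phi) by rewrite ler_wpM2l.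
have k3 : g * S ^+ 2 <= g * (phi * (W ^+ 2 - 1)) by rewrite ler_wpM2l.
have := sqr_ge0 g; nra.
Qed.
End pointwise.

(** * A lower bound for the divergence of the combined field *)

Lemma C1_on_ext (R : realType) D (f f1 f2 g g1 g2 : R * R -> R) :
  f =1 g -> f1 =1 g1 -> f2 =1 g2 -> C1_on D f f1 f2 -> C1_on D g g1 g2.
Proof. by move=> /funext -> /funext -> /funext ->. Qed.

Section bound.
Variable R : realType.
Variables (chi chi1 chi2 m dm Z1 Z2 Z11 Z22 be b1 b2 ze z1 z2 E1 E2 X1 X2 X11 X22 : R).
Variables (et p1 p2 W del c4 c7 c8 : R).
Hypotheses (chi01 : 0 <= chi <= 1) (m01 : 0 <= m <= 1) (ze01 : 0 <= ze <= 1).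
Hypotheses (be0 : 0 <= be) (be8 : be <= c8) (W1 : 1 <= W) (del0 : 0 <= del).
Hypothesis A1 : `|chi1 * Z1 + chi2 * Z2| <= del * (be * W).
Hypothesis A2 : `|dm * (p1 * Z1 + p2 * Z2)| <= m * be / 4.
Hypothesis A3 : be * W / 2 <= Z11 + Z22.
Hypothesis A4 : `|b1 * E1 + b2 * E2| <= c4.
Hypothesis A5 : be * (z1 * E1 + z2 * E2) <= 0.
Hypothesis A6 : W - 1 <= p1 * X1 + p2 * X2.
Hypothesis A7 : `|be * et * (X11 + X22)| <= c7.
Hypothesis cases : [\/ ze = 1, be = 0 | [/\ chi = 0, chi1 = 0 & chi2 = 0]].

(** The right-hand side is the divergence of [Q = chi m Z - 2 del be ze E], where [be] is
    [g ^+ 2], [ze] is a planar cut-off and [E = e - et X] with [e] constant and [grad et = m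
    (p1, p2)]. The gradient of [chi] costs at most [del m be W] by [A1]. The second part of
    [Q] repays it: [- 2 del be ze div E] contains [2 del be ze m (p1 X1 + p2 X2)], which by
    [A6] is at least [2 del m be (W - 1)] where [ze = 1]. All other terms are bounded, or
    have the right sign by [A5]. *)
Lemma div_field_ge : chi * m * be / 4 - del * (2 * c4 + 2 * c7 + 2 * c8) <=
  (chi1 * (m * Z1) + chi * (dm * p1 * Z1 + m * Z11) +
    - (0 * (be * ze * E1) + 2 * del * ((b1 * ze + be * z1) * E1 +
      be * ze * (0 + - (m * p1 * X1 + et * X11))))) +
  (chi2 * (m * Z2) + chi * (dm * p2 * Z2 + m * Z22) +
    - (0 * (be * ze * E2) + 2 * del * ((b2 * ze + be * z2) * E2 +
      be * ze * (0 + - (m * p2 * X2 + et * X22))))).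
Proof.
case/andP: chi01 => c0 c1; case/andP: m01 => m0 m1; case/andP: ze01 => ze0 ze1.
set d := (X in _ <= X).
have -> : d = m * (chi1 * Z1 + chi2 * Z2) + chi * (dm * (p1 * Z1 + p2 * Z2)) +
   chi * m * (Z11 + Z22) - 2 * del * (ze * (b1 * E1 + b2 * E2)) -
   2 * del * (be * (z1 * E1 + z2 * E2)) +
   2 * del * (ze * (m * be * (p1 * X1 + p2 * X2))) +
   2 * del * (ze * (be * et * (X11 + X22))).
  by rewrite /d; ring.
have mb0 : 0 <= m * be by exact: mulr_ge0.
have cm0 : 0 <= chi * m by exact: mulr_ge0.
have B1 : - (m * (del * (be * W))) <= m * (chi1 * Z1 + chi2 * Z2).
  by rewrite -mulrN ler_wpM2l//; move: A1; rewrite ler_norml => /andP[].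
have B2 : - (chi * (m * be / 4)) <= chi * (dm * (p1 * Z1 + p2 * Z2)).
  by rewrite -mulrN ler_wpM2l//; move: A2; rewrite ler_norml => /andP[].
have B3 : chi * m * (be * W / 2) <= chi * m * (Z11 + Z22) by rewrite ler_wpM2l.
have c40 : 0 <= c4 by exact: le_trans (normr_ge0 _) A4.
have c70 : 0 <= c7 by exact: le_trans (normr_ge0 _) A7.
have B4 : ze * (b1 * E1 + b2 * E2) <= c4.
  apply: le_trans (ler_norm _) _; rewrite normrM (ger0_norm ze0).
  by rewrite -[c4]mul1r; exact: ler_pM.
have B7 : - c7 <= ze * (be * et * (X11 + X22)).
  rewrite lerNl; apply: le_trans (ler_norm _) _; rewrite normrN normrM (ger0_norm ze0).
  by rewrite -[c7]mul1r; exact: ler_pM.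
have D4 := ler_wpM2l del0 B4; have D7 := ler_wpM2l del0 B7; have D5 := ler_wpM2l del0 A5.
have B6 : ze * (m * be * (W - 1)) <= ze * (m * be * (p1 * X1 + p2 * X2)).
  by rewrite ler_wpM2l// ler_wpM2l.
have D6 := ler_wpM2l del0 B6.
have mb8 : m * be <= c8 by apply: le_trans be8; rewrite ler_piMl.
have D8 := ler_wpM2l del0 mb8.
have cmbW : chi * m * be <= chi * m * be * W by rewrite ler_peMr// mulr_ge0.
have dmb0 : 0 <= del * (m * be) by exact: mulr_ge0.
have dmbW : del * (m * be) <= del * (m * be) * W by rewrite ler_peMr.
have c80 : 0 <= c8 by exact: le_trans be8.
have dc8 : 0 <= del * c8 by exact: mulr_ge0.
have W10 : 0 <= W - 1 by rewrite subr_ge0.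
have dmW : 0 <= del * (ze * (m * be * (W - 1))).
  by rewrite mulr_ge0// mulr_ge0// mulr_ge0.
case: cases => [e|e|[e e' e'']].
- rewrite e !mul1r in B6 D6 D4 D7 *; lra.
- move: B1 B2 B3 D4; rewrite e !(mul0r, mulr0, oppr0, addr0, subr0) => B1 B2 B3 D4.
  have := mulr_ge0 del0 c70; lra.
by move: B1 B2 B3; rewrite e e' e'' !mul0r addr0 mulr0 => B1 B2 B3; lra.
Qed.
End bound.

(** * No complete translating graph over a boundary cap *)

Section cap.
Variable R : realType.
Variables (D U : set (R * R)) (u p1 p2 p11 p12 p22 rho r1 r2 : R * R -> R).
Variables (C qa qb s0 L M : R).
Hypotheses (oD : open D) (oU : open U).
Hypothesis DM : forall z, D z -> `|z.1| <= M /\ `|z.2| <= M.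
Hypothesis uC : C1_on D u p1 p2.
Hypothesis p1C : C1_on D p1 p11 p12.
Hypothesis p2C : C1_on D p2 p12 p22.
Hypothesis rhoC : C1_on (D `&` U) rho r1 r2.

Let W z := Num.sqrt (1 + p1 z ^+ 2 + p2 z ^+ 2).
Let W_1 z := (p1 z * p11 z + p2 z * p12 z) / W z.
Let W_2 z := (p1 z * p12 z + p2 z * p22 z) / W z.
Let X1 z := p1 z / W z.
Let X2 z := p2 z / W z.
Let X11 z := p11 z / W z + p1 z * (- (W z) ^- 2 * W_1 z).
Let X12 z := p12 z / W z + p1 z * (- (W z) ^- 2 * W_2 z).
Let X21 z := p12 z / W z + p2 z * (- (W z) ^- 2 * W_1 z).
Let X22 z := p22 z / W z + p2 z * (- (W z) ^- 2 * W_2 z).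

Lemma W_sqr z : W z ^+ 2 = 1 + p1 z ^+ 2 + p2 z ^+ 2.
Proof. by rewrite sqr_sqrtr// -addrA addr_ge0// addr_ge0 ?sqr_ge0. Qed.

Lemma W_ge1 z : 1 <= W z.
Proof.
rewrite -[leLHS]sqrtr1 ler_wsqrtr// -addrA lerDl addr_ge0 ?sqr_ge0//.
Qed.

Lemma W_gt0 z : 0 < W z.
Proof. exact: lt_le_trans (W_ge1 z). Qed.

Lemma C1_W : C1_on D W W_1 W_2.
Proof.
have h := C1_D (@C1_cst R D 1) (C1_D (C1_M oD p1C p1C) (C1_M oD p2C p2C)).
have WE z : Num.sqrt (cst 1 z + (p1 z * p1 z + p2 z * p2 z)) = W z.
  by rewrite /W -!expr2 addrA.
have den_gt0 z : 0 < cst 1 z + (p1 z * p1 z + p2 z * p2 z).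
  by rewrite ltr_pwDl// addr_ge0// -expr2 sqr_ge0.
have hh : C1_on D _ _ _ := @C1_comp R D _ _ _ Num.sqrt
  (fun s => (2 * Num.sqrt s)^-1) oD h _.
apply: C1_on_ext (hh _) => [z|z|z|z Dz]; first exact: WE.
- by rewrite WE /W_1 /=; field; rewrite gt_eqF// W_gt0.
- by rewrite WE /W_2 /=; field; rewrite gt_eqF// W_gt0.
split; first exact: is_derive1_sqrt.
apply: cvgV; first by rewrite mulf_neq0// gt_eqF// sqrtr_gt0.
by apply: cvgMr; exact: sqrt_continuous.
Qed.

Lemma C1_invW : C1_on D (fun z => (W z)^-1) (fun z => - (W z) ^- 2 * W_1 z)
  (fun z => - (W z) ^- 2 * W_2 z).
Proof.
apply: (@C1_comp R D _ _ _ (fun s => s^-1) (fun s => - s ^- 2) oD C1_W) => z Dz.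
have W0 : W z != 0 by rewrite gt_eqF// W_gt0.
split.
  rewrite -[X in is_derive _ _ _ X]mulr1.
  exact: (@is_deriveV _ id _ _ _ W0 (is_derive_id _ _)).
apply: cvgN; apply: cvgV; first by rewrite expf_neq0.
exact: exprn_continuous.
Qed.

Lemma C1_X1 : C1_on D X1 X11 X12.
Proof. exact: C1_M oD p1C C1_invW. Qed.

Lemma C1_X2 : C1_on D X2 X21 X22.
Proof. exact: C1_M oD p2C C1_invW. Qed.

Let a (z : R * R) := z.1 - qa.
Let b (z : R * R) := z.2 - qb.
Let phi z := a z ^+ 2 + b z ^+ 2.
Let g z := pospart (phi z - s0).
Let be z := g z ^+ 2.
Let S z := a z * p1 z + b z * p2 z.
Let S_1 z := p1 z + a z * p11 z + b z * p12 z.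
Let S_2 z := p2 z + a z * p12 z + b z * p22 z.

Lemma C1_S : C1_on D S S_1 S_2.
Proof.
have h := C1_D (C1_M oD (@C1_fst R D qa) p1C) (C1_M oD (@C1_snd R D qb) p2C).
by apply: C1_on_ext h => z //=; rewrite /S_1 /S_2 /a /b; ring.
Qed.

Lemma C1_phi E : open E -> C1_on E phi (fun z => 2 * a z) (fun z => 2 * b z).
Proof.
move=> oE; have ha := @C1_fst R E qa; have hb := @C1_snd R E qb.
by apply: C1_on_ext (C1_D (C1_M oE ha ha) (C1_M oE hb hb)) => z /=;
  rewrite /phi /a /b ?expr2//; ring.
Qed.

Lemma C1_be E : open E -> C1_on E be (fun z => 4 * g z * a z) (fun z => 4 * g z * b z).
Proof.
move=> oE; have h := C1_D (C1_phi oE) (@C1_cst R E (- s0)).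
have hh : C1_on E _ _ _ := @C1_comp R E _ _ _ (fun s => pospart s ^+ 2) (fun s => 2 * pospart s) oE h _.
apply: C1_on_ext (hh _) => [z//|z/=|z/=|z Ez].
- by rewrite /g; ring.
- by rewrite /g; ring.
- split; first exact: is_derive_sqr_pospart.
  by apply: cvgMr; exact: continuous_pospart.
Qed.

Let Z1 z := be z * (W z * a z - S z * X1 z).
Let Z2 z := be z * (W z * b z - S z * X2 z).

Lemma C1_Z1 : exists Z12, C1_on D Z1 (fun z => 4 * g z * a z * (W z * a z - S z * X1 z) +
   be z * (W_1 z * a z + W z - (S_1 z * X1 z + S z * X11 z))) Z12.
Proof.
have h := C1_M oD (C1_be oD) (C1_D (C1_M oD C1_W (@C1_fst R D qa))
  (C1_N (C1_M oD C1_S C1_X1))).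
by eexists; apply: C1_on_ext h => z //=; rewrite mulr1.
Qed.

Lemma C1_Z2 : exists Z21, C1_on D Z2 Z21 (fun z => 4 * g z * b z * (W z * b z - S z * X2 z) +
   be z * (W_2 z * b z + W z - (S_2 z * X2 z + S z * X22 z))).
Proof.
have h := C1_M oD (C1_be oD) (C1_D (C1_M oD C1_W (@C1_snd R D qb))
  (C1_N (C1_M oD C1_S C1_X2))).
by eexists; apply: C1_on_ext h => z //=; rewrite mulr1.
Qed.

Hypothesis PDE : forall z, D z -> X11 z + X22 z = C / W z.
Hypothesis rho_lt0 : forall z, D z -> U z -> rho z < 0.
Hypotheses (L0 : 0 < L) (s00 : 0 <= s0).
Hypothesis phiL : forall z, D z -> phi z <= L ^+ 2.
Hypothesis capC : forall z, D z -> C ^+ 2 * (phi z - s0) <= 8.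
Hypothesis capU : forall z, D z -> s0 <= phi z -> U z.
Hypothesis capK : forall tau : R, 0 < tau ->
  compact [set z | [/\ D z, U z, s0 <= phi z & rho z <= - tau]].
Variables e1 e2 : R.
Hypothesis transverse : forall z, D z -> U z -> s0 <= phi z -> forall x1 x2 : R,
  x1 ^+ 2 + x2 ^+ 2 <= 1 -> 8 * L * `|x1 * r1 z + x2 * r2 z| <= e1 * r1 z + e2 * r2 z.

Let eps := (4 * L)^-1.
Let m z := decay eps (u z).
Let eta z := sigm eps (u z).

Lemma eps_gt0 : 0 < eps.
Proof. by rewrite invr_gt0 mulr_gt0. Qed.

Lemma eta_bound z : `|eta z| <= 8 * L.
Proof.
apply: le_trans (sigm_bound _ eps_gt0) _.
by rewrite /eps invrK; lra.
Qed.

Lemma X_norm z : X1 z ^+ 2 + X2 z ^+ 2 <= 1.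
Proof.
rewrite /X1 /X2 !expr_div_n -mulrDl ler_pdivrMr ?exprn_gt0 ?W_gt0// W_sqr; lra.
Qed.

Lemma X_le1 z : `|X1 z| <= 1 /\ `|X2 z| <= 1.
Proof.
have h := X_norm z; have h1 := sqr_ge0 (X1 z); have h2 := sqr_ge0 (X2 z).
by split; rewrite -(ler_pXn2r (n := 2)) ?nnegrE// -normrX ger0_norm ?sqr_ge0// expr1n; lra.
Qed.

Lemma g_bounds z : D z -> [/\ 0 <= g z, g z <= L ^+ 2 & C ^+ 2 * g z <= 8].
Proof.
move=> Dz; have h1 := phiL Dz; have h2 := capC Dz; rewrite /g /pospart.
have := sqr_ge0 L; have := s00.
by case: (leP (phi z - s0) 0) => h3 h4 h5; split; rewrite ?mulr0; lra.
Qed.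

Lemma ab_bound z : D z -> `|a z| <= L /\ `|b z| <= L.
Proof.
move=> /phiL; rewrite /phi => h; have h1 := sqr_ge0 (a z); have h2 := sqr_ge0 (b z).
by split; rewrite -(ler_pXn2r (n := 2)) ?nnegrE ?(ltW L0)// -normrX ger0_norm ?sqr_ge0//; lra.
Qed.

Let E1 z := e1 + - (eta z * X1 z).
Let E2 z := e2 + - (eta z * X2 z).

Lemma E_bound z : `|E1 z| <= `|e1| + 8 * L /\ `|E2 z| <= `|e2| + 8 * L.
Proof.
have [h1 h2] := X_le1 z; have h := eta_bound z.
split; apply: le_trans (ler_normD _ _) _; rewrite lerD2l normrN normrM -[leRHS]mulr1;
  exact: ler_pM.
Qed.

Let c4 := 4 * L ^+ 2 * L * (`|e1| + 8 * L) + 4 * L ^+ 2 * L * (`|e2| + 8 * L).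
Let c8 := L ^+ 2 ^+ 2.
Let c7 := c8 * (8 * L) * `|C|.

Lemma be_bounds z : D z -> 0 <= be z <= c8.
Proof.
move=> /g_bounds[g0 gL _]; rewrite /be sqr_ge0 /c8.
by rewrite ler_pXn2r ?nnegrE ?sqr_ge0.
Qed.

Lemma grad_be_E z : D z ->
  `|4 * g z * a z * E1 z + 4 * g z * b z * E2 z| <= c4.
Proof.
move=> Dz; have [g0 gL _] := g_bounds Dz; have [ha hb] := ab_bound Dz.
have [hE1 hE2] := E_bound z.
apply: le_trans (ler_normD _ _) _; rewrite !normrM (ger0_norm g0) [`|4|]ger0_norm//.
have k : 4 * g z <= 4 * L ^+ 2 by rewrite ler_pM2l.
have g40 : 0 <= 4 * g z by rewrite mulr_ge0.
by apply: lerD; apply: ler_pM => //; rewrite ?mulr_ge0//; apply: ler_pM.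
Qed.

Lemma eta_divX z : D z -> `|be z * eta z * (X11 z + X22 z)| <= c7.
Proof.
move=> Dz; rewrite PDE// [`|be z * eta z * _|]normrM [`|be z * eta z|]normrM.
have /andP[b0 b8] := be_bounds Dz.
rewrite (ger0_norm b0) /c7; apply: ler_pM => //.
- exact: mulr_ge0.
- by apply: ler_pM => //; exact: eta_bound.
rewrite normrM normfV (gtr0_norm (W_gt0 z)) ler_pdivrMr ?W_gt0//.
by rewrite ler_peMr// W_ge1.
Qed.

(** Since [p1 Z1 + p2 Z2 = be S / W] and [|S| <= L W], the value [eps = 1 / (4 L)] makes the
    contribution of the gradient of the weight at most a quarter of [m be]. *)
Lemma decay_pZ z : D z ->
  `|decay' eps (u z) * (p1 z * Z1 z + p2 z * Z2 z)| <= m z * be z / 4.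
Proof.
move=> Dz; have W0 : W z != 0 by rewrite gt_eqF// W_gt0.
have -> : p1 z * Z1 z + p2 z * Z2 z = be z * (S z / W z).
  rewrite /Z1 /Z2 /X1 /X2.
  transitivity (be z * (W z * S z - S z * (p1 z ^+ 2 + p2 z ^+ 2) / W z)).
    by rewrite /S; field.
  rewrite (_ : p1 z ^+ 2 + p2 z ^+ 2 = W z ^+ 2 - 1); last by rewrite W_sqr; ring.
  by field.
have /andP[b0 _] := be_bounds Dz.
have hS : `|S z / W z| <= L.
  rewrite normrM normfV (gtr0_norm (W_gt0 z)) ler_pdivrMr ?W_gt0//.
  by apply: S_le_W (W_sqr z) _ _ _; [exact: W_ge1|exact: ltW|exact: phiL].
have hd := decay'_bound (u z) eps_gt0.
rewrite normrM [`|be z * _|]normrM (ger0_norm b0).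
have -> : m z * be z / 4 = (eps * m z) * (be z * L).
  by rewrite /eps; field; rewrite gt_eqF.
by apply: ler_pM => //; [exact: mulr_ge0|exact: ler_wpM2l].
Qed.

Lemma W_pX z : W z - 1 <= p1 z * X1 z + p2 z * X2 z.
Proof.
have -> : p1 z * X1 z + p2 z * X2 z = (p1 z ^+ 2 + p2 z ^+ 2) / W z.
  by rewrite /X1 /X2; field; rewrite gt_eqF// W_gt0.
rewrite ler_pdivlMr ?W_gt0//.
rewrite (_ : p1 z ^+ 2 + p2 z ^+ 2 = W z ^+ 2 - 1); last by rewrite W_sqr; ring.
have := W_ge1 z; nra.
Qed.

Lemma chi_Z z (chi1 chi2 delta : R) : D z ->
  (forall v1 v2 : R, lift_sqr (p1 z) (p2 z) v1 v2 <= L ^+ 2 ->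
     `|chi1 * v1 + chi2 * v2| <= delta) ->
  `|chi1 * Z1 z + chi2 * Z2 z| <= delta * (be z * W z).
Proof.
move=> Dz h; have W0 : W z != 0 by rewrite gt_eqF// W_gt0.
have /andP[b0 _] := be_bounds Dz.
have -> : chi1 * Z1 z + chi2 * Z2 z = (be z * W z) *
    (chi1 * (a z - S z * p1 z / W z ^+ 2) + chi2 * (b z - S z * p2 z / W z ^+ 2)).
  by rewrite /Z1 /Z2 /X1 /X2; field.
have bW : 0 <= be z * W z by apply: mulr_ge0 => //; exact: ltW (W_gt0 z).
rewrite normrM (ger0_norm bW) mulrC ler_wpM2r//; apply: h.
by apply: lift_sqr_tangential (W_sqr z) _ _; [exact: W_ge1|exact: phiL].
Qed.

(** The cut-off increases into the domain, against [grad rho]. As [|eta X . grad rho|] is at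
    most [e . grad rho] by transversality, the field [E = e - eta X] points out of the
    domain, and the gradient of the cut-off enters with a favourable sign, however thin the
    layer in which it lives. *)
Lemma ramp_term z (tau : R) : 0 < tau -> D z -> U z ->
  be z * (ramp' (cst (- tau^-1) z * rho z + cst (-1) z) *
      (cst 0 z * rho z + cst (- tau^-1) z * r1 z + cst 0 z) * E1 z +
    ramp' (cst (- tau^-1) z * rho z + cst (-1) z) *
      (cst 0 z * rho z + cst (- tau^-1) z * r2 z + cst 0 z) * E2 z) <= 0.
Proof.
move=> tau0 Dz Uz; have [ps|sp] := leP (phi z) s0.
  by rewrite /be /g /pospart max_r ?subr_le0// expr0n mul0r.
have /andP[b0 _] := be_bounds Dz.
rewrite mulr_ge0_le0//=.
set r' := ramp' _; have r'0 : 0 <= r' := ramp'_ge0 _.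
have -> : r' * (0 * rho z + - tau^-1 * r1 z + 0) * E1 z +
    r' * (0 * rho z + - tau^-1 * r2 z + 0) * E2 z =
    - (r' * tau^-1 * (r1 z * E1 z + r2 z * E2 z)) by ring.
rewrite oppr_le0 mulr_ge0// ?mulr_ge0 ?invr_ge0 ?(ltW tau0)//.
have h := transverse Dz Uz (ltW sp) (X_norm z).
have k : eta z * (X1 z * r1 z + X2 z * r2 z) <= 8 * L * `|X1 z * r1 z + X2 z * r2 z|.
  apply: le_trans (ler_norm _) _; rewrite normrM ler_wpM2r//; exact: eta_bound.
by rewrite /E1 /E2; lra.
Qed.

Lemma C1_m : C1_on D m (fun z => decay' eps (u z) * p1 z) (fun z => decay' eps (u z) * p2 z).
Proof.
apply: C1_comp oD uC _ => z Dz; split; first exact: is_derive_decay.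
exact: continuous_decay'.
Qed.

Lemma C1_eta : C1_on D eta (fun z => m z * p1 z) (fun z => m z * p2 z).
Proof.
apply: C1_comp oD uC _ => z Dz; split; last exact: continuous_decay.
by apply: is_derive_sigm; rewrite gt_eqF// eps_gt0.
Qed.

Lemma m_bounds z : 0 < m z <= 1.
Proof. exact: decay_bounds. Qed.

(** The field [Q = chi m Z - 2 delta be ze E] has compact support in the cap: [be] vanishes
    off [phi > s0], and [chi] and [ze] vanish near the boundary of [D]. By [div_field_ge] its
    divergence is at least [- delta c2] everywhere and at least a constant independent of
    [delta], minus [delta c2], near [z0]. As its mean is zero ([divergence_mean]), this is
    impossible for small [delta]. *)
Lemma no_complete_cap z0 : D z0 -> s0 < phi z0 -> path_complete D p1 p2 -> False.
Proof.
move=> Dz0 sp0 cpl.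
have [s sg0 cut] := cutoff_exists oD uC DM Dz0 cpl (ltW L0).
have oDU : open (D `&` U) by exact: openI.
have DUD : D `&` U `<=` D by move=> z [].
(* near z0, where chi >= 1/2, this v bounds the main term chi m be / 4 from below *)
pose v z := m z * be z / 8.
have v0 : 0 < v z0.
  have /andP[m0 _] := m_bounds z0.
  by rewrite divr_gt0// mulr_gt0// exprn_gt0// /g /pospart lt_max subr_gt0 sp0.
have cv : {for z0, continuous v}.
  apply: cvgM; last exact: cvg_cst.
  exact: C1_on_continuous oD (C1_M oD C1_m (C1_be oD)) Dz0.
pose cc := v z0 / 2.
have cc0 : 0 < cc by rewrite divr_gt0.
have [s1 s10 [s1s hs1]] : exists2 s1 : R, 0 < s1 & s1 <= s /\
    forall x y, `|x - z0.1| <= s1 -> `|y - z0.2| <= s1 ->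
      (D `&` U) (x, y) /\ cc <= v (x, y).
  have /continuous2P/(_ _ cc0)[r r0 hr] := cv.
  have DUz0 : (D `&` U) z0 by split=> //; apply: capU => //; exact: ltW.
  have /near2P[r' r'0 hr'] : nbhs z0 (D `&` U) by exact: open_nbhs_nbhs.
  exists (Num.min s (Num.min r r' / 2)).
    by rewrite lt_min sg0 divr_gt0// lt_min r0.
  split=> [|x y]; first by rewrite ge_min lexx.
  have hm : Num.min r r' / 2 < Num.min r r'.
    by rewrite ltr_pdivrMr// ltr_pMr ?ltr1n// lt_min r0.
  rewrite !le_min => /andP[_ h1] /andP[_ h2].
  have := le_lt_trans h1 hm; have := le_lt_trans h2 hm.
  rewrite !lt_min distrC => /andP[y1 y2]; rewrite distrC => /andP[x1 x2].
  split; first exact: hr'.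
  by have := hr _ _ x1 y1; rewrite ltr_norml /cc; lra.
pose c2 := 2 * c4 + 2 * c7 + 2 * c8.
have c80 : 0 < c8 by rewrite !exprn_gt0.
have c40 : 0 <= c4.
  by rewrite addr_ge0// !mulr_ge0 ?addr_ge0 ?sqr_ge0 ?mulr_ge0// ltW.
have c70 : 0 <= c7 by rewrite !mulr_ge0// ltW.
have c20 : 0 < c2 by rewrite /c2; lra.
pose M' := M + s1 + 1.
have M0 : 0 <= M by have [h _] := DM Dz0; exact: le_trans h.
pose den := 2 * c2 * (M' ^+ 2 + s1 ^+ 2).
have den0 : 0 < den by rewrite mulr_gt0 ?mulr_gt0// ltr_wpDl ?sqr_ge0// exprn_gt0.
pose delta := cc * s1 ^+ 2 / den.
have delta0 : 0 < delta by rewrite divr_gt0// mulr_gt0// exprn_gt0.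
have delta_small : delta * c2 * M' ^+ 2 < (cc - delta * c2) * s1 ^+ 2.
  have e : delta * (2 * c2 * (M' ^+ 2 + s1 ^+ 2)) = cc * s1 ^+ 2 by rewrite divfK// gt_eqF.
  have : 0 < cc * s1 ^+ 2 by rewrite mulr_gt0// exprn_gt0.
  lra.
have MM : M < M' by rewrite /M'; lra.
have [z01 z02] : `|z0.1| + s1 < M' /\ `|z0.2| + s1 < M'.
  by have [] := DM Dz0; rewrite /M'; lra.
have [chi [chi1 [chi2 [Cchi chi01 [K1 [cK1 K1D] chi0] chi_half chi_d]]]] := cut _ delta0.
(* the gradient of chi must be paid for wherever it does not vanish on the cap; there
   rho <= - 2 tau, so that ze = 1 *)
have cphi : continuous phi.
  by move=> z; exact: C1_on_continuous openT (C1_phi openT) I.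
have clphi : closed [set z | s0 <= phi z].
  apply: (@preimage_closed _ _ phi [set t | s0 <= t]); last exact: closed_ge.
  by move=> z _; exact: cphi.
pose K1c := K1 `&` [set z | s0 <= phi z].
have cK1c : compact K1c by exact: compact_closedI.
have K1cDU : K1c `<=` D `&` U.
  by move=> z [/K1D Dz sp]; split=> //; exact: capU.
have [tau tau0 htau] : exists2 tau : R, 0 < tau & forall z, K1c z -> rho z <= - (2 * tau).
  have [[w Kw]|ne] := pselect (exists w, K1c w); last first.
    by exists 1 => // z Kz; case: ne; exists z.
  have [|||c cK hc] := @compact_EVT_max _ R rho K1c.
  - by exists w.
  - exact: cK1c.
  - apply: continuous_in_subspaceT => z /set_mem /K1cDU DUz.
    exact: C1_on_continuous oDU rhoC DUz.
  have [Dc Uc] := K1cDU _ (set_mem cK).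
  exists (- rho c / 2); first by rewrite divr_gt0// oppr_gt0 rho_lt0.
  move=> z Kz; have := hc z (mem_set Kz).
  by rewrite mulrC divfK ?opprK.
pose ze z := ramp (cst (- tau^-1) z * rho z + cst (-1) z).
have Cze : C1_on (D `&` U) ze _ _ := @C1_comp R _ _ _ _ (@ramp R) (@ramp' R) oDU
  (C1_D (C1_M oDU (@C1_cst R _ (- tau^-1)) rhoC) (@C1_cst R _ (-1)))
  (fun z _ => conj (@is_derive_ramp R _) (@continuous_ramp' R _)).
have sub f f1 f2 : C1_on D f f1 f2 -> C1_on (D `&` U) f f1 f2 := C1_on_sub DUD.
have CE1 := C1_D (@C1_cst R (D `&` U) e1) (C1_N (C1_M oDU (sub _ _ _ C1_eta) (sub _ _ _ C1_X1))).
have CE2 := C1_D (@C1_cst R (D `&` U) e2) (C1_N (C1_M oDU (sub _ _ _ C1_eta) (sub _ _ _ C1_X2))).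
have Cchi' : C1_on (D `&` U) chi chi1 chi2 by move=> z _; exact: Cchi.
have Cbe' := C1_be oDU.
have [Z12 CZ1'] := C1_Z1; have [Z21 CZ2'] := C1_Z2.
have CQ1 := C1_D (C1_M oDU Cchi' (C1_M oDU (sub _ _ _ C1_m) (sub _ _ _ CZ1')))
  (C1_N (C1_M oDU (@C1_cst R _ (2 * delta)) (C1_M oDU (C1_M oDU Cbe' Cze) CE1))).
have CQ2 := C1_D (C1_M oDU Cchi' (C1_M oDU (sub _ _ _ C1_m) (sub _ _ _ CZ2')))
  (C1_N (C1_M oDU (@C1_cst R _ (2 * delta)) (C1_M oDU (C1_M oDU Cbe' Cze) CE2))).
pose K := K1c `|` [set z | [/\ D z, U z, s0 <= phi z & rho z <= - tau]].
have clK : closed K.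
  have hausd : hausdorff_space (R * R)%type by exact: norm_hausdorff.
  by apply: closedU; apply: compact_closed => //; exact: capK.
have KDU : K `<=` D `&` U by move=> z [/K1cDU//|[]].
have out z : (D `&` U) z -> ~ K z -> be z = 0 \/ (chi z = 0 /\ ze z = 0).
  move=> [Dz Uz] nK; have [sp|ps] := leP s0 (phi z); last first.
    by left; rewrite /be /g /pospart max_r ?expr0n// subr_le0 ltW.
  right; split.
    by have [|] := chi0 z => // Kz; apply: nK; left.
  have rt : - tau < rho z.
    by rewrite ltNge; apply/negP => h; apply: nK; right.
  apply: ramp0 => /=; rewrite mulNr subr_le0 lerNl mulrC ler_pdivlMr//.
  lra.
have [|CF1 zF1] := C1_ext0 oDU clK KDU CQ1.
  by move=> z Dz nK; case: (out z Dz nK) => [h|[h1 h2]]; rewrite ?h ?h1 ?h2 /Z1 ?h; ring.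
have [|CF2 zF2] := C1_ext0 oDU clK KDU CQ2.
  by move=> z Dz nK; case: (out z Dz nK) => [h|[h1 h2]]; rewrite ?h ?h1 ?h2 /Z2 ?h; ring.
have A3 z : D z -> be z * W z / 2 <=
   (4 * g z * a z * (W z * a z - S z * X1 z) +
   be z * (W_1 z * a z + W z - (S_1 z * X1 z + S z * X11 z))) +
   (4 * g z * b z * (W z * b z - S z * X2 z) +
   be z * (W_2 z * b z + W z - (S_2 z * X2 z + S z * X22 z))).
  move=> Dz; have [g0 gL gC] := g_bounds Dz.
  exact: (@divZ_ge R (a z) (b z) (p1 z) (p2 z) (W z) (g z) (W_ge1 z) (W_sqr z) g0
    C (p11 z) (p12 z) (p22 z) (W_1 z) (W_2 z) (X11 z) (X22 z) erefl erefl (PDE Dz) gC).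
have cases z : D z -> [\/ ze z = 1, be z = 0 | [/\ chi z = 0, chi1 z = 0 & chi2 z = 0]].
  move=> Dz; have [Kz|nK] := pselect (K1 z); last by apply: Or33; exact: chi0.
  have [sp|ps] := leP s0 (phi z); last first.
    by apply: Or32; rewrite /be /g /pospart max_r ?expr0n// subr_le0 ltW.
  apply: Or31; apply: ramp1; have /= := htau z (conj Kz sp).
  rewrite mulNr lerBrDr => h; rewrite lerNr mulrC ler_pdivrMr//; lra.
have m01 z : 0 <= m z <= 1 by have /andP[/ltW-> ->] := m_bounds z.
have key z (Dz : D z) (Uz : U z) := div_field_ge (chi01 z) (m01 z) (ramp_bounds _ : 0 <= ze z <= 1)
  (proj1 (andP (be_bounds Dz))) (proj2 (andP (be_bounds Dz))) (W_ge1 z) (ltW delta0)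
  (chi_Z Dz (fun v1 v2 => chi_d z v1 v2 Dz)) (decay_pZ Dz) (A3 z Dz) (grad_be_E Dz)
  (ramp_term tau0 Dz Uz) (W_pX z) (eta_divX Dz) (cases z Dz).
have := @divergence_mean R M' s1 (cc - delta * c2) (delta * c2) z0.1 z0.2 _ _ _ _
  (fun z => C1_on_continuous openT CF2 I) (fun z => let: And4 _ _ c _ := CF1 z I in c)
  (fun z => let: And4 _ _ _ c := CF2 z I in c) (fun z => let: And4 c _ _ _ := CF1 z I in c)
  (fun z => let: And4 _ c _ _ := CF2 z I in c) s10.
move=> dm; suff : (cc - delta * c2) * s1 ^+ 2 <= delta * c2 * M' ^+ 2.
  by rewrite leNgt delta_small.
have dc0 : 0 <= delta * c2 by rewrite mulr_ge0// ltW.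
apply: dm => //.
- move=> x y h; have nK : ~ K (x, y).
    move=> /KDU[/DM[/= h1 h2] _]; by case: h; rewrite leNgt ?(le_lt_trans h1 MM) ?(le_lt_trans h2 MM).
  by have [e1' e2' _] := zF1 _ nK; have [e3 _ e4] := zF2 _ nK.
- move=> z; have [[Dz Uz]|nDU] := pselect ((D `&` U) z); last first.
    by rewrite /ext0 asboolF// addr0 oppr_le0.
  rewrite /ext0 asboolT//; apply: le_trans (key z Dz Uz).
  rewrite /c2 -[leLHS]add0r lerD2r; have /andP[c0 _] := chi01 z.
  have /andP[m0 _] := m01 z; have /andP[b0 _] := be_bounds Dz.
  by apply: divr_ge0 => //; apply: mulr_ge0 => //; exact: mulr_ge0.
- move=> x y hx hy; have [[Dz Uz] hv] := hs1 x y hx hy.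
  rewrite /ext0 asboolT//; apply: le_trans (key (x, y) Dz Uz).
  rewrite /c2 lerD2r; apply: le_trans hv _; rewrite /v.
  have hc := chi_half x y (le_trans hx s1s) (le_trans hy s1s).
  have /andP[m0 _] := m01 (x, y); have /andP[b0 _] := be_bounds Dz.
  have := ler_wpM2r (mulr_ge0 m0 b0) hc; lra.
Qed.
End cap.

(** * The cap at the farthest boundary point *)

Lemma sum_sqr_gt0 (R : realType) (x y : R) : (x, y) != (0, 0) -> 0 < x ^+ 2 + y ^+ 2.
Proof.
move=> h; rewrite lt_neqAle addr_ge0 ?sqr_ge0// andbT eq_sym paddr_eq0 ?sqr_ge0//.
by rewrite !sqrf_eq0 -[_ && _]/((x, y) == (0, 0)).
Qed.

Section farthest_point.
Variable R : realType.
Variables (D : set (R * R)) (M : R).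
Hypothesis oD : open D.
Hypothesis DM : forall z, D z -> `|z.1| <= M /\ `|z.2| <= M.
Implicit Types (z w p : R * R).

Let nrm2 z := z.1 ^+ 2 + z.2 ^+ 2.

Lemma continuous_nrm2 : continuous nrm2.
Proof.
move=> z; apply: (C1_on_continuous openT (D := setT)) => //.
have h1 := @C1_fst R setT 0; have h2 := @C1_snd R setT 0.
apply: C1_on_ext (C1_D (C1_M openT h1 h1) (C1_M openT h2 h2)) => w //=.
by rewrite /nrm2 !subr0 !expr2.
Qed.

Lemma closure_box z : closure D z -> `|z.1| <= M /\ `|z.2| <= M.
Proof.
have := compact_closed (@norm_hausdorff _ _) (@compact_box R M).
move=> cl; have : closure D `<=` closure [set z : R * R | `|z.1| <= M /\ `|z.2| <= M].
  by apply: closure_subset => w /DM.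
by move=> h /h /cl.
Qed.

Lemma compact_closure_box : compact (closure D).
Proof.
apply: subclosed_compact (@compact_box R M) _; first exact: closed_closure.
exact: closure_box.
Qed.

(** A point of [D] is not farthest from the origin: one can move outwards a little. *)
Lemma farthest_exists : D !=set0 -> exists p, [/\ closure D p, ~ D p,
  0 < nrm2 p & forall z, closure D z -> nrm2 z <= nrm2 p].
Proof.
move=> [w0 Dw0].
have [|||p cp hp] := @compact_EVT_max _ R nrm2 (closure D).
- by exists w0; exact: subset_closure.
- exact: compact_closure_box.
- exact: continuous_subspaceT continuous_nrm2.
have {}hp z : closure D z -> nrm2 z <= nrm2 p by move=> /mem_set; exact: hp.
have open_step w : D w -> exists2 t : R, 0 < t & D (w.1 + t, w.2) /\ D (w.1 + t * w.1, w.2 + t * w.2).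
  move=> Dw; have /near2P[r r0 hr] : nbhs w D by exact: open_nbhs_nbhs.
  pose N := 1 + `|w.1| + `|w.2|.
  have N1 : 1 <= N by rewrite /N -addrA lerDl addr_ge0.
  have N0 : 0 < N by exact: lt_le_trans N1.
  have t0 : 0 < r / (2 * N) by rewrite divr_gt0// mulr_gt0.
  have sm (s : R) : `|s| <= N -> `|r / (2 * N) * s| < r.
    move=> sN; rewrite normrM (gtr0_norm t0) mulrAC ltr_pdivrMr ?mulr_gt0//.
    by rewrite ltr_pM2l//; lra.
  exists (r / (2 * N)) => //; split; apply: hr; rewrite ?subrr ?normr0//
    opprD addNKr normrN.
  - by rewrite -[_ / _]mulr1; apply: sm; rewrite normr1.
  - by apply: sm; rewrite /N -addrA addrCA lerDl addr_ge0.
  - by apply: sm; rewrite /N lerDr addr_ge0.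
have n0 : 0 < nrm2 p.
  have [t t0 [Dt _]] := open_step _ Dw0.
  have [e|ne] := eqVneq w0.1 0.
    apply: lt_le_trans (hp _ (subset_closure Dt)).
    by apply: sum_sqr_gt0; rewrite e add0r; apply/eqP => -[h]; rewrite h ltxx in t0.
  apply: lt_le_trans (hp _ (subset_closure Dw0)).
  by apply: sum_sqr_gt0; apply/eqP => -[h]; rewrite h eqxx in ne.
exists p; split=> //; first exact: set_mem.
move=> Dp; have [t t0 [_ Dt]] := open_step _ Dp.
have := hp _ (subset_closure Dt).
have -> : nrm2 (p.1 + t * p.1, p.2 + t * p.2) = nrm2 p + (2 * t + t ^+ 2) * nrm2 p.
  by rewrite /nrm2 /=; ring.
rewrite gerDl leNgt mulr_gt0// ltr_wpDr ?sqr_ge0//; lra.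
Qed.
End farthest_point.

Definition local_defining (R : realType) (D : set (R * R)) (p : R * R) :=
  exists U rho r1 r2, [/\ open U, U p, C1_on U rho r1 r2, (r1 p, r2 p) != (0, 0) &
    forall z, U z -> D z <-> rho z < 0].

(** Let [p] be a point of the closure of [D] farthest from the origin and measure positions
    from [- p]. By the parallelogram law [|z - p| ^+ 2 + |z + p| ^+ 2 <= 4 |p| ^+ 2] on the
    closure, so that [|z + p| ^+ 2] has its strict maximum [L ^+ 2 = 4 |p| ^+ 2] at [p], and
    the points where it exceeds [L ^+ 2 - kap] are within [sqrt kap] of [p]. *)
Lemma bounded_graph_incomplete (R : realType) (D : set (R * R)) (M C : R)
    (u p1 p2 p11 p12 p22 : R * R -> R) :
  open D -> D !=set0 -> (forall z, D z -> `|z.1| <= M /\ `|z.2| <= M) ->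
  (forall p, closure D p -> ~ D p -> local_defining D p) ->
  C1_on D u p1 p2 -> C1_on D p1 p11 p12 -> C1_on D p2 p12 p22 ->
  (forall z, D z -> let W := Num.sqrt (1 + p1 z ^+ 2 + p2 z ^+ 2) in
    p11 z / W + p1 z * (- W ^- 2 * ((p1 z * p11 z + p2 z * p12 z) / W)) +
    (p22 z / W + p2 z * (- W ^- 2 * ((p1 z * p12 z + p2 z * p22 z) / W))) = C / W) ->
  ~ path_complete D p1 p2.
Proof.
move=> oD D0 DM bd uC p1C p2C PDE cpl.
have [p [clp nDp n0 far]] := farthest_exists oD DM D0.
have [U [rho [r1 [r2 [oU Up rhoC r12 Drho]]]]] := bd p clp nDp.
set nrm2 := fun z : R * R => z.1 ^+ 2 + z.2 ^+ 2 in n0 far.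
pose phi (z : R * R) := (z.1 - - p.1) ^+ 2 + (z.2 - - p.2) ^+ 2.
pose L := 2 * Num.sqrt (nrm2 p).
have L0 : 0 < L by rewrite mulr_gt0// sqrtr_gt0.
have L2 : L ^+ 2 = 4 * nrm2 p by rewrite exprMn sqr_sqrtr ?(ltW n0)//; ring.
have para z : closure D z -> (z.1 - p.1) ^+ 2 + (z.2 - p.2) ^+ 2 <= L ^+ 2 - phi z.
  by move=> /far; rewrite L2 /phi /nrm2; lra.
have phiL z : closure D z -> phi z <= L ^+ 2.
  by move=> /para; have := sqr_ge0 (z.1 - p.1); have := sqr_ge0 (z.2 - p.2); lra.
have phip : phi p = L ^+ 2 by rewrite L2 /phi /nrm2; ring.
pose G := r1 p ^+ 2 + r2 p ^+ 2.
have G0 : 0 < G by exact: sum_sqr_gt0.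
pose B := 1 + `|r1 p| + `|r2 p|.
have B0 : 1 <= B by rewrite /B -addrA lerDl addr_ge0.
have [_ _ cr1 cr2] := rhoC p Up.
pose d := Num.min 1 (G / (4 * B)).
have d0 : 0 < d by rewrite lt_min ltr01 divr_gt0// mulr_gt0//; lra.
have /continuous2P/(_ _ d0)[q1 q10 hq1] := cr1.
have /continuous2P/(_ _ d0)[q2 q20 hq2] := cr2.
have /near2P[qU qU0 hU] : nbhs p U by exact: open_nbhs_nbhs.
pose q := Num.min qU (Num.min q1 q2).
have q0 : 0 < q by rewrite !lt_min qU0 q10 q20.
(* the bounds make s0 nonnegative, put the cap into the square of radius q about p, and
   give C ^+ 2 g <= 8, in this order *)
pose kap := Num.min (Num.min (4 * nrm2 p) (q ^+ 2 / 2)) (8 / (C ^+ 2 + 1)).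
have C10 : 0 < C ^+ 2 + 1 by rewrite ltr_wpDl// sqr_ge0.
have kap0 : 0 < kap.
  by rewrite !lt_min mulr_gt0//= divr_gt0 ?exprn_gt0//= divr_gt0.
have [[kap1 kap2] kap3] : (kap <= 4 * nrm2 p /\ kap <= q ^+ 2 / 2) /\ kap <= 8 / (C ^+ 2 + 1).
  by rewrite /kap !ge_min !lexx !orbT.
pose s0 := L ^+ 2 - kap.
have near_p z : closure D z -> s0 <= phi z -> `|p.1 - z.1| < q /\ `|p.2 - z.2| < q.
  move=> /para h sp.
  have lt_q (t : R) : t ^+ 2 <= kap -> `|t| < q.
    move=> ht; rewrite -(ltr_pXn2r (n := 2)) ?nnegrE ?(ltW q0)//.
    rewrite -normrX ger0_norm ?sqr_ge0//.
    have : 0 < q ^+ 2 by rewrite exprn_gt0.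
    lra.
  have h1 := sqr_ge0 (z.1 - p.1); have h2 := sqr_ge0 (z.2 - p.2).
  by rewrite (distrC p.1) (distrC p.2); split; apply: lt_q; move: sp; rewrite /s0; lra.
have cap_near z : closure D z -> s0 <= phi z ->
   [/\ U z, `|r1 p - r1 z| < d & `|r2 p - r2 z| < d].
  move=> cz sp; have [ha hb] := near_p z cz sp.
  rewrite !lt_min in ha hb; case/and3P: ha => a1 a2 a3; case/and3P: hb => b1 b2 b3.
  have := hU _ _ a1 b1; have := hq1 _ _ a2 b2; have := hq2 _ _ a3 b3.
  by rewrite -!surjective_pairing.
have cphi : continuous phi.
  by move=> z; exact: C1_on_continuous openT (C1_phi (- p.1) (- p.2) openT) I.
have [z0 [Dz0 sz0]] : exists z0, D z0 /\ s0 < phi z0.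
  have := clp [set z | s0 < phi z]; case.
    have kp : s0 < phi p by rewrite phip /s0; lra.
    have /continuous2P/(_ _ kap0)[r r0 hr] := cphi p.
    apply/near2P; exists r => // x y h1 h2 /=.
    by have := hr x y h1 h2; rewrite ltr_norml phip /s0; lra.
  by move=> z [? ?]; exists z.
(* on the cap |X . grad rho| <= 2 B and grad rho (p) . grad rho >= G / 2, so this c makes
   the constant field c grad rho (p) dominate 8 L |X . grad rho| *)
pose c := 64 * L * B / G.
have c0 : 0 < c by rewrite divr_gt0// mulr_gt0//; [exact: mulr_gt0|lra].
have DUrho z : D z -> U z -> rho z < 0 by move=> Dz Uz; exact: (Drho z Uz).1.
have clphi : closed [set z | s0 <= phi z].
  apply: (@preimage_closed _ _ phi [set t | s0 <= t]); last exact: closed_ge.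
  by move=> z _; exact: cphi.
apply: (@no_complete_cap R D U u p1 p2 p11 p12 p22 rho r1 r2 C (- p.1) (- p.2) s0 L M
  oD oU DM uC p1C p2C _ PDE DUrho L0 _ _ _ _ _ (c * r1 p) (c * r2 p) _ z0 Dz0 sz0 cpl).
- by apply: C1_on_sub rhoC => z [].
- by rewrite /s0 subr_ge0 L2.
- by move=> z /subset_closure; exact: phiL.
- move=> z /subset_closure /phiL; rewrite -/(phi z) /s0 => h.
  apply: (@le_trans _ _ (C ^+ 2 * (8 / (C ^+ 2 + 1)))).
    by rewrite ler_wpM2l ?sqr_ge0//; lra.
  by rewrite mulrA ler_pdivrMr//; have := sqr_ge0 C; lra.
- by move=> z /subset_closure cz sp; have [] := cap_near z cz sp.
- move=> tau tau0; set A := [set z | _].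
  have AD : A `<=` D by move=> z [].
  apply: (subclosed_compact _ (@compact_box R M)); last by move=> z /AD /DM.
  move=> z cz.
  have cDz : closure D z by exact: closure_subset AD _ cz.
  have sz : s0 <= phi z.
    have Aphi : A `<=` [set z | s0 <= phi z] by move=> w [].
    exact: clphi (closure_subset Aphi cz).
  have [Uz _ _] := cap_near z cDz sz.
  have rz : rho z <= - tau.
    rewrite leNgt; apply/negP => h.
    have e0 : 0 < rho z + tau by lra.
    have /continuous2P/(_ _ e0)[r rr0 hr] := C1_on_continuous oU rhoC Uz.
    have [] := cz [set w | - tau < rho w].
      apply/near2P; exists r => // x y h1 h2 /=.
      by have := hr x y h1 h2; rewrite ltr_norml; lra.
    by move=> w [[_ _ _ h1] /= h2]; lra.
  split=> //; apply/(Drho z Uz); lra.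
- move=> z /subset_closure cz Uz sp x1 x2 hx.
  have [_ h1 h2] := cap_near z cz sp.
  have [d1 d2] : d <= 1 /\ d <= G / (4 * B) by rewrite /d !ge_min !lexx orbT.
  have le1 (s t : R) : s ^+ 2 + t ^+ 2 <= 1 -> `|s| <= 1.
    move=> h; rewrite -(ler_pXn2r (n := 2)) ?nnegrE// -normrX ger0_norm ?sqr_ge0// expr1n.
    by have := sqr_ge0 t; lra.
  have k1 : `|x1 * r1 z + x2 * r2 z| <= 2 * B.
    apply: le_trans (ler_normD _ _) _; rewrite !normrM.
    have b1 : `|r1 z| <= `|r1 p| + 1.
      by have := ler_distD (r1 p) (r1 z) 0; rewrite !subr0 distrC; lra.
    have b2 : `|r2 z| <= `|r2 p| + 1.
      by have := ler_distD (r2 p) (r2 z) 0; rewrite !subr0 distrC; lra.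
    have m1 : `|x1| * `|r1 z| <= `|r1 z| by rewrite ler_piMl//; exact: le1 hx.
    have m2 : `|x2| * `|r2 z| <= `|r2 z| by rewrite ler_piMl//; apply: (le1 _ x1); rewrite addrC.
    have := normr_ge0 (r1 p); have := normr_ge0 (r2 p); rewrite /B; lra.
  have k2 : G / 2 <= r1 p * r1 z + r2 p * r2 z.
    have e : r1 p * r1 z + r2 p * r2 z = G - (r1 p * (r1 p - r1 z) + r2 p * (r2 p - r2 z)).
      by rewrite /G; ring.
    have k3 : `|r1 p * (r1 p - r1 z) + r2 p * (r2 p - r2 z)| <= 2 * (B * d).
      apply: le_trans (ler_normD _ _) _; rewrite !normrM.
      have m1 : `|r1 p| * `|r1 p - r1 z| <= B * d.
        apply: ler_pM => //; last exact: ltW.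
        by rewrite /B; have := normr_ge0 (r2 p); lra.
      have m2 : `|r2 p| * `|r2 p - r2 z| <= B * d.
        apply: ler_pM => //; last exact: ltW.
        by rewrite /B; have := normr_ge0 (r1 p); lra.
      lra.
    have k4 : B * d <= G / 4.
      apply: (@le_trans _ _ (B * (G / (4 * B)))); first by rewrite ler_wpM2l//; lra.
      by rewrite le_eqVlt; apply/orP; left; apply/eqP; field; rewrite gt_eqF//; lra.
    by rewrite e; move: k3; rewrite ler_norml; lra.
  have -> : c * r1 p * r1 z + c * r2 p * r2 z = c * (r1 p * r1 z + r2 p * r2 z) by ring.
  apply: le_trans (ler_wpM2l (ltW c0) k2).
  have -> : c * (G / 2) = 8 * L * (4 * B) by rewrite /c; field; rewrite gt_eqF.
  by rewrite ler_wpM2l ?mulr_ge0 ?(ltW L0)//; lra.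
Qed.

(** * Row vectors of length two in coordinates *)

Section coordinates.
Variable R : realType.
Implicit Types (z w : R * R) (x : 'rV[R]_2).

Definition pt z : 'rV[R]_2 := \row_i (if i == 0 then z.1 else z.2).

Lemma pt_0 z : pt z 0 0 = z.1. Proof. by rewrite mxE. Qed.
Lemma pt_1 z : pt z 0 1 = z.2. Proof. by rewrite mxE. Qed.

Lemma ptK_coord x : x = pt (x 0 0, x 0 1).
Proof.
apply/rowP => i; rewrite mxE /=.
by case: i => [[|[|//]]] hi /=; congr (x _ _); apply/val_inj.
Qed.

Lemma nbhs_pt z (A : set 'rV[R]_2) :
  nbhs (pt z) A <-> exists2 r : R, 0 < r &
    forall a b, `|z.1 - a| < r -> `|z.2 - b| < r -> A (pt (a, b)).
Proof.
have [h1 h2] := nbhs_ballP (pt z) A; split=> [/h1[r /= r0 h]|[r r0 h]].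
  exists r => // a b ha hb; apply: h; split=> // i j; rewrite !mxE /ball /=.
  by case: ifP.
apply: h2; exists r => // y [_ hy]; rewrite (ptK_coord y); apply: h.
  by have := hy 0 0; rewrite /ball/= pt_0.
by have := hy 0 1; rewrite /ball/= pt_1.
Qed.

Lemma open_pt (A : set 'rV[R]_2) : open A -> open [set z | A (pt z)].
Proof.
move=> oA; rewrite openE => z Az.
have /nbhs_pt[r r0 h] : nbhs (pt z) A by exact: open_nbhs_nbhs.
by apply/near2P; exists r.
Qed.

Lemma continuous_pt (f : 'rV[R]_2 -> R) z :
  {for pt z, continuous f} -> {for z, continuous (fun w => f (pt w))}.
Proof.
move=> /cvgrPdist_lt cf; apply/continuous2P => e /cf /nbhs_pt[r r0 h].
by exists r.
Qed.

Lemma shift_pt0 z (h : R) : h *: delta_mx 0 0 + pt z = pt (h + z.1, z.2).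
Proof.
by apply/rowP => -[[|[|//]] hi]; rewrite !mxE/= ?mulr1// mulr0 add0r.
Qed.

Lemma shift_pt1 z (h : R) : h *: delta_mx 0 1 + pt z = pt (z.1, h + z.2).
Proof.
by apply/rowP => -[[|[|//]] hi]; rewrite !mxE/= ?mulr1// mulr0 add0r.
Qed.

Lemma quot_pt0 (f : 'rV[R]_2 -> R) z :
  (fun h => h^-1 *: (f (h *: delta_mx 0 0 + pt z) - f (pt z))) =
  (fun h : R => h^-1 *: (f (pt (h *: 1 + z.1, z.2)) - f (pt (z.1, z.2)))).
Proof. by apply/funext => h; rewrite shift_pt0 [h *: 1]mulr1 -surjective_pairing. Qed.

Lemma quot_pt1 (f : 'rV[R]_2 -> R) z :
  (fun h => h^-1 *: (f (h *: delta_mx 0 1 + pt z) - f (pt z))) =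
  (fun h : R => h^-1 *: (f (pt (z.1, h *: 1 + z.2)) - f (pt (z.1, z.2)))).
Proof. by apply/funext => h; rewrite shift_pt1 [h *: 1]mulr1 -surjective_pairing. Qed.

Lemma derive_pt0 (f : 'rV[R]_2 -> R) z :
  partial 0 f (pt z) = 'D_1 (fun a => f (pt (a, z.2))) z.1.
Proof. by rewrite /partial /derive quot_pt0. Qed.

Lemma derive_pt1 (f : 'rV[R]_2 -> R) z :
  partial 1 f (pt z) = 'D_1 (fun b => f (pt (z.1, b))) z.2.
Proof. by rewrite /partial /derive quot_pt1. Qed.

Lemma is_d1_pt (f : 'rV[R]_2 -> R) z : derivable f (pt z) (delta_mx 0 0) ->
  is_d1 (fun w => f (pt w)) z (partial 0 f (pt z)).
Proof.
move=> df; apply: DeriveDef; last by rewrite derive_pt0.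
by move: df; rewrite /derivable quot_pt0.
Qed.

Lemma is_d2_pt (f : 'rV[R]_2 -> R) z : derivable f (pt z) (delta_mx 0 1) ->
  is_d2 (fun w => f (pt w)) z (partial 1 f (pt z)).
Proof.
move=> df; apply: DeriveDef; last by rewrite derive_pt1.
by move: df; rewrite /derivable quot_pt1.
Qed.

Lemma C1_on_pt (O : set 'rV[R]_2) f : Ck_on 1 O f ->
  C1_on [set z | O (pt z)] (fun z => f (pt z)) (fun z => partial 0 f (pt z))
    (fun z => partial 1 f (pt z)).
Proof.
move=> [_ h] z /= Oz; have [d0 [c0 _]] := h 0; have [d1 [c1 _]] := h 1.
split; [exact/is_d1_pt/d0|exact/is_d2_pt/d1|exact/continuous_pt/c0|exact/continuous_pt/c1].
Qed.

Lemma C1_on_eq D (f f1 f2 g1 g2 : R * R -> R) : open D ->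
  (forall z, D z -> f1 z = g1 z) -> (forall z, D z -> f2 z = g2 z) ->
  C1_on D f f1 f2 -> C1_on D f g1 g2.
Proof.
move=> oD e1 e2 h z Dz; have [d1 d2 c1 c2] := h z Dz.
have tr (f3 f4 : R * R -> R) : (forall w, D w -> f3 w = f4 w) ->
    {for z, continuous f3} -> {for z, continuous f4}.
  move=> e /continuous2P c; apply/continuous2P => d /c[r r0 hr].
  have /near2P[r' r'0 hr'] : nbhs z D by exact: open_nbhs_nbhs.
  exists (Num.min r r') => [|x y]; first by rewrite lt_min r0.
  by rewrite !lt_min => /andP[x1 x2] /andP[y1 y2]; rewrite -!e//; [exact: hr|exact: hr'].
by split; [rewrite -e1|rewrite -e2|exact: tr c1|exact: tr c2].
Qed.

Section solution.
Variables (O : set 'rV[R]_2) (u : 'rV[R]_2 -> R).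
Hypothesis oO : open O.
Hypothesis su : smooth_on O u.
Let D := [set z | O (pt z)].
Let p1 z := partial 0 u (pt z).
Let p2 z := partial 1 u (pt z).
Let p11 z := partial 0 (partial 0 u) (pt z).
Let p12 z := partial 1 (partial 0 u) (pt z).
Let p22 z := partial 1 (partial 1 u) (pt z).

Lemma smooth_C1 : C1_on D (fun z => u (pt z)) p1 p2.
Proof. exact: C1_on_pt (su 1). Qed.

Lemma smooth_C1_1 : C1_on D p1 p11 p12.
Proof. by have [_ /(_ 0)[_ h]] := su 2; exact: C1_on_pt h. Qed.

Lemma smooth_C1_2 : C1_on D p2 p12 p22.
Proof.
have oD : open D by exact: open_pt.
have h : C1_on D p2 (fun z => partial 0 (partial 1 u) (pt z)) p22.
  by have [_ /(_ 1)[_ h]] := su 2; exact: C1_on_pt h.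
pose p21 z := partial 0 (partial 1 u) (pt z).
apply: (@C1_on_eq D p2 p21 p22 p12 p22 oD _ _ h) => z Dz; last reflexivity.
symmetry.
apply: (@schwarz R (fun z => u (pt z)) p1 p2 p12 p21 z).
- have /near2P[r r0 hr] : nbhs z D by exact: open_nbhs_nbhs.
  apply/near2P; exists r; first exact: r0.
  move=> x y hx hy; have Dw := hr _ _ hx hy.
  have [a1 a2 _ _] := smooth_C1 Dw; have [_ a3 _ _] := smooth_C1_1 Dw.
  have [a4 _ _ _] := h _ Dw; split; [exact: a1|exact: a2|exact: a3|exact: a4].
- by have [_ _ _ c] := smooth_C1_1 Dz.
- by have [_ _ c _] := h _ Dz.
Qed.

Lemma translator_coordinates (C : R) : translator_eq O C u ->
  forall z, D z -> let W := Num.sqrt (1 + p1 z ^+ 2 + p2 z ^+ 2) in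
    p11 z / W + p1 z * (- W ^- 2 * ((p1 z * p11 z + p2 z * p12 z) / W)) +
    (p22 z / W + p2 z * (- W ^- 2 * ((p1 z * p12 z + p2 z * p22 z) / W))) = C / W.
Proof.
move=> eq z Dz /=; have oD : open D by exact: open_pt.
have WE w : Num.sqrt (1 + enorm (grad u (pt w)) ^+ 2) =
    Num.sqrt (1 + p1 w ^+ 2 + p2 w ^+ 2).
  congr Num.sqrt; rewrite /enorm sqr_sqrtr; last by apply: sumr_ge0 => i _; exact: sqr_ge0.
  by rewrite !big_ord_recl big_ord0 !mxE addr0 addrA; congr (_ + _ ^+ 2 + partial _ _ _ ^+ 2); exact/val_inj.
have := eq _ Dz; rewrite WE => <-.
rewrite /divergence !big_ord_recl big_ord0 addr0.
have -> : lift ord0 ord0 = 1 :> 'I_2 by exact/val_inj.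
rewrite -[ord0]/(0 : 'I_2) derive_pt0 derive_pt1.
have [d1 _ _ _] := C1_X1 oD smooth_C1_1 smooth_C1_2 Dz.
have [_ d2 _ _] := C1_X2 oD smooth_C1_1 smooth_C1_2 Dz.
congr (_ + _); apply/esym.
  rewrite -(@derive_val _ _ _ _ _ _ _ d1).
  apply: (congr1 (fun F : R -> R => 'D_1 F z.1)); apply/funext => a.
  by rewrite /= !mxE WE mulrC.
rewrite -(@derive_val _ _ _ _ _ _ _ d2).
apply: (congr1 (fun F : R -> R => 'D_1 F z.2)); apply/funext => a.
by rewrite /= !mxE WE mulrC.
Qed.
End solution.

Lemma bounded_pt (O : set 'rV[R]_2) : bounded_set O ->
  exists M : R, forall z, O (pt z) -> `|z.1| <= M /\ `|z.2| <= M.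
Proof.
move=> [M [_ hM]]; exists (M + 1) => z /hM; move=> /(_ (M + 1)).
rewrite ltrDl ltr01 => /(_ isT) h.
have coord j : `|pt z 0 j| <= `|pt z|.
  rewrite [leRHS]/Num.Def.normr/= mx_normrE.
  exact: (le_bigmax _ (fun i => `|pt z i.1 i.2|) (0, j)).
by split; [rewrite -(pt_0 z)|rewrite -(pt_1 z)]; exact: le_trans (coord _) h.
Qed.

Lemma boundary_pt (O : set 'rV[R]_2) : smooth_boundary O ->
  forall p, closure [set z | O (pt z)] p -> ~ O (pt p) ->
  local_defining [set z | O (pt z)] p.
Proof.
move=> sb p clp nOp; have [|U [rho [oU Up srho gr Dr]]] := sb (pt p).
  split; last by move=> /interior_subset.
  move=> B /nbhs_pt[r r0 h].
  have [|[x y] [/= Oz [hx hy]]] := clp [set w | `|p.1 - w.1| < r /\ `|p.2 - w.2| < r].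
    by apply/near2P; exists r.
  by exists (pt (x, y)); split=> //; exact: h.
exists [set z | U (pt z)], (fun z => rho (pt z)), (fun z => partial 0 rho (pt z)),
  (fun z => partial 1 rho (pt z)); split=> //.
- exact: open_pt.
- exact: C1_on_pt (srho 1).
- apply: contra_neq (gr _ Up) => -[h0 h1]; apply/rowP => i; rewrite !mxE.
  by case: i => [[|[|//]] hi]; [rewrite -[RHS]h0|rewrite -[RHS]h1];
    congr (partial _ _ _); exact/val_inj.
- move=> z /= Uz; split=> [Oz|rz].
    have : (O `&` U) (pt z) by split.
    by rewrite Dr => -[].
  have : [set x | U x /\ rho x < 0] (pt z) by split.
  by rewrite -Dr => -[].
Qed.
End coordinates.

(** * From polygonal paths to C^1 curves *)

Section curves.
Variables (R : realType) (D : set (R * R)) (u u1 u2 : R * R -> R).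
Hypothesis oD : open D.
Hypothesis uC : C1_on D u u1 u2.
Implicit Types (x y z w : R * R) (a b s : R -> R) (c t : R).

(** A C^1 curve [(a, b)] in [D] from [x] to [y] that rests before time 0 and after
    time 1; the clock [s] bounds the length of its lift to the graph.  Rest at the ends
    makes concatenation a sum. *)
Record timed_curve x y c a b s a' b' s' : Prop := TimedCurve {
  tc_a : forall t, is_derive t 1 a (a' t);
  tc_b : forall t, is_derive t 1 b (b' t);
  tc_s : forall t, is_derive t 1 s (s' t);
  tc_ca : continuous a';
  tc_cb : continuous b';
  tc_cs : continuous s';
  tc_lo : forall t, t <= 0 -> [/\ (a t, b t) = x, s t = 0, a' t = 0, b' t = 0 & s' t = 0];
  tc_hi : forall t, 1 <= t -> [/\ (a t, b t) = y, s t = c, a' t = 0, b' t = 0 & s' t = 0];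
  tc_D : forall t, D (a t, b t);
  tc_s0 : forall t, 0 <= s' t;
  tc_len : forall t, lift_sqr (u1 (a t, b t)) (u2 (a t, b t)) (a' t) (b' t) <= s' t ^+ 2
}.

Definition timed x y c := exists a b s a' b' s', timed_curve x y c a b s a' b' s'.

Lemma timed_refl x : D x -> timed x x 0.
Proof.
move=> Dx; exists (cst x.1), (cst x.2), (cst 0), (cst 0), (cst 0), (cst 0).
split; rewrite /=; try (by move=> t; exact: is_derive_cst); try exact: cst_continuous.
- by move=> t _; rewrite -surjective_pairing.
- by move=> t _; rewrite -surjective_pairing.
- by rewrite -surjective_pairing.
- by [].
- by move=> t; rewrite /lift_sqr !mulr0 addr0 !expr0n !addr0.
Qed.

Lemma ramp'_rest t : t <= 0 \/ 1 <= t -> ramp' t = 0 :> R.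
Proof.
by rewrite /ramp' /pospart => -[h|h]; [rewrite !max_r|rewrite !max_l]; lra.
Qed.

Lemma timed_step x y c : gstep D u1 u2 x y c -> timed x y c.
Proof.
move=> [c0 st].
have affine (p q : R) t : is_derive t 1 (fun t => p + ramp t * q) (ramp' t * q).
  have h := is_deriveD (is_derive_cst p t 1) (is_deriveM (is_derive_ramp t) (is_derive_cst q t 1)).
  have -> : ramp' t * q = 0 + (ramp t *: 0 + q *: ramp' t).
    by rewrite /GRing.scale/=; ring.
  exact: h.
have caff (q : R) : continuous (fun t => ramp' t * q).
  by move=> t; apply: cvgM; [exact: continuous_ramp'|exact: cvg_cst].
exists (fun t => x.1 + ramp t * (y.1 - x.1)), (fun t => x.2 + ramp t * (y.2 - x.2)),
  (fun t => 0 + ramp t * c), (fun t => ramp' t * (y.1 - x.1)),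
  (fun t => ramp' t * (y.2 - x.2)), (fun t => ramp' t * c).
split=> // t.
- move=> h; rewrite ramp'_rest; last by left.
  by rewrite ramp0// !mul0r !addr0 -surjective_pairing.
- move=> h; rewrite ramp'_rest; last by right.
  by rewrite ramp1// !mul0r !mul1r add0r ![_ + (_ - _)]addrC !subrK -surjective_pairing.
- by have [] := st (ramp t) (ramp_bounds t).
- by rewrite mulr_ge0// ramp'_ge0.
- have [_ h] := st (ramp t) (ramp_bounds t); rewrite exprMn.
  apply: le_trans (ler_wpM2l (sqr_ge0 (ramp' t)) h).
  by rewrite /seg /lift_sqr /= le_eqVlt; apply/orP; left; apply/eqP; ring.
Qed.

Lemma scaled_is_derive (f f' : R -> R) (k t : R) : (forall t, is_derive t 1 f (f' t)) ->
  is_derive t 1 (fun t => f (2 * t - k)) (2 * f' (2 * t - k)).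
Proof.
move=> df; rewrite mulrC; apply: (@is_derive1_comp _ f (fun t => 2 * t - k)).
rewrite -[X in is_derive _ _ _ X]subr0; apply: is_deriveB.
by rewrite -[X in is_derive _ _ _ X]mulr1; exact: is_deriveZ.
Qed.

Lemma scaled_continuous (f : R -> R) (k : R) : continuous f ->
  continuous (fun t => 2 * f (2 * t - k)).
Proof.
move=> cf t; apply: cvgMr.
apply: (@continuous_comp _ _ _ (fun t => 2 * t - k) f); last exact: cf.
by apply: cvgB; [apply: cvgMr; exact: cvg_id|exact: cvg_cst].
Qed.

Lemma timed_trans x y z c c' : timed x y c -> timed y z c' -> timed x z (c + c').
Proof.
move=> [a [b [s [a' [b' [s' h1]]]]]] [e [f [r [e' [f' [r' h2]]]]]].
have glue (p p' q q' : R -> R) (k : R) t : (forall t, is_derive t 1 p (p' t)) ->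
    (forall t, is_derive t 1 q (q' t)) ->
    is_derive t 1 (fun t => p (2 * t - 0) + q (2 * t - 1) - k)
      (2 * p' (2 * t - 0) + 2 * q' (2 * t - 1)).
  move=> dp dq; rewrite -[X in is_derive _ _ _ X]subr0; apply: is_deriveB.
  by apply: is_deriveD; exact: scaled_is_derive.
have cglue (p' q' : R -> R) : continuous p' -> continuous q' ->
    continuous (fun t => 2 * p' (2 * t - 0) + 2 * q' (2 * t - 1)).
  by move=> cp cq t; apply: cvgD; exact: scaled_continuous.
have lo t : t <= 2^-1 -> [/\ (e (2 * t - 1), f (2 * t - 1)) = y, r (2 * t - 1) = 0,
   e' (2 * t - 1) = 0, f' (2 * t - 1) = 0 & r' (2 * t - 1) = 0].
  by move=> ht; apply: (tc_lo h2); lra.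
have hi t : 2^-1 <= t -> [/\ (a (2 * t - 0), b (2 * t - 0)) = y, s (2 * t - 0) = c,
   a' (2 * t - 0) = 0, b' (2 * t - 0) = 0 & s' (2 * t - 0) = 0].
  by move=> ht; apply: (tc_hi h1); lra.
exists (fun t => a (2 * t - 0) + e (2 * t - 1) - y.1),
  (fun t => b (2 * t - 0) + f (2 * t - 1) - y.2),
  (fun t => s (2 * t - 0) + r (2 * t - 1) - 0),
  (fun t => 2 * a' (2 * t - 0) + 2 * e' (2 * t - 1)),
  (fun t => 2 * b' (2 * t - 0) + 2 * f' (2 * t - 1)),
  (fun t => 2 * s' (2 * t - 0) + 2 * r' (2 * t - 1)).
have half t : (t <= 2^-1 /\ (a (2 * t - 0) + e (2 * t - 1) - y.1,
      b (2 * t - 0) + f (2 * t - 1) - y.2) = (a (2 * t - 0), b (2 * t - 0))) \/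
    (2^-1 <= t /\ (a (2 * t - 0) + e (2 * t - 1) - y.1,
      b (2 * t - 0) + f (2 * t - 1) - y.2) = (e (2 * t - 1), f (2 * t - 1))).
  have [ht|/ltW ht] := leP t 2^-1; [left|right]; split=> //.
    by have [<- _ _ _ _] := lo t ht; rewrite /= !addrK.
  by have [<- _ _ _ _] := hi t ht; rewrite /= ![_ + e _]addrC ![_ + f _]addrC !addrK.
split; try by [move=> t; apply: glue; [apply: tc_a h1|apply: tc_a h2]|
  move=> t; apply: glue; [apply: tc_b h1|apply: tc_b h2]|
  move=> t; apply: glue; [apply: tc_s h1|apply: tc_s h2]].
- exact: cglue (tc_ca h1) (tc_ca h2).
- exact: cglue (tc_cb h1) (tc_cb h2).
- exact: cglue (tc_cs h1) (tc_cs h2).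
- move=> t t0; have ht : t <= 2^-1 by lra.
  have [_ r0 e0 f0 r'0] := lo t ht.
  have [|p0 s0 a0 b0 s'0] := tc_lo h1 (t := 2 * t - 0); first by lra.
  have [[_ ->]|[ht' _]] := half t; last by lra.
  by rewrite p0 s0 a0 b0 s'0 r0 e0 f0 r'0 !mulr0 !addr0 subr0.
- move=> t t0; have ht : 2^-1 <= t by lra.
  have [_ s0 a0 b0 s'0] := hi t ht.
  have [|p0 r0 e0 f0 r'0] := tc_hi h2 (t := 2 * t - 1); first by lra.
  have [[ht' _]|[_ ->]] := half t; first by lra.
  by rewrite p0 s0 a0 b0 s'0 r0 e0 f0 r'0 !mulr0 !addr0 subr0.
- move=> t; have [[_ ->]|[_ ->]] := half t; [exact: tc_D h1 _|exact: tc_D h2 _].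
- by move=> t; rewrite addr_ge0// mulr_ge0//; [exact: tc_s0 h1 _|exact: tc_s0 h2 _].
- move=> t; have sc (p q v1 v2 d : R) : lift_sqr p q v1 v2 <= d ^+ 2 ->
      lift_sqr p q (2 * v1) (2 * v2) <= (2 * d) ^+ 2.
    rewrite (_ : lift_sqr p q (2 * v1) (2 * v2) = 2 ^+ 2 * lift_sqr p q v1 v2); last by rewrite /lift_sqr; ring.
    by move=> h; rewrite exprMn ler_wpM2l ?sqr_ge0.
  have [[ht ->]|[ht ->]] := half t.
    have [_ _ -> -> ->] := lo t ht; rewrite !mulr0 !addr0; apply: sc.
    exact: tc_len h1 _.
  have [_ _ -> -> ->] := hi t ht; rewrite !mulr0 !add0r; apply: sc.
  exact: tc_len h2 _.
Qed.

Lemma gpath_timed x y c : gpath D u1 u2 x y c -> timed x y c.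
Proof.
elim=> [z Dz|x' y' z c1 c2 _ IH /timed_step st]; first exact: timed_refl.
exact: timed_trans IH st.
Qed.
End curves.

Section graph_curves.
Variables (R : realType) (O : set 'rV[R]_2) (u : 'rV[R]_2 -> R).
Hypothesis oO : open O.
Hypothesis su : smooth_on O u.
Let D : set (R * R) := [set z | O (pt z)].
Let p1 (z : R * R) := partial 0 u (pt z).
Let p2 (z : R * R) := partial 1 u (pt z).

Definition lift3 (z : R * R) : 'rV[R]_3 := row_mx (pt z) (u (pt z))%:M.

Lemma lift3_0 z : lift3 z 0 0 = z.1.
Proof.
have e : 0 = lshift 1 (0 : 'I_2) :> 'I_(2 + 1) by exact/val_inj.
by rewrite -(pt_0 z) -(row_mxEl (pt z) (u (pt z))%:M) -e.
Qed.

Lemma lift3_1 z : lift3 z 0 1 = z.2.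
Proof.
have e : 1 = lshift 1 (1 : 'I_2) :> 'I_(2 + 1) by exact/val_inj.
by rewrite -(pt_1 z) -(row_mxEl (pt z) (u (pt z))%:M) -e.
Qed.

Lemma lift3_2 z : lift3 z 0 (inord 2) = u (pt z).
Proof.
have e : inord 2 = rshift 2 (0 : 'I_1) :> 'I_(2 + 1) by apply/val_inj; rewrite /= inordK.
transitivity ((u (pt z))%:M 0 (0 : 'I_1)); last by rewrite mxE.
by rewrite -(row_mxEr (pt z) (u (pt z))%:M) -e.
Qed.

Lemma graph_lift3 z : D z -> graph_over O u (lift3 z).
Proof. by move=> Dz; exists (pt z). Qed.

Lemma graph_overP q : graph_over O u q -> exists2 z, D z & q = lift3 z.
Proof.
by move=> [x Ox <-]; exists (x 0 0, x 0 1); rewrite /D /lift3 /= -ptK_coord.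
Qed.

Lemma ord3P (P : 'I_3 -> Prop) : P 0 -> P 1 -> P (inord 2) -> forall i, P i.
Proof.
move=> h0 h1 h2 i; have : i \in [:: 0; 1; inord 2].
  by case: i => -[|[|[|//]]] hi; rewrite !inE -!val_eqE /= ?inordK.
by rewrite !inE => /or3P[] /eqP ->.
Qed.

Lemma derivable_lift3 (a b a' b' : R -> R) (t : R) :
  (forall t, D (a t, b t)) -> (forall t : R, is_derive t 1 a (a' t)) ->
  (forall t : R, is_derive t 1 b (b' t)) ->
  let g t := lift3 (a t, b t) in
  [/\ derivable g t 1, derive1 g t 0 0 = a' t, derive1 g t 0 1 = b' t &
    derive1 g t 0 (inord 2) = p1 (a t, b t) * a' t + p2 (a t, b t) * b' t].
Proof.
move=> Dab da db g.
have oD : open D by exact: open_pt.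
have du : is_derive t 1 (fun t => u (pt (a t, b t)))
    (p1 (a t, b t) * a' t + p2 (a t, b t) * b' t).
  have h := smooth_C1 su.
  have [_ _ c1 c2] := h _ (Dab t).
  have nD : nbhs (a t, b t) D by apply: open_nbhs_nbhs; split=> //; exact: Dab.
  apply: (@chain2 R (fun z => u (pt z)) p1 p2 a b t _ _ _ _ c1 c2 (da t) (db t)).
    by move: nD; apply: filterS => z /h[].
  by move: nD; apply: filterS => z /h[].
have g0 : (fun t => g t 0 0) = a by apply/funext => s; rewrite /g lift3_0.
have g1 : (fun t => g t 0 1) = b by apply/funext => s; rewrite /g lift3_1.
have g2 : (fun t => g t 0 (inord 2)) = (fun t => u (pt (a t, b t))).
  by apply/funext => s; rewrite /g lift3_2.
have dg : derivable g t 1.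
  apply/derivable_mxP => i; rewrite (ord1 i).
  by apply: ord3P; rewrite ?g0 ?g1 ?g2; [case: (da t)|case: (db t)|case: du].
split=> //; rewrite derive1E derive_mx// mxE ?g0 ?g1 ?g2; exact: derive_val.
Qed.
End graph_curves.

(** * Lengths of curves and the intrinsic distance *)

Section lengths.
Variable R : realType.
Notation mu := (@lebesgue_measure R).

Lemma continuous_rV n (M : R -> 'rV[R]_n) :
  (forall j, continuous (fun t => M t 0 j)) <-> continuous M.
Proof.
split=> [h t|cM j t]; last first.
  apply: (@continuous_comp _ _ _ M (fun x => x 0 j)); first exact: cM.
  exact: coord_continuous.
apply/cvgrPdist_le => /= e e0; near=> x.
rewrite /Num.Def.normr/= mx_normrE (bigmax_le _ (ltW e0))//= => -[i j] _.
rewrite (ord1 i) !mxE/= {i}.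
move: j; near: x; apply: filter_forall => /= j.
exact: ((cvgrPdist_le _ _).1 (h j t)).
Unshelve. all: by end_near. Qed.

Lemma enorm_ge_coord n (v : 'rV[R]_n) k : `|v 0 k| <= enorm v.
Proof.
rewrite /enorm -sqrtr_sqr ler_wsqrtr// (bigD1 k)//= lerDl.
by apply: sumr_ge0 => i _; exact: sqr_ge0.
Qed.

Lemma continuous_enorm n (M : R -> 'rV[R]_n) : continuous M ->
  continuous (fun t => enorm (M t)).
Proof.
move=> /continuous_rV cM t.
apply: (@continuous_comp _ _ _ (fun t => \sum_(i < n) M t 0 i ^+ 2) Num.sqrt).
  apply: cvg_big => //; first by move=> x; exact: add_continuous.
  move=> i _; apply: (@continuous_comp _ _ _ (fun t => M t 0 i) (fun x => x ^+ 2)).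
    exact: cM.
  exact: exprn_continuous.
exact: sqrt_continuous.
Qed.

Lemma measurable_continuous (A : set R) (f : R -> R) : measurable A -> continuous f ->
  measurable_fun A f.
Proof. by move=> mA cf; apply: measurable_funTS; exact: continuous_measurable_fun.
Qed.

Lemma integral_FTC (a b : R) (f F : R -> R) : a < b -> continuous f ->
  (forall t : R, is_derive t 1 F (f t)) ->
  (\int[mu]_(t in `[a, b]) (f t)%:E)%E = (F b - F a)%:E.
Proof.
move=> ab cf dF; have cF x : {for x, continuous F} by exact: is_derive_continuous (dF x).
rewrite (@continuous_FTC2 R f F a b ab) -?EFinB//.
- exact: continuous_subspaceT.
- by split; [move=> x _; case: (dF x)|apply: cvg_at_right_filter; exact: cF|apply: cvg_at_left_filter; exact: cF].
- by move=> x _; rewrite derive1E; exact: derive_val.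
Qed.

Lemma enorm_ge0 n (v : 'rV[R]_n) : 0 <= enorm v.
Proof. exact: sqrtr_ge0. Qed.

(** The derivatives of [g] and [h] agree only inside the interval; the half-open interval
    lets consecutive pieces be added without overlap. *)
Lemma C1_piece_length n (g h : R -> 'rV[R]_n.+1) (a b : R) k : a < b -> C1_curve h ->
  {in `[a, b], g =1 h} ->
  measurable_fun (`[a, b[ : set R) (fun t => enorm (derive1 g t)) /\
  (`|g b 0 k - g a 0 k|%:E <= \int[mu]_(t in `[a, b[) (enorm (derive1 g t))%:E)%E.
Proof.
move=> ab [dh ch] gh.
have ce : continuous (fun t => enorm (derive1 h t)) by exact: continuous_enorm.
have eqd t : `]a, b[%classic t -> derive1 g t = derive1 h t.
  move=> tI; rewrite !derive1E; apply: near_eq_derive.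
  have : nbhs t `]a, b[%classic by apply: open_nbhs_nbhs; split=> //; exact: interval_open.
  apply: filterS => s sI; apply: gh.
  by move: sI; rewrite /= !in_itv/= => /andP[/ltW -> /ltW ->].
have mo : measurable_fun (`]a, b[ : set R) (fun t => enorm (derive1 g t)).
  apply: (eq_measurable_fun (fun t => enorm (derive1 h t))).
    by move=> t /set_mem tI; rewrite eqd.
  exact: measurable_continuous.
split; first exact/measurable_fun_itv_obnd_cbndP.
rewrite integral_itv_bndoo; last exact/measurable_EFinP.
have -> : (\int[mu]_(t in `]a, b[) (enorm (derive1 g t))%:E =
    \int[mu]_(t in `]a, b[) (enorm (derive1 h t))%:E)%E.
  by apply: eq_integral => t tI; rewrite eqd//; exact: set_mem.
have mh (A : set R) : measurable A -> measurable_fun A (fun t => enorm (derive1 h t)).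
  by move=> mA; exact: (measurable_continuous mA ce).
rewrite -(integral_itv_bndoo true false); last by apply/measurable_EFinP; exact: mh.
have dhk (t : R) : is_derive t 1 (fun t => h t 0 k) (derive1 h t 0 k).
  have dk := (derivable_mxP h t 1).1 (dh t) 0 k.
  by apply: DeriveDef => //; rewrite derive1E derive_mx// mxE.
have chk : continuous (fun t => derive1 h t 0 k) by move/continuous_rV: ch; exact.
have := integral_FTC ab chk dhk => e.
apply: (@le_trans _ _ `|\int[mu]_(t in `[a, b]) (derive1 h t 0 k)%:E|%E).
  by rewrite e !gh// in_itv/= lexx ?(ltW ab).
apply: le_trans (le_abse_integral _ _ _) _ => //.
  by apply/measurable_EFinP; exact: measurable_continuous.
apply: ge0_le_integral => //.
- apply: measurableT_comp => //.
  by apply/measurable_EFinP; exact: measurable_continuous.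
- by apply/measurable_EFinP; exact: mh.
- by move=> t _; rewrite /= lee_fin; exact: enorm_ge_coord.
Qed.

Lemma curve_length_ge n (g : R -> 'rV[R]_n.+1) k : piecewise_C1 g ->
  (`|g 1 0 k - g 0 0 k|%:E <= curve_length g)%E.
Proof.
move=> [s [ps ls hs]].
pose t i := nth 0 (0 :: s) i.
pose F x := enorm (derive1 g x).
have tlt i : (i < size s)%N -> t i < t i.+1 by move=> hi; exact: (pathP 0 ps).
have tge i : (i <= size s)%N -> 0 <= t i.
  elim: i => [//|i IH hi]; apply: le_trans (ltW (tlt i hi)); exact/IH/ltnW.
have main i : (i <= size s)%N -> measurable_fun (`[0, t i[ : set R) F /\
    (`|g (t i) 0 k - g 0 0 k|%:E <= \int[mu]_(x in `[0%R, t i[) (F x)%:E)%E.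
  elim: i => [_|i IH hi].
    rewrite /t /= subrr normr0 set_itvco0; split; first exact: measurable_fun_set0.
    by rewrite integral_set0.
  have [mi li] := IH (ltnW hi).
  have [h [hC gh]] := hs i hi.
  have [mp lp] := C1_piece_length k (tlt i hi) hC gh.
  have ti := tge i (ltnW hi).
  have U : (`[0, t i.+1[ = `[0, t i[ `|` `[t i, t i.+1[ :> set R)%classic.
    by apply: itv_bndbnd_setU; rewrite bnd_simp// ltW// tlt.
  have mU : measurable_fun (`[0, t i[ `|` `[t i, t i.+1[ : set R) F.
    exact/measurable_funU.
  split; first by rewrite U.
  rewrite U ge0_integral_setU//=; last 3 first.
  - exact/measurable_EFinP.
  - by move=> x _; rewrite lee_fin enorm_ge0.
  - apply/disj_setPS => x [] /=; rewrite !in_itv/= => /andP[_ h1] /andP[h2 _].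
    by move: (lt_le_trans h1 h2); rewrite ltxx.
  apply: le_trans (leeD li lp); rewrite -EFinD lee_fin [leRHS]addrC.
  exact: ler_distD.
have [] := main (size s) (leqnn _).
have -> : t (size s) = 1 by rewrite /t -ls nth_last.
move=> m1 l1; apply: le_trans l1 _; rewrite /curve_length -/F.
have mo : measurable_fun (`]0, 1[ : set R) F by exact/measurable_fun_itv_obnd_cbndP.
have mo' := (measurable_EFinP _ _).2 mo.
by rewrite (integral_itv_bndoo true true mo') (integral_itv_bndoo true false mo').
Qed.

Lemma intrinsic_dist_ge n (S : set 'rV[R]_n.+1) (P Q : 'rV[R]_n.+1) k :
  (`|Q 0 k - P 0 k|%:E <= intrinsic_dist S P Q)%E.
Proof.
by apply: le_ereal_inf_tmp => _ [g [pg _ <- <-] <-]; exact: curve_length_ge.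
Qed.
End lengths.

(** A polygonal path, run so that it rests at each vertex, is a C^1 curve on the graph, and
    its clock dominates its length. *)
Lemma intrinsic_dist_le (R : realType) (O : set 'rV[R]_2) (u : 'rV[R]_2 -> R) x y c :
  open O -> smooth_on O u ->
  gpath [set z | O (pt z)] (fun z => partial 0 u (pt z)) (fun z => partial 1 u (pt z)) x y c ->
  (intrinsic_dist (graph_over O u) (lift3 u x) (lift3 u y) <= c%:E)%E.
Proof.
move=> oO su /gpath_timed[a [b [s [a' [b' [s' h]]]]]].
pose g t := lift3 u (a t, b t).
have dg t := derivable_lift3 oO su t (tc_D h) (tc_a h) (tc_b h).
have C1u := smooth_C1 su.
have oD : open [set z : R * R | O (pt z)] by exact: open_pt.
have cab : continuous (fun t => (a t, b t)).
  move=> t; exact: (cvg_pair (is_derive_continuous (tc_a h t))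
    (is_derive_continuous (tc_b h t))).
have cg : continuous (derive1 g).
  apply/continuous_rV; apply: ord3P.
  - rewrite (_ : (fun t => _) = a'); last by apply/funext => t; have [] := dg t.
    exact: tc_ca h.
  - rewrite (_ : (fun t => _) = b'); last by apply/funext => t; have [] := dg t.
    exact: tc_cb h.
  - rewrite (_ : (fun t => _) = (fun t => partial 0 u (pt (a t, b t)) * a' t +
      partial 1 u (pt (a t, b t)) * b' t)); last by apply/funext => t; have [] := dg t.
    move=> t; have [_ _ c1 c2] := C1u _ (tc_D h t).
    apply: cvgD; apply: cvgM; try exact: (tc_ca h); try exact: (tc_cb h).
    + exact: (@continuous_comp _ _ _ (fun t => (a t, b t)) (fun z => partial 0 u (pt z)) t (cab t) c1).
    + exact: (@continuous_comp _ _ _ (fun t => (a t, b t)) (fun z => partial 1 u (pt z)) t (cab t) c2).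
have C1g : C1_curve g.
  by split=> [t|]; [have [dgt _ _ _] := dg t; exact: dgt|exact: cg].
apply: ge_ereal_inf; exists (curve_length g).
  exists g => //; split.
  - exists [:: 1]; split=> //=; first by rewrite ltr01.
    by move=> i _; exists g.
  - by move=> t _; exact: graph_lift3 (tc_D h t).
  - by rewrite /g; have [-> _ _ _ _] := tc_lo h (lexx 0).
  - by rewrite /g; have [-> _ _ _ _] := tc_hi h (lexx 1).
have -> : c = s 1 - s 0.
  by have [_ -> _ _ _] := tc_lo h (lexx 0); have [_ -> _ _ _] := tc_hi h (lexx 1); rewrite subr0.
rewrite -(integral_FTC ltr01 (tc_cs h) (tc_s h)) /curve_length.
apply: ge0_le_integral => //.
- by move=> t _; rewrite lee_fin enorm_ge0.
- by apply/measurable_EFinP; apply: measurable_continuous => //; exact: continuous_enorm.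
- by apply/measurable_EFinP; apply: measurable_continuous => //; exact: tc_cs h.
move=> t _; rewrite lee_fin.
have [_ e0 e1 e2] := dg t.
rewrite -(ler_pXn2r (n := 2)) ?nnegrE ?enorm_ge0 ?(tc_s0 h)//.
apply: le_trans (tc_len h t); rewrite /enorm sqr_sqrtr; last first.
  by apply: sumr_ge0 => i _; exact: sqr_ge0.
rewrite !big_ord_recl big_ord0 addr0 /lift_sqr.
have -> : lift ord0 ord0 = 1 :> 'I_3 by exact/val_inj.
have -> : lift ord0 (lift ord0 ord0) = inord 2 :> 'I_3 by apply/val_inj; rewrite /= inordK.
by rewrite -/g e0 e1 e2 addrA.
Qed.

(** * Non-existence *)

(** The intrinsic distance lies between the differences of the first two coordinates and
    the cost of polygonal paths. *)
Lemma graph_path_complete (R : realType) (O : set 'rV[R]_2) (u : 'rV[R]_2 -> R) :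
  open O -> smooth_on O u -> intrinsically_complete (graph_over O u) ->
  path_complete [set z | O (pt z)] (fun z => partial 0 u (pt z))
    (fun z => partial 1 u (pt z)).
Proof.
move=> oO su cpl f Df cauchy.
have [i|e e0|q Sq cq] := cpl (fun i => lift3 u (f i)).
- exact: graph_lift3 (Df i).
- have [N hN] := cauchy e e0; exists N => i j Ni Nj.
  have [c p ce] := hN i j Ni Nj.
  by apply: le_lt_trans (intrinsic_dist_le oO su p) _; rewrite lte_fin.
have [p Dp qE] := graph_overP Sq; exists p => // e e0.
have [N hN] := cq e e0; exists N => i Ni.
have coord k : `|lift3 u p 0 k - lift3 u (f i) 0 k| < e.
  rewrite -lte_fin; apply: le_lt_trans (hN i Ni); rewrite qE.
  exact: intrinsic_dist_ge.
by split; [have := coord 0; rewrite !lift3_0|have := coord 1; rewrite !lift3_1].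
Qed.

Unset Implicit Arguments.

Theorem theorem4p2 (R : realType) (Omega : set 'rV[R]_2) (C : R) :
  domain Omega -> bounded_set Omega -> smooth_boundary Omega -> C != 0 ->
  ~ exists u : 'rV[R]_2 -> R,
      [/\ smooth_on Omega u,
          translator_eq Omega C u &
          intrinsically_complete (graph_over Omega u)].
Proof.
move=> [oO _ [x Ox]] bO sb _ [u [su eq cpl]].
have [M DM] := bounded_pt bO.
apply: (bounded_graph_incomplete (open_pt oO) _ DM (boundary_pt sb) (smooth_C1 su)
  (smooth_C1_1 su) (smooth_C1_2 oO su) (translator_coordinates oO su eq)).
  by exists (x 0 0, x 0 1); rewrite /= -ptK_coord.
exact: graph_path_complete.
Qed.
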